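(* Consider the longitudinal setting of the context with univariate instruments, and assume: (consistency) $Y=Y(\overline{A})$; (latent ignorability) for every $t$, $\{Z_t,A_t\}$ is conditionally independent of $Y(\underline{a}_t)$ given $(H_t,\overline{U}_t)$; (IV independence) for every $t$, $Z_t$ is conditionally independent of $\overline{U}_t$ given $H_t$. Suppose that for each $t=0,\dots,T$, $\pi_t(Z_t,H_t)=Z_t$ is a regular weighting function for $A_t$. Let $\overline g=[g_0,\dots,g_T]$ be a deterministic dynamic treatment regime with $g_t:\mathcal{H}_t\to\mathcal{A}_t$, let $A_t^{(g_t)}:=I\{A_t=g_t(H_t)\}$, and $$\psi^o_{\overline g}:=\mathbb{E}\left[\prod_{t=0}^T\frac{(Z_t-\rho_t^o(H_t))A_t^{(g_t)}}{\kappa^o_{t,g_t}(H_t)}\,Y\right].$$ Then, in the nonparametric model for the law of $O$, the efficient influence function for $\psi^o_{\overline g}$ is $\varphi_{\overline g}(O;\psi^o_{\overline g},\alpha^o_{\overline g})$, where $$\varphi_{\overline g}(O;\psi_{\overline g},\alpha_{\overline g}):=\prod_{t=0}^T\frac{\{Z_t-\rho_t(H_t)\}A_t^{(g_t)}}{\kappa_{t,g_t}(H_t)}Y-\psi_{\overline g}+\sum_{t=0}^T\left(\prod_{s=0}^{t-1}\frac{\{Z_s-\rho_s(H_s)\}A_s^{(g_s)}}{\kappa_{s,g_s}(H_s)}\right)\left\{\left(1-\frac{\{Z_t-\rho_t(H_t)\}\{A_t^{(g_t)}-\delta_{t,g_t}(H_t)\}}{\kappa_{t,g_t}(H_t)}\right)\gamma_{t,\underline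 g_t}(H_t)-\frac{(Z_t-\rho_t(H_t))\eta_{t,\underline g_t}(H_t)}{\kappa_{t,g_t}(H_t)}\right\}.$$
   Context: Times $t=0,\dots,T$. At time $t$: $L_t$ observed confounders, $U_t$ unobserved confounders, $Z_t\in\mathbb{R}$ an instrument, $A_t\in\mathcal{A}_t$ a discrete treatment (finite $\mathcal{A}_t$); $Y\in\mathbb{R}$ is an outcome observed at time $T+1$. $\overline{x}_t=[x_0,\dots,x_t]$, $\underline{x}_t=[x_t,\dots,x_T]$, $\overline{x}=\overline{x}_T$; empty products equal 1. $H_t=[\overline{Z}_{t-1},\overline{A}_{t-1},\overline{L}_t]\in\mathcal{H}_t$ for $0\le t\le T$, $H_{T+1}=O=[\overline{Z}_T,\overline{A}_T,\overline{L}_T,Y]$. $Y(\overline a)$ is the potential outcome under treatment history $\overline a$; $Y(\underline a_t)=Y(\overline A_{t-1},\underline a_t)$. $Z_t$ is a regular weighting function for $A_t$ if it is uniformly bounded and for each $a_t\in\mathcal{A}_t$ there is $\epsilon_0>0$ with $|\mathrm{Cov}\{I\{A_t=a_t\},Z_t\mid H_t=h_t\}|\ge\epsilon_0$ for all $h_t\in\mathcal{H}_t$. True nuisances: $\gamma^o_{T+1,\underline g_{T+1}}(H_{T+1}):=Y$, and for $t=T,\dots,0$: $\delta^o_{t,g_t}(H_t)=\mathbb{E}[A_t^{(g_t)}\mid H_t]$, $\rho^o_t(H_t)=\mathbb{E}[Z_t\mid H_t]$, $\kappa^o_{t,g_t}(H_t)=\mathrm{Cov}\{A_t^{(g_t)},Z_t\mid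 H_t\}$, $\eta^o_{t,\underline g_t}(H_t)=\mathbb{E}[A_t^{(g_t)}\gamma^o_{t+1,\underline g_{t+1}}(H_{t+1})\mid H_t]$, $\gamma^o_{t,\underline g_t}(H_t)=\mathrm{Cov}\{A_t^{(g_t)}\gamma^o_{t+1,\underline g_{t+1}}(H_{t+1}),Z_t\mid H_t\}/\kappa^o_{t,g_t}(H_t)$. $\alpha^o_{\overline g}=\{[\delta^o_{t,g_t},\kappa^o_{t,g_t},\rho^o_t,\eta^o_{t,\underline g_t},\gamma^o_{t,\underline g_t}]\}_{t=0}^T$; $\alpha_{\overline g}$ denotes a generic such vector. The semiparametric analysis is in the fully nonparametric model for the observed data (tangent space equal to all mean-zero square-integrable functions of $O$), so the efficient influence function is the unique mean-zero square-integrable $\varphi$ with $\frac{d}{d\theta}\psi_{\overline g}(P_\theta)|_{\theta=0}=\mathbb{E}[\varphi(O)s(O)]$ for every regular parametric submodel $P_\theta$ through the true law with score $s$ at $\theta=0$, where $\psi_{\overline g}(P)$ is the displayed functional evaluated under $P$.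
   Formalization: Assumes E[Y²]<∞ (else φ need not be square-integrable) and measurable g_t; regular submodels are quadratic-mean-differentiable paths along which Z_t stays bounded, the conditional covariances stay away from 0 and E[Y²] stays bounded, uniformly near the truth. *)

(* Defs.v *)
From HB Require Import structures.
From mathcomp Require Import all_boot all_order all_algebra.
From mathcomp Require Import all_classical all_reals all_analysis.

Set Implicit Arguments.
Unset Strict Implicit.
Unset Printing Implicit Defensive.
Import Order.TTheory GRing.Theory Num.Theory.
Import numFieldNormedType.Exports.

Local Open Scope classical_set_scope.
Local Open Scope ring_scope.

Section product_space.
Variables (I : Type) (d : I -> measure_display).
Variable X : forall i, measurableType (d i).

Definition cylinders : set (set (forall i, X i)) :=
  [set C | exists i (B : set (X i)),
             measurable B /\ C = (fun f => f i) @^-1` B].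

Lemma measurable_cylinders (d' : measure_display) (S : measurableType d')
    (f : S -> g_sigma_algebraType cylinders) :
  (forall i, measurable_fun [set: S] (fun x => f x i)) ->
  measurable_fun [set: S] f.
Proof.
move=> mf; apply: (@measurability _ _ S (g_sigma_algebraType cylinders) _ _
  cylinders erefl).
by move=> _ [_ [i [B [mB ->]]] <-]; exact: (mf i measurableT B mB).
Qed.

End product_space.
Arguments cylinders {I d} X.

(* The product of a family of measurable spaces, with the sigma-algebra
   generated by the coordinate projections. *)
Notation prod_space X := (g_sigma_algebraType (cylinders X)).

Section conditioning.
Context {d dS : measure_display} {Omega : measurableType d}
  {S : measurableType dS} {R : realType}.
Variables (P : probability Omega R) (W : Omega -> S).

(* r is a version of the regression function w |-> E[X | W = w] *)
Definition is_cond_mean (X : Omega -> R) (r : S -> R) : Prop :=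
  [/\ measurable_fun [set: S] r,
      P.-integrable [set: Omega] (fun w => (r (W w))%:E) &
      forall B : set S, measurable B ->
        (\int[P]_(w in W @^-1` B) (r (W w))%:E =
         \int[P]_(w in W @^-1` B) (X w)%:E)%E].

(* E[X | W = .] for integrable X: some fixed version, two versions being equal
   almost everywhere for the law of W. *)
Definition cond_mean (X : Omega -> R) : S -> R := get (is_cond_mean X).

Definition cond_cov (X Y : Omega -> R) (s : S) : R :=
  cond_mean (fun w => X w * Y w) s - cond_mean X s * cond_mean Y s.

Definition cond_prob (E : set Omega) : S -> R := cond_mean (\1_E).

Definition cond_indep {dE dF : measure_display} {E : measurableType dE}
    {F : measurableType dF} (X : Omega -> E) (Y : Omega -> F) : Prop :=
  forall (B : set E) (C : set F), measurable B -> measurable C ->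
    {ae P, forall w, cond_prob (X @^-1` B `&` Y @^-1` C) (W w) =
                     cond_prob (X @^-1` B) (W w) * cond_prob (Y @^-1` C) (W w)}.

End conditioning.

Section influence_functions.
Context {d : measure_display} {O : measurableType d} {R : realType}.

(* The path Q, differentiable in quadratic mean at 0 with score s, for densities
   with respect to some sigma-finite measure. *)
Definition qmd_submodel (P : probability O R) (Q : R -> probability O R)
    (s : O -> R) : Prop :=
  [/\ forall B, measurable B -> Q 0 B = P B,
      s \in Lfun P 2%:E &
      exists (nu : {sigma_finite_measure set O -> \bar R}) (f : R -> O -> R),
        (\forall theta \near (0 : R),
           [/\ measurable_fun [set: O] (f theta),
               forall o, 0 <= f theta o &
               forall B, measurable B ->
                 Q theta B = (\int[nu]_(o in B) (f theta o)%:E)%E]) /\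
        ((fun theta : R => (theta ^- 2)%:E *
            \int[nu]_o ((Num.sqrt (f theta o) - Num.sqrt (f 0 o)
               - theta / 2 * s o * Num.sqrt (f 0 o)) ^+ 2)%:E)%E
         @ (0 : R)^' --> 0%E)].

(* phi is mean-zero, square-integrable and represents the derivative at P of psi
   along every submodel in the class [regular]. *)
Definition is_influence_function
    (regular : probability O R -> (R -> probability O R) -> (O -> R) -> Prop)
    (psi : probability O R -> R) (P : probability O R) (phi : O -> R) : Prop :=
  [/\ phi \in Lfun P 2%:E,
      ('E_P[phi] = 0)%E &
      forall (Q : R -> probability O R) (s : O -> R), regular P Q s ->
        is_derive (0 : R) (1 : R) (fun theta => psi (Q theta))
          (\int[P]_o (phi o * s o))].

Definition is_EIF
    (regular : probability O R -> (R -> probability O R) -> (O -> R) -> Prop)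
    (psi : probability O R -> R) (P : probability O R) (phi : O -> R) : Prop :=
  is_influence_function regular psi P phi /\
  (forall phi', is_influence_function regular psi P phi' ->
     {ae P, forall o, phi' o = phi o}).

End influence_functions.

Section longitudinal.
Context {R : realType} {T : nat} {dL dA : 'I_T.+1 -> measure_display}.
Variables (L : forall t, measurableType (dL t))
          (A : forall t, measurableType (dA t)).

Definition before (t : 'I_T.+1) := {s : 'I_T.+1 | (s < t)%N}.
Definition upto (t : 'I_T.+1) := {s : 'I_T.+1 | (s <= t)%N}.

(* O = [Z_0..Z_T, A_0..A_T, L_0..L_T, Y] *)
Definition obs : Type :=
  (prod_space (fun _ : 'I_T.+1 => R : measurableType _) *
   prod_space A * prod_space L * R)%type.

(* the space of H_t = [Z_0..Z_(t-1), A_0..A_(t-1), L_0..L_t] *)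
Definition hist (t : 'I_T.+1) : Type :=
  (prod_space (fun _ : before t => R : measurableType _) *
   prod_space (fun s : before t => A (val s)) *
   prod_space (fun s : upto t => L (val s)))%type.


Definition obsZ (t : 'I_T.+1) (o : obs) : R := o.1.1.1 t.
Definition obsA (t : 'I_T.+1) (o : obs) : A t := o.1.1.2 t.
Definition obsL (t : 'I_T.+1) (o : obs) : L t := o.1.2 t.
Definition obsY (o : obs) : R := o.2.

Definition obsH (t : 'I_T.+1) (o : obs) : hist t :=
  (fun s => obsZ (val s) o, fun s => obsA (val s) o, fun s => obsL (val s) o).

Section observed_data.
Context {dW : measure_display} {Omega : measurableType dW}.
Variables (Z : 'I_T.+1 -> {mfun Omega >-> R})
  (Av : forall t, {mfun Omega >-> A t})
  (Lv : forall t, {mfun Omega >-> L t}) (Y : {mfun Omega >-> R}).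

Definition observed (w : Omega) : obs :=
  (fun t => Z t w, fun t => Av t w, fun t => Lv t w, Y w).

Lemma measurable_observed : measurable_fun [set: Omega] observed.
Proof.
apply: measurable_fun_pair; last exact: measurable_funPT.
apply: measurable_fun_pair; last first.
  by apply: measurable_cylinders => t; exact: measurable_funPT.
by apply: measurable_fun_pair; apply: measurable_cylinders => t;
  exact: measurable_funPT.
Qed.

HB.instance Definition _ := isMeasurableFun.Build _ _ _ _ observed
  measurable_observed.

End observed_data.

Definition ind_eq (t : 'I_T.+1) (a : A t) (o : obs) : R :=
  (obsA t o == a)%:R.

(* The bound on Z_t and the two-sided separation of the conditional covariance
   from 0; the latter is a function of h_t known only up to null sets, so "for
   all h_t" is "for almost every value of H_t". *)
Definition bounded_weight (P : probability obs R) (t : 'I_T.+1) (M : R) : Prop :=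
  {ae P, forall o, `|obsZ t o| <= M}.

Definition separated_weight (P : probability obs R) (t : 'I_T.+1) (a : A t)
    (eps : R) : Prop :=
  {ae P, forall o, eps <= `|cond_cov P (obsH t) (ind_eq a) (obsZ t) (obsH t o)|}.

Definition regular_weight (P : probability obs R) (t : 'I_T.+1) : Prop :=
  (exists M : R, bounded_weight P t M) /\
  (forall a : A t, exists2 eps : R, 0 < eps & separated_weight P a eps).

(* Regular one-dimensional submodels of the nonparametric model: paths that are
   differentiable in quadratic mean, along which the conditions making the
   functional well defined and finite (Z_t is a regular weighting function, Y
   has a second moment) hold locally uniformly near the truth. *)
Definition regular_submodel (P : probability obs R) (Q : R -> probability obs R)
    (s : obs -> R) : Prop :=
  [/\ qmd_submodel P Q s,
      forall t, exists M : R, \forall theta \near (0 : R),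
        bounded_weight (Q theta) t M,
      forall t (a : A t), exists2 eps : R, 0 < eps &
        \forall theta \near (0 : R), separated_weight (Q theta) a eps &
      exists K : R, \forall theta \near (0 : R),
        ('E_(Q theta)[fun o => (obsY o ^+ 2)%R] <= K%:E)%E].

Record nuisance := Nuisance {
  nu_delta : forall t, hist t -> R;
  nu_kappa : forall t, hist t -> R;
  nu_rho : forall t, hist t -> R;
  nu_eta : forall t, hist t -> R;
  nu_gamma : forall t, hist t -> R }.

Section regime.
Variable g : forall t, hist t -> A t.

(* A_t^(g_t) *)
Definition followed (t : 'I_T.+1) (o : obs) : R :=
  (obsA t o == g (obsH t o))%:R.

Section true_nuisances.
Variable P : probability obs R.

Definition delta_o (t : 'I_T.+1) : hist t -> R :=
  cond_mean P (obsH t) (followed t).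

Definition rho_o (t : 'I_T.+1) : hist t -> R :=
  cond_mean P (obsH t) (obsZ t).

Definition kappa_o (t : 'I_T.+1) : hist t -> R :=
  cond_cov P (obsH t) (followed t) (obsZ t).

Definition gamma_step (t : 'I_T.+1) (next : obs -> R) : hist t -> R :=
  fun h => cond_cov P (obsH t) (fun o => followed t o * next o) (obsZ t) h
           / kappa_o h.

(* gamma_(T+1-k)(H_(T+1-k)) as a function of O *)
Fixpoint gamma_after (k : nat) : obs -> R :=
  if k is k'.+1 then
    fun o => gamma_step (gamma_after k') (obsH (inord (T - k')) o)
  else obsY.

Definition gamma_next (t : 'I_T.+1) : obs -> R := gamma_after (T - t).

Definition gamma_o (t : 'I_T.+1) : hist t -> R := gamma_step (gamma_next t).

Definition eta_o (t : 'I_T.+1) : hist t -> R :=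
  cond_mean P (obsH t) (fun o => followed t o * gamma_next t o).

Definition alpha_o : nuisance :=
  Nuisance delta_o kappa_o rho_o eta_o gamma_o.

Lemma gamma_next_max : gamma_next ord_max = obsY.
Proof. by rewrite /gamma_next subnn. Qed.

Lemma gamma_nextE (t t' : 'I_T.+1) : t' = t.+1 :> nat ->
  gamma_next t = fun o => gamma_o (obsH t' o).
Proof.
move=> tt'; have lt_tT : (t < T)%N by rewrite -ltnS -tt'.
rewrite /gamma_o /gamma_next tt' subnS -{1}(@prednK (T - t)) ?subn_gt0//=.
suff -> : inord (T - (T - t).-1) = t' by [].
apply: val_inj; rewrite -subnS /= inordK ?ltnS ?leq_subr// tt' subKn//.
Qed.

End true_nuisances.

Definition weight (al : nuisance) (t : 'I_T.+1) (o : obs) : R :=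
  (obsZ t o - nu_rho al (obsH t o)) * followed t o / nu_kappa al (obsH t o).

Definition psi_functional (P : probability obs R) : R :=
  \int[P]_o ((\prod_(t < T.+1) weight (alpha_o P) t o) * obsY o).

Definition eif (psi : R) (al : nuisance) (o : obs) : R :=
  (\prod_(t < T.+1) weight al t o) * obsY o - psi +
  \sum_(t < T.+1) (\prod_(s < T.+1 | (s < t)%N) weight al s o) *
    let h := obsH t o in
    ((1 - (obsZ t o - nu_rho al h) * (followed t o - nu_delta al h)
          / nu_kappa al h) * nu_gamma al h
     - (obsZ t o - nu_rho al h) * nu_eta al h / nu_kappa al h).

End regime.

Section latent.
Context {dW : measure_display} {Omega : measurableType dW}
  {dU : 'I_T.+1 -> measure_display} {U : forall t, measurableType (dU t)}.

(* (U_0, .., U_t) *)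
Definition latent_past (Uv : forall t, {mfun Omega >-> U t}) (t : 'I_T.+1)
    (w : Omega) : prod_space (fun s : upto t => U (val s)) := fun s => Uv (val s) w.

(* Y(a_t,..,a_T) = Y(A_0,..,A_(t-1),a_t,..,a_T) *)
Definition Y_from (Ypot : (forall t, A t) -> {mfun Omega >-> R})
    (Av : forall t, {mfun Omega >-> A t}) (a : forall t, A t) (t : 'I_T.+1)
    (w : Omega) : R :=
  Ypot (fun s => if (s < t)%N then Av s w else a s) w.

End latent.

End longitudinal.
Arguments latent_past {T dW Omega dU U} Uv t w.
Arguments regular_submodel {R T dL dA L A} P Q s.

(* Main.v *)
Require Import Defs.
From HB Require Import structures.
From mathcomp Require Import all_boot all_order all_algebra.
From mathcomp Require Import all_classical all_reals all_analysis.
From mathcomp Require Import measurable_realfun ring lra.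

(* Along a path Q_th that is differentiable in quadratic mean with score s, the
   difference (E_th[X_th] - E[X_th]) / th tends to E[s X_0] as soon as the X_th are
   bounded in L2 and converge weakly to X_0, where weak convergence means convergence
   of E_th[u X_th] for every bounded u. Weak convergence is preserved by conditioning
   on the history, hence passes backwards in time from Y to all the gamma_t.

   Let D_k(Q) be the functional that weights by the nuisances of P before time k and
   uses the nuisances of Q from time k on; D_0(Q) is psi(Q) and D_(T+1)(Q) is the
   expectation under Q of a fixed variable. The difference D_t(Q_th) - D_(t+1)(Q_th) is
   the error made by inverse weighting with the nuisances of P instead of those of
   Q_th: it is an expectation under Q_th of variables that are centered given H_t under
   P, up to a second-order remainder, and its derivative is E[s V_t] with V_t the t-th
   summand of the influence function.

   Uniqueness comes from the paths (1 + th s) P with s bounded and centered, which are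
   regular: the difference D of two influence functions is orthogonal to
   1_B - P(B) for B = {D > 0}, and this forces D = 0. *)

Set Implicit Arguments.
Unset Strict Implicit.
Unset Printing Implicit Defensive.
Import Order.TTheory GRing.Theory Num.Theory.
Import numFieldNormedType.Exports.

Local Open Scope classical_set_scope.
Local Open Scope ring_scope.

(** * Real-valued integrals and L2 norms *)

(** Weak convergence is the mode that fits because only second moments of [Y] are bounded along the
    path: the squares need not be uniformly integrable, so the gamma_t of Q_th need not converge in
    norm. Nor need Q_th be dominated by P: a version chosen under Q_th is arbitrary on Q_th-null
    sets, and its norm under P is uncontrolled. Convergence is therefore tested under Q_th, and
    functions are truncated before they are integrated under P. Truncation at level K costs O(1/K),
    uniformly in th.

    The remainder of the reweighting error contains no difference of rho or kappa, only (Z -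
    rho_P)(delta_th - delta_P) times a multiple of gamma_th. The deltas are bounded and converge in
    norm, so what multiplies Z - rho_P tends weakly to 0; as Z - rho_P is centered under P, the
    remainder drops out of the difference quotient without any rate for the nuisances.

    Conditional expectations are fixed only almost everywhere, so their bounds are imposed
    everywhere by clipping, with constants common to P and all laws near it. *)

Section real_integrals.
Context {d : measure_display} {X : measurableType d} {R : realType}.
Variable mu : {measure set X -> \bar R}.
Implicit Types f g h : X -> R.

Definition L1 f : Prop := mu.-integrable [set: X] (EFin \o f).

Definition L2 f : Prop := measurable_fun [set: X] f /\ L1 (fun x => f x ^+ 2).

Lemma L1_measurable f : L1 f -> measurable_fun [set: X] f.
Proof. by move=> /measurable_int /measurable_EFinP. Qed.

Lemma eq_L1 f g : f =1 g -> L1 f -> L1 g.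
Proof. by move=> /funext ->. Qed.

Lemma L1_le f g : measurable_fun [set: X] f -> (forall x, `|f x| <= g x) ->
  L1 g -> L1 f.
Proof.
move=> mf fg; apply: le_integrable => //; first exact/measurable_EFinP.
by move=> x _ /=; rewrite lee_fin (le_trans (fg x))// ler_norm.
Qed.

Lemma L1D f g : L1 f -> L1 g -> L1 (fun x => f x + g x).
Proof. by move=> Lf Lg; have := integrableD measurableT Lf Lg. Qed.

Lemma L1B f g : L1 f -> L1 g -> L1 (fun x => f x - g x).
Proof. by move=> Lf Lg; have := integrableB measurableT Lf Lg. Qed.

Lemma L1Z c f : L1 f -> L1 (fun x => c * f x).
Proof. by move=> Lf; have := integrableZl measurableT c Lf. Qed.

Lemma L1_norm f : L1 f -> L1 (fun x => `|f x|).
Proof. exact: integrable_norm. Qed.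

Lemma ERD f g : L1 f -> L1 g ->
  \int[mu]_x (f x + g x) = \int[mu]_x f x + \int[mu]_x g x.
Proof. by move=> Lf Lg; rewrite RintegralD. Qed.

Lemma ERB f g : L1 f -> L1 g ->
  \int[mu]_x (f x - g x) = \int[mu]_x f x - \int[mu]_x g x.
Proof. by move=> Lf Lg; rewrite RintegralB. Qed.

Lemma ERZ c f : L1 f -> \int[mu]_x (c * f x) = c * \int[mu]_x f x.
Proof. by move=> Lf; rewrite RintegralZl. Qed.

Lemma eq_ER f g : f =1 g -> \int[mu]_x f x = \int[mu]_x g x.
Proof. by move=> fg; apply: eq_Rintegral => x _; exact: fg. Qed.

Lemma ER_le f g : L1 f -> L1 g -> (forall x, f x <= g x) ->
  \int[mu]_x f x <= \int[mu]_x g x.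
Proof. by move=> Lf Lg fg; apply: le_Rintegral => // x _; exact: fg. Qed.

Lemma ER_ge0 f : (forall x, 0 <= f x) -> 0 <= \int[mu]_x f x.
Proof. by move=> f0; apply: Rintegral_ge0. Qed.

Lemma ER_abs f : L1 f -> `|\int[mu]_x f x| <= \int[mu]_x `|f x|.
Proof. by move=> Lf; apply: le_normr_Rintegral. Qed.

Lemma ER_EFin f : L1 f -> (\int[mu]_x f x)%:E = (\int[mu]_x (f x)%:E)%E.
Proof. by move=> Lf; rewrite /Rintegral fineK// integrable_fin_num. Qed.

Lemma L1_ae_eq f g : measurable_fun [set: X] g -> {ae mu, forall x, f x = g x} ->
  L1 f -> L1 g.
Proof.
move=> mg fg Lf; apply/integrableP; split; first exact/measurable_EFinP.
case/integrableP : (Lf) => mf; apply: le_lt_trans.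
rewrite le_eqVlt; apply/orP; left; apply/eqP/esym.
apply: ae_eq_integral => //.
- by apply: measurableT_comp => //.
- by apply: measurableT_comp => //; exact/measurable_EFinP.
- by apply: filterS fg => x /= -> _.
Qed.

Lemma ae_eq_ER f g : measurable_fun [set: X] f -> measurable_fun [set: X] g ->
  {ae mu, forall x, f x = g x} -> \int[mu]_x f x = \int[mu]_x g x.
Proof.
move=> mf mg fg; congr fine; apply: ae_eq_integral => //;
  [exact/measurable_EFinP|exact/measurable_EFinP|].
by apply: filterS fg => x /= -> _.
Qed.

Lemma ae_L1_le f g : measurable_fun [set: X] f ->
  {ae mu, forall x, `|f x| <= g x} -> L1 g -> L1 f.
Proof.
move=> mf fg Lg; have mg := L1_measurable Lg.
(* Cutting [f] at the levels [|g|] and [-|g|] changes it only on a null set and makes the domination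
   hold everywhere. *)
apply: (@L1_ae_eq (fun x => Num.max (- `|g x|) (Num.min (`|g x|) (f x)))) => //.
  apply: filterS fg => x fgx.
  have := le_trans fgx (ler_norm _); rewrite ler_norml => /andP[a b].
  by rewrite (min_idPr b) (max_idPr a).
apply: (@L1_le _ (fun x => `|g x|)); last exact: L1_norm.
  have mng : measurable_fun [set: X] (fun x => `|g x|).
    by apply: measurableT_comp => //; exact: normr_measurable.
  apply: measurable_maxr; first exact/measurable_funN.
  exact: measurable_minr.
move=> x; rewrite ler_norml le_max lexx/= ge_max ge_min lexx andbT.
by rewrite (le_trans (_ : _ <= 0)) ?oppr_le0.
Qed.

Lemma eq_L2 f g : f =1 g -> L2 f -> L2 g.
Proof. by move=> /funext ->. Qed.

Lemma L2_measurable f : L2 f -> measurable_fun [set: X] f.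
Proof. by case. Qed.

Lemma L2_le f g : measurable_fun [set: X] f -> (forall x, `|f x| <= `|g x|) ->
  L2 g -> L2 f.
Proof.
move=> mf fg [mg Lg]; split => //; apply: L1_le Lg => //.
  exact: measurable_funX.
by move=> x; rewrite ger0_norm ?sqr_ge0// -!(real_normK (num_real (_ x))) lerXn2r ?nnegrE.
Qed.

Lemma L2_mul f g : L2 f -> L2 g -> L1 (fun x => f x * g x).
Proof.
move=> [mf Lf] [mg Lg]; apply: L1_le (L1D Lf Lg); first exact: measurable_funM.
move=> x; rewrite ler_norml; apply/andP; split; nra.
Qed.

Lemma L2_sq f : L2 f -> L1 (fun x => f x ^+ 2).
Proof. by case. Qed.

Lemma L2D f g : L2 f -> L2 g -> L2 (fun x => f x + g x).
Proof.
move=> Lf Lg; split; first by apply: measurable_funD; [case: Lf|case: Lg].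
have := L1D (L1D (L2_sq Lf) (L1Z 2 (L2_mul Lf Lg))) (L2_sq Lg).
by apply: eq_L1 => x; ring.
Qed.

Lemma L2_bM (M : R) (b f : X -> R) : measurable_fun [set: X] b -> (forall x, `|b x| <= M) ->
  L2 f -> L2 (fun x => b x * f x).
Proof.
move=> mb bM [mf Lf]; split; first exact: measurable_funM.
apply: L1_le (L1Z (M ^+ 2) Lf); first exact/measurable_funX/measurable_funM.
move=> x; rewrite ger0_norm ?sqr_ge0// exprMn ler_wpM2r ?sqr_ge0//.
by rewrite -(real_normK (num_real _)) lerXn2r ?nnegrE// (le_trans _ (bM x)).
Qed.

Lemma L2Z c f : L2 f -> L2 (fun x => c * f x).
Proof. by move=> Lf; apply: (@L2_bM `|c| (fun=> c)). Qed.

Lemma L2N f : L2 f -> L2 (fun x => - f x).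
Proof. by move=> /(L2Z (-1)); apply: eq_L2 => x; rewrite mulN1r. Qed.

Lemma L2B f g : L2 f -> L2 g -> L2 (fun x => f x - g x).
Proof. by move=> Lf /L2N; exact: L2D. Qed.

Definition nrm f : R := Num.sqrt (\int[mu]_x (f x ^+ 2)).

Lemma nrm_ge0 f : 0 <= nrm f. Proof. exact: sqrtr_ge0. Qed.

Lemma sqr_nrm f : nrm f ^+ 2 = \int[mu]_x (f x ^+ 2).
Proof. by rewrite sqr_sqrtr// ER_ge0// => x; exact: sqr_ge0. Qed.

Lemma eq_nrm f g : f =1 g -> nrm f = nrm g.
Proof. by move=> /funext ->. Qed.

Lemma cauchy_schwarz f g : L2 f -> L2 g ->
  `|\int[mu]_x (f x * g x)| <= nrm f * nrm g.
Proof.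
move=> Lf Lg; set c := \int[mu]_x _.
have ff := L2_sq Lf; have gg := L2_sq Lg; have fg := L2_mul Lf Lg.
have quad t : 0 <= nrm f ^+ 2 * t ^+ 2 + c * t *+ 2 + nrm g ^+ 2.
  have : 0 <= \int[mu]_x ((t * f x + g x) ^+ 2) by apply: ER_ge0 => x; exact: sqr_ge0.
  rewrite (@eq_ER _ (fun x => t ^+ 2 * f x ^+ 2 + (2 * t) * (f x * g x) +
    g x ^+ 2)); last by move=> x; ring.
  have tff := L1Z (t ^+ 2) ff; have tfg := L1Z (2 * t) fg.
  rewrite ERD ?ERD ?ERZ//; last exact: L1D.
  by rewrite -/c -!sqr_nrm; congr (_ <= _); ring.
have a0 := nrm_ge0 f; have b0 := nrm_ge0 g.
set a := nrm f in quad a0 *; set b := nrm g in quad b0 *.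
suff : c ^+ 2 <= (a * b) ^+ 2.
  move=> h; rewrite -(@ger0_norm _ (a * b)) ?mulr_ge0//.
  by rewrite -(@ler_pXn2r _ 2) ?nnegrE// !real_normK ?num_real.
have [a_eq0|a_neq0] := eqVneq a 0.
  have [->|c0] := eqVneq c 0; first by rewrite expr0n/= sqr_ge0.
  (* When [nrm f = 0] the quadratic in t degenerates to an affine function; unless [c = 0], this t
     makes it equal to [- b ^+ 2 - 2 < 0]. Otherwise t is taken at the minimum of the parabola. *)
  have := quad (- (b ^+ 2 + 1) / c); rewrite a_eq0.
  have -> : c * (- (b ^+ 2 + 1) / c) *+ 2 = - (b ^+ 2 + 1) *+ 2 by field.
  by rewrite expr0n/=; nra.
have := quad (- c / a ^+ 2).
have -> : a ^+ 2 * (- c / a ^+ 2) ^+ 2 + c * (- c / a ^+ 2) *+ 2 + b ^+ 2 =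
  (- c ^+ 2 + (a * b) ^+ 2) / a ^+ 2 by field.
by rewrite pmulr_lge0 ?invr_gt0 ?exprn_even_gt0//; lra.
Qed.

Lemma nrm_le f g : L2 g -> measurable_fun [set: X] f ->
  (forall x, `|f x| <= `|g x|) -> nrm f <= nrm g.
Proof.
move=> Lg mf fg; have Lf := L2_le mf fg Lg.
apply: ler_wsqrtr; apply: ER_le; [exact: L2_sq|exact: L2_sq|].
by move=> x; rewrite -!(real_normK (num_real (_ x))) lerXn2r ?nnegrE.
Qed.

Lemma nrmZ c f : L2 f -> nrm (fun x => c * f x) = `|c| * nrm f.
Proof.
move=> Lf; rewrite /nrm (@eq_ER _ (fun x => c ^+ 2 * f x ^+ 2)); last first.
  by move=> x; rewrite exprMn.
by rewrite ERZ; [rewrite sqrtrM ?sqr_ge0// sqrtr_sqr|exact: L2_sq].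
Qed.

Lemma nrm_bM (M : R) (b f : X -> R) : measurable_fun [set: X] b -> (forall x, `|b x| <= M) ->
  L2 f -> nrm (fun x => b x * f x) <= M * nrm f.
Proof.
move=> mb bM Lf; have [M0|M0] := leP 0 M; last first.
  (* A negative bound on [|b|] is possible only if [X] is empty, and then every norm is 0. *)
  have x0 (x : X) : False.
    by have := le_lt_trans (bM x) M0; rewrite ltNge normr_ge0.
  suff fE (h : X -> R) : nrm h = 0 by rewrite !fE mulr0.
  rewrite (_ : h = fun=> 0); last by apply/funext => x; case: (x0 x).
  by rewrite /nrm (@eq_ER _ (fun x => 0 * f x ^+ 2)) ?(ERZ _ (L2_sq Lf)) ?mul0r
    ?sqrtr0// => x; case: (x0 x).
rewrite -{1}(ger0_norm M0) -nrmZ//; apply: nrm_le; first exact: L2Z.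
  by apply: measurable_funM => //; case: Lf.
by move=> x; rewrite !normrM ler_wpM2r// (le_trans (bM x))// ler_norm.
Qed.

Lemma nrmD f g : L2 f -> L2 g -> nrm (fun x => f x + g x) <= nrm f + nrm g.
Proof.
move=> Lf Lg; have s0 : 0 <= nrm f + nrm g by rewrite addr_ge0 ?nrm_ge0.
rewrite -(@ler_pXn2r _ 2) ?nnegrE ?nrm_ge0//.
rewrite sqr_nrm (@eq_ER _ (fun x => f x ^+ 2 + 2 * (f x * g x) + g x ^+ 2));
  last by move=> x; ring.
have ff := L2_sq Lf; have gg := L2_sq Lg; have fg := L2_mul Lf Lg.
have := cauchy_schwarz Lf Lg; rewrite ler_norml => /andP[_ h].
have tfg := L1Z 2 fg.
rewrite ERD ?ERD ?ERZ//; last exact: L1D.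
by rewrite -!sqr_nrm; nra.
Qed.

Lemma nrmN f : nrm (fun x => - f x) = nrm f.
Proof. by rewrite /nrm; congr Num.sqrt; apply: eq_ER => x; rewrite sqrrN. Qed.

Lemma nrmB f g : L2 f -> L2 g -> nrm (fun x => f x - g x) <= nrm f + nrm g.
Proof. by move=> Lf Lg; rewrite -(nrmN g); apply: nrmD => //; exact: L2N. Qed.

Lemma le_nrm f M : L2 f -> 0 <= M -> \int[mu]_x (f x ^+ 2) <= M ^+ 2 -> nrm f <= M.
Proof.
move=> Lf M0 h; rewrite -(@ler_pXn2r _ 2) ?nnegrE ?nrm_ge0//.
by rewrite sqr_nrm.
Qed.

Lemma L2_ae_eq f g : measurable_fun [set: X] g -> {ae mu, forall x, f x = g x} ->
  L2 f -> L2 g.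
Proof.
move=> mg fg [mf Lf]; split => //; apply: L1_ae_eq Lf; first exact: measurable_funX.
by apply: filterS fg => x ->.
Qed.

End real_integrals.

Section real_integrals_probability.
Context {d : measure_display} {X : measurableType d} {R : realType}.
Variable P : probability X R.
Implicit Types f g : X -> R.

Lemma probability_inhabited : exists x : X, True.
Proof.
apply: contrapT => /forallNP nx; have := @probability_setT _ _ _ P.
rewrite (_ : [set: X] = set0) ?measure0.
  by move=> /eqP; rewrite eqe eq_sym oner_eq0.
by apply/seteqP; split => // x _; exact: (nx x).
Qed.

Lemma L1_bounded (M : R) f : measurable_fun [set: X] f -> (forall x, `|f x| <= M) ->
  L1 P f.
Proof.
move=> mf fM; apply: (@L1_le _ _ _ _ _ (fun=> M)) => //.
by apply: finite_measure_integrable_cst.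
Qed.

Lemma L2_bounded (M : R) f : measurable_fun [set: X] f -> (forall x, `|f x| <= M) ->
  L2 P f.
Proof.
move=> mf fM; split => //; apply: (@L1_bounded (M ^+ 2)); first exact: measurable_funX.
by move=> x; rewrite normrX lerXn2r ?nnegrE// (le_trans _ (fM x)).
Qed.

Lemma L2_cst c : L2 P (fun=> c).
Proof. exact: (@L2_bounded `|c|). Qed.

Lemma L2_L1 f : L2 P f -> L1 P f.
Proof. by move=> /L2_mul /(_ (L2_cst 1)); apply: eq_L1 => x; rewrite mulr1. Qed.

Lemma ER_cst c : \int[P]_x c = c.
Proof. by rewrite Rintegral_cst//= probability_setT mulr1. Qed.

Lemma nrm_cst c : nrm P (fun=> c) = `|c|.
Proof. by rewrite /nrm ER_cst sqrtr_sqr. Qed.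

Lemma nrm_bounded (M : R) f : 0 <= M -> measurable_fun [set: X] f ->
  (forall x, `|f x| <= M) -> nrm P f <= M.
Proof.
move=> M0 mf fM; rewrite -{1}(ger0_norm M0) -nrm_cst; apply: nrm_le => //.
  exact: L2_cst.
by move=> x; rewrite (le_trans (fM x))// ler_norm.
Qed.

Lemma L2_Lfun f : L2 P f <-> f \in Lfun P 2%:E.
Proof.
split=> [[mf Lf]|Lf].
  rewrite inE; apply/andP; split; first by rewrite inE.
  rewrite inE/= /finite_norm unlock /Lnorm poweR_lty//.
  case/integrableP : Lf => _; congr (_ < _)%E; apply: eq_integral => x _.
  transitivity (`|f x|%:E `^ 2%R)%E; last by [].
  by rewrite poweR_EFin powR_mulrn//= normrX.
have mf : measurable_fun [set: X] f by move: Lf; rewrite inE => /andP[]; rewrite inE.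
by split => //; exact: Lfun2_integrable_sqr.
Qed.

End real_integrals_probability.

(** * Change of density *)

Section change_of_density.
Context {d : measure_display} {X : measurableType d} {R : realType}.
Variables (nu : {sigma_finite_measure set X -> \bar R}) (Q : probability X R).
Variable f : X -> R.
Hypothesis mf : measurable_fun [set: X] f.
Hypothesis f0 : forall x, 0 <= f x.
Hypothesis Qf : forall B, measurable B -> Q B = (\int[nu]_(x in B) (f x)%:E)%E.

Let L1f : L1 nu f.
Proof.
apply/integrableP; split; first exact/measurable_EFinP.
under eq_integral do rewrite /= ger0_norm//.
by rewrite -Qf// probability_setT ltry.
Qed.

Let dom : Q `<< nu.
Proof.
apply/null_content_dominatesP => B mB nuB; rewrite Qf//.
by rewrite null_set_integral//; exact: measurable_funTS (measurable_int _ L1f).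
Qed.

Let df := Radon_Nikodym_SigmaFinite.f Q nu.

(** The change of variables formula concerns the Radon-Nikodym derivative [df]; since [f] has the
    same integral over every measurable set, the two agree almost everywhere. *)
Let df_ae : ae_eq nu [set: X] df (EFin \o f).
Proof.
apply: integral_ae_eq => //.
- exact: Radon_Nikodym_SigmaFinite.f_integrable.
- exact/measurable_EFinP.
- move=> B _ mB.
  exact: etrans (esym (Radon_Nikodym_SigmaFinite.f_integral dom mB)) (Qf mB).
Qed.

Lemma ge0_integral_density (h : X -> \bar R) : measurable_fun [set: X] h ->
  (forall x, 0 <= h x)%E -> (\int[Q]_x h x = \int[nu]_x (h x * (f x)%:E))%E.
Proof.
move=> mh h0; rewrite -(Radon_Nikodym_SigmaFinite.change_of_variables dom)//.
apply: ae_eq_integral => //.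
- apply: emeasurable_funM => //.
  exact: measurable_int (Radon_Nikodym_SigmaFinite.f_integrable dom).
- by apply: emeasurable_funM => //; exact/measurable_EFinP.
- by have := ae_eqe_mul2l h df_ae.
Qed.

Lemma L1_density (h : X -> R) : L1 Q h -> L1 nu (fun x => h x * f x).
Proof.
move=> /[dup] /L1_measurable mh /integrableP[_ hoo]; apply/integrableP; split.
  by apply/measurable_EFinP; exact: measurable_funM.
move: hoo; rewrite ge0_integral_density//; last first.
  by apply: measurableT_comp => //; exact/measurable_EFinP.
congr (_ < _)%E; apply: eq_integral => x _ /=.
by rewrite normrM (ger0_norm (f0 x)).
Qed.

Lemma ER_density (h : X -> R) : L1 Q h -> \int[Q]_x h x = \int[nu]_x (h x * f x).
Proof.
move=> Lh; have mh := L1_measurable Lh; congr fine.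
rewrite integralE [RHS]integralE; congr (_ - _)%E.
  rewrite ge0_integral_density//; last first.
    by apply: measurable_funepos; exact/measurable_EFinP.
  by apply: eq_integral => x _; rewrite !funeposE -!EFin_max -EFinM maxr_pMl// mul0r.
rewrite ge0_integral_density//; last first.
  by apply: measurable_funeneg; exact/measurable_EFinP.
by apply: eq_integral => x _; rewrite !funenegE/= -!EFin_max -EFinM maxr_pMl// mul0r mulNr.
Qed.

(** Multiplication by the root of the density embeds L2(Q) isometrically into L2(nu). Functions that
    are square-integrable under different laws of a path thus meet in one Hilbert space. *)
Lemma L2_density (h : X -> R) : L2 Q h -> L2 nu (fun x => h x * Num.sqrt (f x)).
Proof.
move=> [mh Lh]; split.
  apply: measurable_funM => //; apply: measurableT_comp => //.
  by apply: continuous_measurable_fun; exact: sqrt_continuous.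
by apply: (eq_L1 _ (L1_density Lh)) => x; rewrite exprMn sqr_sqrtr.
Qed.

Lemma nrm_density (h : X -> R) : L2 Q h ->
  nrm nu (fun x => h x * Num.sqrt (f x)) = nrm Q h.
Proof.
move=> [mh Lh]; congr Num.sqrt; rewrite (ER_density Lh).
by apply: eq_ER => x; rewrite exprMn sqr_sqrtr.
Qed.

End change_of_density.

(** * Conditional expectations *)

Section conditional_means.
Context {d dS : measure_display} {O : measurableType d} {S : measurableType dS}
  {R : realType}.
Variables (Q : probability O R) (H : O -> S).
Hypothesis mH : measurable_fun [set: O] H.
Implicit Types (X W : O -> R) (r F : S -> R).

Lemma measurable_comp_H F : measurable_fun [set: S] F ->
  measurable_fun [set: O] (fun x => F (H x)).
Proof. by move=> mF; exact: measurableT_comp mF mH. Qed.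

(** The regression function is the Radon-Nikodym derivative, with respect to the law of [H], of the
    image under [H] of the signed measure with density [X]. Taking [fine] makes this derivative
    real-valued. *)
Lemma cond_mean_exists X : L1 Q X -> exists r, is_cond_mean Q H X r.
Proof.
move=> LX.
pose Hm : {mfun O >-> S} := HB.pack H (isMeasurableFun.Build _ _ _ _ H mH).
pose mu := distribution Q Hm.
pose nu := measure_function_pushforward__canonical__charge_Charge
  (induced_charge LX) mH.
have numu : nu `<< mu.
  apply/null_content_dominatesP => B mB QB.
  apply: null_set_integral => //; first by rewrite -[X in measurable X]setTI; exact: mH.
  by apply: measurable_funTS; exact: measurable_int LX.
pose f := Radon_Nikodym nu mu.
have ffin s : f s \is a fin_num := Radon_Nikodym_fin_num s numu.
have fE : EFin \o (fine \o f) = f by apply/funext => s /=; rewrite fineK.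
have intf : mu.-integrable [set: S] f := Radon_Nikodym_integrable numu.
have intfH : Q.-integrable [set: O] (f \o H).
  apply/integrableP; split; first exact: measurableT_comp (measurable_int _ intf) mH.
  case/integrableP : intf => mf; rewrite ge0_integral_distribution//.
  exact: measurableT_comp.
exists (fine \o f); split.
- by apply/measurable_EFinP; rewrite fE; exact: measurable_int intf.
- by apply: eq_integrable intfH => // x _ /=; rewrite fineK.
- move=> B mB; have := Radon_Nikodym_integral numu mB; rewrite -/f => h.
  transitivity (\int[Q]_(x in H @^-1` B) (f \o H) x)%E.
    by apply: eq_integral => x _ /=; rewrite fineK.
  have mHB : measurable (H @^-1` B) by rewrite -[X in measurable X]setTI; exact: mH.
  have e := integral_pushforward mH (measurable_int _ intf)
    (integrableS measurableT mHB (@subsetT _ _) intfH) mB.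
  exact: etrans (esym e) (esym h).
Qed.

Lemma cond_meanP X : L1 Q X -> is_cond_mean Q H X (cond_mean Q H X).
Proof. by move=> /cond_mean_exists [r hr]; exact: (getI hr). Qed.

Lemma L1_indic_mul (B : set S) W : measurable B -> L1 Q W ->
  L1 Q (fun x => \1_B (H x) * W x).
Proof.
move=> mB LW; apply: (L1_le _ _ (L1_norm LW)).
  apply: measurable_funM; last exact: L1_measurable LW.
  exact: measurable_comp_H.
move=> x; rewrite normrM indicE; case: (_ \in _); first by rewrite normr1 mul1r.
by rewrite normr0 mul0r.
Qed.

Lemma ER_indic (B : set S) W : measurable B -> L1 Q W ->
  (\int[Q]_x (\1_B (H x) * W x))%:E = (\int[Q]_(x in H @^-1` B) (W x)%:E)%E.
Proof.
move=> mB LW; rewrite ER_EFin; last exact: L1_indic_mul.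
rewrite [RHS]integral_mkcond; apply: eq_integral => x _.
rewrite patchE indicE.
have -> : (x \in H @^-1` B) = (H x \in B) by apply/idP/idP; rewrite !inE.
by case: (_ \in _); rewrite ?mul1r ?mul0r.
Qed.

Lemma is_cond_mean_indic X r : L1 Q X -> is_cond_mean Q H X r ->
  forall B : set S, measurable B ->
  \int[Q]_x (\1_B (H x) * (X x - r (H x))) = 0.
Proof.
move=> LX [mr Lr rX] B mB.
have /eqP := rX B mB; rewrite -!ER_indic// => /eqP[] e.
rewrite (@eq_ER _ _ _ _ _ (fun x => \1_B (H x) * X x - \1_B (H x) * r (H x))).
  by rewrite ERB ?e ?subrr//; exact: L1_indic_mul.
by move=> x; rewrite mulrBr.
Qed.

Lemma ER_mulrB (c f g : O -> R) : L1 Q (fun x => c x * f x) ->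
  L1 Q (fun x => c x * g x) ->
  \int[Q]_x (c x * (f x - g x)) = \int[Q]_x (c x * f x) - \int[Q]_x (c x * g x).
Proof.
by move=> Lf Lg; rewrite -(ERB Lf Lg); apply: eq_ER => x; rewrite mulrBr.
Qed.

Lemma ER_sum (I : Type) (s : seq I) (f : I -> O -> R) : (forall i, L1 Q (f i)) ->
  L1 Q (fun x => \sum_(i <- s) f i x) /\
  \int[Q]_x (\sum_(i <- s) f i x) = \sum_(i <- s) \int[Q]_x f i x.
Proof.
move=> Lf; elim: s => [|i s [Ls IH]].
  rewrite big_nil; split.
    by apply: (eq_L1 _ (L2_L1 (L2_cst Q 0))) => x; rewrite big_nil.
  by rewrite (@eq_ER _ _ _ _ _ (fun=> 0)) ?ER_cst// => x; rewrite big_nil.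
split; first by apply: (eq_L1 _ (L1D (Lf i) Ls)) => x; rewrite big_cons.
rewrite big_cons -IH -ERD//; apply: eq_ER => x; by rewrite big_cons.
Qed.

Import HBNNSimple.

(** For a simple [F] the integral is a combination of integrals over level sets, which vanish by
    hypothesis. Simple functions increasing to [F] give the general case by dominated convergence
    with bound [|F W|], so [F] itself may be unbounded. *)
Lemma ge0_pull_zero W F : L1 Q W ->
  (forall B, measurable B -> \int[Q]_x (\1_B (H x) * W x) = 0) ->
  measurable_fun [set: S] F -> (forall s, 0 <= F s) ->
  L1 Q (fun x => F (H x) * W x) -> \int[Q]_x (F (H x) * W x) = 0.
Proof.
move=> LW W0 mF F0 LFW.
have mEF : measurable_fun [set: S] (EFin \o F) by exact/measurable_EFinP.
pose h := nnsfun_approx measurableT mEF.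
have f0 t : [set: S] t -> (0 <= (EFin \o F) t)%E by rewrite lee_fin.
have hF n s : h n s <= F s.
  rewrite -lee_fin /h nnsfun_approxE; exact: (le_approx n f0 I).
have cvh s : (fun n => (h n s)%:E) @ \oo --> (F s)%:E.
  by apply: (@cvg_nnsfun_approx _ _ _ _ measurableT _ mEF) .
have h0 n : \int[Q]_x (h n (H x) * W x) = 0.
  pose s : seq R := finmap.enum_fset (fset_set (range (h n))).
  pose f y x := y * (\1_(h n @^-1` [set y]) (H x) * W x).
  have Lf y : L1 Q (f y) by apply: L1Z; exact: L1_indic_mul.
  rewrite (@eq_ER _ _ _ _ _ (fun x => \sum_(y <- s) f y x)); last first.
    move=> x; rewrite {1}fimfunE fsbig_finite//= mulr_suml.
    by apply: eq_bigr => y _; rewrite /f mulrA.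
  rewrite (ER_sum _ Lf).2 big1// => y _.
  by rewrite ERZ ?W0 ?mulr0//; exact: L1_indic_mul.
have mh n : measurable_fun [set: O] (fun x => (h n (H x) * W x)%:E).
  apply/measurable_EFinP; apply: measurable_funM; last exact: L1_measurable LW.
  exact: measurable_comp_H.
have cvhW x : (fun n => (h n (H x) * W x)%:E) @ \oo --> (F (H x) * W x)%:E.
  under eq_fun do rewrite EFinM.
  by rewrite EFinM; apply: cvgeZr.
have dom : {ae Q, forall x, forall n, setT x ->
    (`|(h n (H x) * W x)%:E| <= `|F (H x) * W x|%:E)%E}.
  apply: aeW => x n _; rewrite lee_fin !normrM ler_wpM2r//.
  by rewrite !ger0_norm.
have [_ _ cv] := @dominated_convergence _ _ _ Q [set: O] measurableT
  (fun n x => (h n (H x) * W x)%:E) (fun x => (F (H x) * W x)%:E)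
  (fun x => `|F (H x) * W x|%:E) mh
  (measurable_int _ LFW)
  (aeW _ (fun x _ => cvhW x))
  (L1_norm LFW) dom.
rewrite /Rintegral.
suff -> : (\int[Q]_x (F (H x) * W x)%:E = 0)%E by [].
rewrite -(cvg_lim _ cv)//; apply: lim_near_cst => //.
apply: nearW => n /=; rewrite -ER_EFin ?h0//.
apply: (L1_le _ _ (L1_norm LFW)); first exact/measurable_EFinP/mh.
by move=> x; rewrite !normrM ler_wpM2r// !ger0_norm.
Qed.

Lemma pull_zero W F : L1 Q W ->
  (forall B, measurable B -> \int[Q]_x (\1_B (H x) * W x) = 0) ->
  measurable_fun [set: S] F ->
  L1 Q (fun x => F (H x) * W x) -> \int[Q]_x (F (H x) * W x) = 0.
Proof.
move=> LW W0 mF LFW.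
pose p := fun s => Num.max (F s) 0; pose n := fun s => Num.max (- F s) 0.
have pnE s : F s = p s - n s.
  by rewrite /p /n; case: (leP (F s) 0) => h; case: leP => h'; lra.
have mp : measurable_fun [set: S] p by exact: measurable_maxr.
have mn : measurable_fun [set: S] n.
  by apply: measurable_maxr => //; exact: measurable_funN.
have p0 s : 0 <= p s by rewrite le_max lexx orbT.
have n0 s : 0 <= n s by rewrite le_max lexx orbT.
have L (q : S -> R) : measurable_fun [set: S] q -> (forall s, `|q s| <= `|F s|) ->
    L1 Q (fun x => q (H x) * W x).
  move=> mq qF; apply: (L1_le _ _ (L1_norm LFW)).
    apply: measurable_funM; last exact: L1_measurable LW.
    exact: measurable_comp_H.
  by move=> x; rewrite !normrM ler_wpM2r.
have Lp : L1 Q (fun x => p (H x) * W x).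
  by apply: L => // s; rewrite (ger0_norm (p0 s)) /p ge_max ler_norm normr_ge0.
have Ln : L1 Q (fun x => n (H x) * W x).
  by apply: L => // s; rewrite (ger0_norm (n0 s)) /n ge_max normr_ge0 andbT -normrN ler_norm.
rewrite (@eq_ER _ _ _ _ _ (fun x => p (H x) * W x - n (H x) * W x)).
  by rewrite ERB// !ge0_pull_zero// subrr.
by move=> x; rewrite -mulrBl -pnE.
Qed.

Lemma pull_out X r F : L1 Q X -> is_cond_mean Q H X r ->
  measurable_fun [set: S] F ->
  L1 Q (fun x => F (H x) * X x) -> L1 Q (fun x => F (H x) * r (H x)) ->
  \int[Q]_x (F (H x) * r (H x)) = \int[Q]_x (F (H x) * X x).
Proof.
move=> LX rX mF LFX LFr; have [_ Lr _] := rX.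
apply/esym/eqP; rewrite -subr_eq0 -ERB//; apply/eqP.
rewrite (@eq_ER _ _ _ _ _ (fun x => F (H x) * (X x - r (H x)))); last first.
  by move=> x; rewrite mulrBr.
apply: pull_zero => //; [exact: L1B|exact: is_cond_mean_indic|].
by apply: (eq_L1 _ (L1B LFX LFr)) => x; rewrite mulrBr.
Qed.

Lemma ER_ge0_eq0 W : L1 Q W -> (forall x, 0 <= W x) -> \int[Q]_x W x <= 0 ->
  {ae Q, forall x, W x = 0}.
Proof.
move=> LW W0 W_le0.
have W_eq0 : \int[Q]_x W x = 0 by apply/le_anti; rewrite W_le0 ER_ge0.
have := ER_EFin LW; rewrite W_eq0 => /esym e.
have : ae_eq Q [set: O] (EFin \o W) (cst 0%E).
  apply/ae_eq_integral_abs => //; first exact: measurable_int LW.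
  by rewrite -[RHS]e; apply: eq_integral => x _ /=; rewrite ger0_norm.
by apply: filterS => x /(_ I) [].
Qed.

(** The event B0 and r' < r is determined by [H]. On it r - r' is positive, yet has the same
    integral as X - X', which is at most 0 there; so the event is null. Localizing to [B0] serves to
    compare regressions of variables that agree only on part of the histories. *)
Lemma cond_mean_le_on (B0 : set S) X X' r r' : measurable B0 ->
  L1 Q X -> L1 Q X' -> is_cond_mean Q H X r -> is_cond_mean Q H X' r' ->
  {ae Q, forall x, B0 (H x) -> X x <= X' x} ->
  {ae Q, forall x, B0 (H x) -> r (H x) <= r' (H x)}.
Proof.
move=> mB0 LX LX' rX rX' XX'; have [mr Lr _] := rX; have [mr' Lr' _] := rX'.
pose B := B0 `&` [set s | r' s < r s].
have mB : measurable B.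
  apply: measurableI => //; rewrite -[X in measurable X]setTI.
  rewrite (_ : [set s | _] = (fun s => r' s < r s) @^-1` [set true]).
    exact: (measurable_fun_ltr mr' mr measurableT).
  by apply/seteqP; split => s /=.
pose W x := \1_B (H x) * (r (H x) - r' (H x)).
have LW : L1 Q W by apply: L1_indic_mul => //; exact: L1B.
have : {ae Q, forall x, W x = 0}.
  apply: ER_ge0_eq0 => //.
    move=> x; rewrite /W indicE; case: (boolP (_ \in _)); rewrite ?mul0r//.
    by rewrite inE => -[_ /= /ltW]; rewrite mul1r subr_ge0.
  have := is_cond_mean_indic LX rX mB; have := is_cond_mean_indic LX' rX' mB.
  have LB (V : O -> R) : L1 Q V -> L1 Q (fun x => \1_B (H x) * V x).
    exact: L1_indic_mul.
  have [LBX LBX'] := (LB _ LX, LB _ LX').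
  have LBr : L1 Q (fun x => \1_B (H x) * r (H x)) := LB (fun x => r (H x)) Lr.
  have LBr' : L1 Q (fun x => \1_B (H x) * r' (H x)) := LB (fun x => r' (H x)) Lr'.
  rewrite ER_mulrB// ER_mulrB// => e1 e2.
  rewrite /W ER_mulrB//.
  suff : \int[Q]_x (\1_B (H x) * X x) <= \int[Q]_x (\1_B (H x) * X' x) by lra.
  rewrite -lee_fin !ER_EFin ?LB//.
  (* The minimum equals [X] almost everywhere on the event and lies below [X'] everywhere, which
     turns the almost sure inequality into a pointwise one. *)
  have Lmin : L1 Q (fun x => \1_B (H x) * Num.min (X x) (X' x)).
    apply: L1_indic_mul => //.
    apply: (L1_le _ _ (L1D (L1_norm LX) (L1_norm LX'))).
      by apply: measurable_minr; [exact: L1_measurable LX|exact: L1_measurable LX'].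
    move=> x; case: (leP (X x) (X' x)) => _; first by rewrite lerDl.
    by rewrite lerDr.
  rewrite (ae_eq_integral (fun x => (\1_B (H x) * Num.min (X x) (X' x))%:E)) //=.
  - apply: le_integral => // x _; rewrite lee_fin ler_wpM2l ?ge_min ?lexx ?orbT//.
  - exact: measurable_int LBX.
  - apply/measurable_EFinP; apply: measurable_funM; first exact: measurable_comp_H.
    by apply: measurable_minr; [exact: L1_measurable LX|exact: L1_measurable LX'].
  - apply: filterS XX' => x h _; rewrite indicE; case: (boolP (_ \in _)); last first.
      by rewrite !mul0r.
    by rewrite inE => -[/h /min_idPl ->].
apply: filterS => x; rewrite /W indicE; case: (boolP (_ \in _)).
  by rewrite inE mul1r => -[_ /= h] /eqP; rewrite subr_eq0 => /eqP e; rewrite e ltxx in h.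
rewrite notin_setE => nB _ B0x; rewrite leNgt; apply/negP => h; exact: nB.
Qed.

Lemma cond_mean_eq_on (B0 : set S) X X' r r' : measurable B0 ->
  L1 Q X -> L1 Q X' -> is_cond_mean Q H X r -> is_cond_mean Q H X' r' ->
  {ae Q, forall x, B0 (H x) -> X x = X' x} ->
  {ae Q, forall x, B0 (H x) -> r (H x) = r' (H x)}.
Proof.
move=> mB0 LX LX' rX rX' XX'.
have le1 := cond_mean_le_on mB0 LX LX' rX rX'.
have le2 := cond_mean_le_on mB0 LX' LX rX' rX.
have {}le1 : {ae Q, forall x, B0 (H x) -> r (H x) <= r' (H x)}.
  by apply: le1; apply: filterS XX' => x h b; rewrite h.
have {}le2 : {ae Q, forall x, B0 (H x) -> r' (H x) <= r (H x)}.
  by apply: le2; apply: filterS XX' => x h b; rewrite h.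
by apply: filterS2 le1 le2 => x h1 h2 b; apply/le_anti; rewrite h1// h2.
Qed.

Lemma cond_mean_bounded X r (M : R) : L1 Q X -> is_cond_mean Q H X r ->
  {ae Q, forall x, `|X x| <= M} -> {ae Q, forall x, `|r (H x)| <= M}.
Proof.
move=> LX rX XM.
have cst_cm c : is_cond_mean Q H (fun=> c) (fun=> c).
  by split => //; exact: L2_L1 (L2_cst Q c).
have L c := L2_L1 (L2_cst Q c).
have := cond_mean_le_on measurableT LX (L M) rX (cst_cm M).
have := cond_mean_le_on measurableT (L (- M)) LX (cst_cm (- M)) rX.
move=> h1 h2; apply: filterS2 (h1 _) (h2 _).
- by move=> x h3 h4; rewrite ler_norml h3// h4.
- by apply: filterS XM => x; rewrite ler_norml => /andP[].
- by apply: filterS XM => x; rewrite ler_norml => /andP[].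
Qed.

(** Testing r against itself would presuppose that its square is integrable. The truncations [t k]
    are bounded and satisfy t r = t^2, so |t|^2 = E[t X] <= |t| |X| bounds their norms by that of
    [X]; monotone convergence concludes. *)
Lemma cond_mean_L2 X r : L2 Q X -> is_cond_mean Q H X r -> L2 Q (fun x => r (H x)).
Proof.
move=> LX rX; have LX1 := L2_L1 LX; have [mr Lr _] := rX.
pose t (k : nat) s := (`|r s| <= k%:R)%R%:R * r s.
have mt k : measurable_fun [set: S] (t k).
  apply: measurable_funM => //; apply: measurableT_comp => //=.
  apply: measurable_fun_ler => //; exact: measurableT_comp.
have tk k s : `|t k s| <= k%:R.
  by rewrite /t; case: (boolP (`|r s| <= k%:R)%R) => h; rewrite ?mul1r ?mul0r ?normr0.
have tr k s : t k s * r s = t k s ^+ 2.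
  by rewrite /t expr2; case: (boolP (`|r s| <= k%:R)%R) => _; rewrite ?mul1r ?mul0r.
have mtH k := measurable_comp_H (mt k).
have Lt k : L2 Q (fun x => t k (H x)) by apply: (@L2_bounded _ _ _ _ k%:R).
have nt k : \int[Q]_x (t k (H x) ^+ 2) <= nrm Q X ^+ 2.
  rewrite -sqr_nrm lerXn2r ?nnegrE ?nrm_ge0//.
  have : nrm Q (fun x => t k (H x)) ^+ 2 <=
     nrm Q (fun x => t k (H x)) * nrm Q X.
    rewrite sqr_nrm (@eq_ER _ _ _ _ _ (fun x => t k (H x) * r (H x))); last first.
      by move=> x; rewrite tr.
    rewrite (pull_out LX1 rX)//.
    - by apply: le_trans (ler_norm _) (cauchy_schwarz _ _).
    - exact: L2_mul.
    - by apply: (eq_L1 _ (L2_sq (Lt k))) => x; rewrite tr.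
  have := nrm_ge0 Q (fun x => t k (H x)).
  rewrite le_eqVlt => /predU1P[<- _|n0]; first exact: nrm_ge0.
  by rewrite expr2 ler_pM2l.
split; first exact: measurable_comp_H.
have m2 : measurable_fun [set: O] (fun x => (r (H x) ^+ 2)%:E).
  by apply/measurable_EFinP; apply: measurable_funX; exact: measurable_comp_H.
apply/integrableP; split => //.
under eq_integral do rewrite /= ger0_norm ?sqr_ge0//.
apply: (@le_lt_trans _ _ (nrm Q X ^+ 2)%:E); last exact: ltry.
have cv x : (t n (H x) ^+ 2)%:E @[n --> \oo] --> (r (H x) ^+ 2)%:E.
  apply: cvg_near_cst; near=> n; rewrite /t.
  suff -> : (`|r (H x)| <= n%:R)%R by rewrite mul1r.
  by near: n; exact: nbhs_infty_ger.
under eq_integral => x _ do rewrite -(cvg_lim _ (cv x))//.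
rewrite monotone_convergence//.
- apply: lime_le.
    apply: ereal_nondecreasing_is_cvgn => m n mn; apply: ge0_le_integral => //.
    + by move=> x _; rewrite lee_fin sqr_ge0.
    + by apply/measurable_EFinP; exact: measurable_funX.
    + by apply/measurable_EFinP; exact: measurable_funX.
    + move=> x _; rewrite lee_fin /t !exprMn ler_wpM2r ?sqr_ge0//.
      case: (boolP (_ <= m%:R)%R) => h; rewrite ?expr0n/= ?sqr_ge0//.
      by rewrite (le_trans h) ?ler_nat.
  by apply: nearW => n; rewrite -ER_EFin ?lee_fin//; exact: L2_sq.
- by move=> n; apply/measurable_EFinP; exact: measurable_funX.
- by move=> n x _; rewrite lee_fin sqr_ge0.
- move=> x _ m n mn; rewrite lee_fin /t !exprMn ler_wpM2r ?sqr_ge0//.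
  case: (boolP (_ <= m%:R)%R) => h; rewrite ?expr0n/= ?sqr_ge0//.
  by rewrite (le_trans h) ?ler_nat.
Unshelve. all: by end_near. Qed.

End conditional_means.

(** * Differentiability in quadratic mean *)

Section quadratic_mean_paths.
Context {d : measure_display} {O : measurableType d} {R : realType}.
Variables (P : probability O R) (Q : R -> probability O R) (s : O -> R).

(** Quantitative consequences of differentiability in quadratic mean at one th. The first estimate
    expresses that the Hellinger distance of P and [Q th] is at most [c |th|]. In the second a
    bounded [v] stands in for the score, because [s] is controlled under P only, whereas [v X] is
    integrable under [Q th] as well. *)
Definition qmd_bounds (c : R) (e : R -> R) (th : R) : Prop :=
  (forall (K : R) X, L2 P X -> L2 (Q th) X -> (forall x, `|X x| <= K) ->
     nrm P X <= nrm (Q th) X + K * (c * `|th|)) /\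
  (forall (v X : O -> R) (k C : R), measurable_fun [set: O] v ->
     0 <= k -> (forall x, `|v x| <= k) ->
     L2 P X -> L2 (Q th) X -> nrm P X <= C -> nrm (Q th) X <= C ->
     `|\int[Q th]_x X x - \int[P]_x X x - th * \int[Q th]_x (v x * X x)| <=
     `|th| * (C * (nrm P (fun x => s x - v x) + (1 + k) * e th))).

(** All integrals are moved to [nu], where a difference of densities factors as (q + p)(q - p), with
    p and q the roots of the densities at 0 and th. Here q - p is th/2 s p plus the remainder
    [D th], whose norm [n th] is o(th). *)
Lemma qmd_expansion : qmd_submodel P Q s ->
  exists (c : R) (e : R -> R), [/\ 0 <= c, e th @[th --> (0 : R)^'] --> (0 : R) &
    \forall th \near (0 : R)^', qmd_bounds c e th].
Proof.
move=> [QP /L2_Lfun Ls [nu [f [nearf cvf]]]].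
pose D th := fun o => Num.sqrt (f th o) - Num.sqrt (f 0 o)
               - th / 2 * s o * Num.sqrt (f 0 o).
pose n th := nrm nu (D th).
pose sg := nrm P s.
have sg0 : 0 <= sg by exact: nrm_ge0.
have [mf0 f00 Pf0] : [/\ measurable_fun [set: O] (f 0), forall o, 0 <= f 0 o &
    forall B, measurable B -> P B = (\int[nu]_(o in B) (f 0 o)%:E)%E].
  by have [? ? h] := nbhs_singleton nearf; split => // B mB; rewrite -QP// h.
have Lp X : L2 P X -> L2 nu (fun x => X x * Num.sqrt (f 0 x)) by exact: L2_density.
have nf : \forall th \near (0 : R)^', [/\ measurable_fun [set: O] (f th),
     forall o, 0 <= f th o &
     forall B, measurable B -> Q th B = (\int[nu]_(o in B) (f th o)%:E)%E].
  exact: cvg_within nearf.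
have L1p : L2 nu (fun x => Num.sqrt (f 0 x)).
  by apply: (eq_L2 _ (Lp _ (L2_cst P 1))) => x; rewrite mul1r.
have Lsp : L2 nu (fun x => s x * Num.sqrt (f 0 x)) by exact: Lp.
have nearL : \forall th \near (0 : R)^', L2 nu (fun x => Num.sqrt (f th x)) /\ L2 nu (D th).
  near=> th; have [mf ff Qf] : [/\ measurable_fun [set: O] (f th),
     forall o, 0 <= f th o &
     forall B, measurable B -> Q th B = (\int[nu]_(o in B) (f th o)%:E)%E].
    by near: th.
  have L1q : L2 nu (fun x => Num.sqrt (f th x)).
    by apply: (eq_L2 _ (L2_density mf ff Qf (L2_cst (Q th) 1))) => x; rewrite mul1r.
  split => //; apply: (eq_L2 _ (L2B (L2B L1q L1p) (L2Z (th / 2) Lsp))) => x.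
  by rewrite /D mulrA.
have cvn : n th / `|th| @[th --> (0 : R)^'] --> (0 : R).
  have : ((n th / `|th|) ^+ 2)%:E @[th --> (0 : R)^'] --> 0%:E.
    apply: cvg_trans cvf; apply: near_eq_cvg; near=> th.
    have [_ LD] : L2 nu (fun x => Num.sqrt (f th x)) /\ L2 nu (D th) by near: th.
    rewrite expr_div_n real_normK ?num_real// sqr_nrm -ER_EFin; last exact: L2_sq.
    by rewrite -EFinM; congr EFin; exact: mulrC.
  move=> /fine_cvgP[_ /= cv2].
  have := cvg_comp _ _ cv2 (@sqrt_continuous R 0); rewrite sqrtr0.
  apply: cvg_trans; apply: near_eq_cvg; near=> th.
  by rewrite /= sqrtr_sqr ger0_norm// divr_ge0// nrm_ge0.
have cvth : `|th| @[th --> (0 : R)^'] --> (0 : R).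
  rewrite -[X in _ --> X](normr0 R); apply: cvg_within_filter.
  by apply: cvg_norm; exact: cvg_id.
(* The first summand comes from pairing [D th], of norm [n th], with X(q + p), of norm at most 2C.
   The second is 3/2 times the bound on the norm of q - p and comes from a factor of norm at most 3C
   in the splitting below. *)
pose e th := 2 * (n th / `|th|) + 3 / 2 * (`|th| * (sg / 2) + n th / `|th| * `|th|).
exists (sg / 2 + 1), e; split.
- by rewrite addr_ge0// divr_ge0.
- suff : e th @[th --> (0 : R)^'] --> 2 * 0 + 3 / 2 * (0 * (sg / 2) + 0 * 0).
    by rewrite !(mulr0,mul0r,addr0).
  apply: cvgD; first exact: cvgMl_tmp.
  apply: cvgMl_tmp; apply: cvgD; first exact: cvgMr_tmp.
  exact: cvgM.
near=> th.
have th0 : th != 0 by near: th; exact: nbhs_dnbhs_neq.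
have nth : n th / `|th| <= 1.
  have : `|n th / `|th| | <= 1 by near: th; apply: cvgr0_norm_le.
  exact: le_trans (ler_norm _).
have [mf ff Qf] : [/\ measurable_fun [set: O] (f th),
     forall o, 0 <= f th o &
     forall B, measurable B -> Q th B = (\int[nu]_(o in B) (f th o)%:E)%E].
  by near: th.
have [L1q LD] : L2 nu (fun x => Num.sqrt (f th x)) /\ L2 nu (D th) by near: th.
have n0 : 0 <= n th by exact: nrm_ge0.
have ath : 0 < `|th| by rewrite normr_gt0.
have Ldiff := L2B L1q L1p.
pose m := nrm nu (fun x => Num.sqrt (f th x) - Num.sqrt (f 0 x)).
have mE : m <= `|th| * (sg / 2) + n th.
  rewrite /m (@eq_nrm _ _ _ _ _
    (fun x => th / 2 * (s x * Num.sqrt (f 0 x)) + D th x)); last first.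
    by move=> x; rewrite /D; ring.
  apply: (le_trans (nrmD (L2Z _ Lsp) LD)).
  rewrite nrmZ// (nrm_density mf0 f00 Pf0)// lerD2r normrM.
  by rewrite (@ger0_norm _ 2^-1) ?invr_ge0// -/sg -mulrA (mulrC 2^-1).
split=> [K X LPX LQX XK|v X k C mv k0 vk LPX LQX PC QC].
  rewrite -(nrm_density mf0 f00 Pf0)// -(nrm_density mf ff Qf)//.
  have mX : measurable_fun [set: O] X by case: LPX.
  have LX := L2_bM mX XK Ldiff.
  rewrite (@eq_nrm _ _ _ _ _ (fun x => X x * Num.sqrt (f th x) -
     X x * (Num.sqrt (f th x) - Num.sqrt (f 0 x)))); last by move=> x; ring.
  apply: (le_trans (nrmB (L2_density mf ff Qf LQX) LX)); rewrite lerD2l.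
  apply: (le_trans (nrm_bM mX XK Ldiff)).
  have [x0 _] := probability_inhabited P.
  have K0 : 0 <= K := le_trans (normr_ge0 _) (XK x0).
  apply: ler_wpM2l => //; apply: (le_trans mE).
  have : n th <= `|th| by rewrite -[leRHS]mul1r -ler_pdivrMr.
  nra.
have mX : measurable_fun [set: O] X by case: LPX.
have C0 : 0 <= C := le_trans (nrm_ge0 _ _) PC.
have LXp := L2_density mf0 f00 Pf0 LPX; have LXq := L2_density mf ff Qf LQX.
have nXp := nrm_density mf0 f00 Pf0 LPX; have nXq := nrm_density mf ff Qf LQX.
have LvX := L2_bM mv vk LQX.
have Lv : L2 P v := L2_bounded P mv vk.
have Lsv := L2B Ls Lv.
have Lsvp := L2_density mf0 f00 Pf0 Lsv.
have nsvp := nrm_density mf0 f00 Pf0 Lsv.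
rewrite (ER_density mf ff Qf (L2_L1 LQX)) (ER_density mf0 f00 Pf0 (L2_L1 LPX)).
rewrite (ER_density mf ff Qf (L2_L1 LvX)).
have i1 := L1_density mf ff Qf (L2_L1 LQX).
have i2 := L1_density mf0 f00 Pf0 (L2_L1 LPX).
have i3 := L1_density mf ff Qf (L2_L1 LvX).
rewrite -(ERZ th i3) -(ERB i1 i2) -(ERB (L1B i1 i2) (L1Z th i3)).
have LS := L2D LXq LXp.
have LS2 := L2D LXp (L2Z 2 LXq).
have Lvd := L2_bM mv vk (L2B L1p L1q).
have j1 := L2_mul LS LD.
have j2 := L1Z (th / 2) (L2_mul LS Lsvp).
have j3 := L1Z (th / 2) (L2_mul Lvd LS2).
(* With p and q the roots of the densities at 0 and th, the last summand uses (q + p) p - 2 q^2 = (p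
   - q)(p + 2 q). The three summands carry, in order, the remainder of the expansion, the error s -
   v, and the replacement of P by [Q th] in the term with [v]. *)
rewrite (@eq_ER _ _ _ _ _ (fun x =>
  (X x * Num.sqrt (f th x) + X x * Num.sqrt (f 0 x)) * D th x +
  th / 2 * ((X x * Num.sqrt (f th x) + X x * Num.sqrt (f 0 x)) *
    ((s x - v x) * Num.sqrt (f 0 x))) +
  th / 2 * ((v x * (Num.sqrt (f 0 x) - Num.sqrt (f th x))) *
    (X x * Num.sqrt (f 0 x) + 2 * (X x * Num.sqrt (f th x)))))); last first.
  move=> x; have := sqr_sqrtr (ff x); have := sqr_sqrtr (f00 x).
  rewrite /D; set a := Num.sqrt _; set b := Num.sqrt _ => <- <-.
  by field.
rewrite (ERD (L1D j1 j2) j3) (ERD j1 j2) (ERZ _ (L2_mul LS Lsvp)).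
rewrite (ERZ _ (L2_mul Lvd LS2)).
have nS : nrm nu (fun x => X x * Num.sqrt (f th x) + X x * Num.sqrt (f 0 x)) <= 2 * C.
  by apply: (le_trans (nrmD LXq LXp)); rewrite nXq nXp; lra.
have nS2 : nrm nu (fun x => X x * Num.sqrt (f 0 x) + 2 * (X x * Num.sqrt (f th x))) <= 3 * C.
  apply: (le_trans (nrmD LXp (L2Z 2 LXq))); rewrite nrmZ// nXq nXp.
  by rewrite ger0_norm//; lra.
have nvd : nrm nu (fun x => v x * (Num.sqrt (f 0 x) - Num.sqrt (f th x))) <= k * m.
  apply: (le_trans (nrm_bM mv vk (L2B L1p L1q))); rewrite /m -nrmN.
  by rewrite (@eq_nrm _ _ _ _ _ (fun x => Num.sqrt (f th x) - Num.sqrt (f 0 x)))// => x;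
    rewrite opprB.
have m0 : 0 <= m by exact: nrm_ge0.
have c1 := cauchy_schwarz LS LD; have c2 := cauchy_schwarz LS Lsvp.
have c3 := cauchy_schwarz Lvd LS2.
rewrite nsvp in c2.
set a := nrm P (fun x => s x - v x) in c2 *.
have a0 : 0 <= a by exact: nrm_ge0.
have {}c1 : `|\int[nu]_x ((X x * Num.sqrt (f th x) + X x * Num.sqrt (f 0 x)) * D th x)|
    <= 2 * C * n th by apply: (le_trans c1); rewrite ler_wpM2r.
have {}c2 := le_trans c2 (ler_wpM2r a0 nS).
have {}c3 := le_trans c3 (ler_pM (nrm_ge0 _ _) (nrm_ge0 _ _) nvd nS2).
apply: (le_trans (ler_normD _ _)); rewrite normrM.
apply: (le_trans (lerD (ler_normD _ _) (lexx _))); rewrite normrM.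
have -> : `|th / 2| = `|th| / 2 by rewrite normrM (@ger0_norm _ 2^-1)// invr_ge0.
have -> : `|th| * (C * (a + (1 + k) * e th)) =
   `|th| * C * a + (2 * C * n th + C * 3 / 2 * `|th| * (`|th| * (sg / 2) + n th)) +
   k * (2 * C * n th + C * 3 / 2 * `|th| * (`|th| * (sg / 2) + n th)).
  by rewrite /e; field; rewrite normr_eq0.
set I1 := `|\int[nu]_x _| in c1 *; set I2 := `|\int[nu]_x _| in c2 *.
set I3 := `|\int[nu]_x _| in c3 *.
have h2 : `|th| / 2 * I2 <= `|th| / 2 * (2 * C * a) by rewrite ler_wpM2l// divr_ge0.
have h3 : `|th| / 2 * I3 <= `|th| / 2 * (k * (`|th| * (sg / 2) + n th) * (3 * C)).
  rewrite ler_wpM2l ?divr_ge0// (le_trans c3)// ler_wpM2r ?mulr_ge0//.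
  by rewrite ler_wpM2l.
have p1 : 0 <= k * (2 * C * n th) by rewrite !mulr_ge0.
have p2 : 0 <= C * 3 / 2 * `|th| * (`|th| * (sg / 2) + n th).
  by rewrite !mulr_ge0 ?addr_ge0 ?mulr_ge0 ?divr_ge0.
by clear -h2 h3 c1 p1 p2; nra.
Unshelve. all: by end_near. Qed.

End quadratic_mean_paths.

(** * Truncation *)

Section truncation.
Context {d : measure_display} {X : measurableType d} {R : realType}.
Implicit Types (f : X -> R) (K : R).

Definition trunc K f (x : X) : R := (`|f x| <= K)%R%:R * f x.

Lemma measurable_trunc K f : measurable_fun [set: X] f ->
  measurable_fun [set: X] (trunc K f).
Proof.
move=> mf; apply: measurable_funM => //; apply: measurableT_comp => //=.
by apply: measurable_fun_ler => //; exact: measurableT_comp.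
Qed.

Lemma trunc_le K f x : `|trunc K f x| <= `|f x|.
Proof. by rewrite /trunc; case: (_ <= K); rewrite ?mul1r// mul0r normr0. Qed.

Lemma trunc_bounded K f x : 0 <= K -> `|trunc K f x| <= K.
Proof.
move=> K0; rewrite /trunc; case: (boolP (`|f x| <= K)); rewrite ?mul1r//.
by rewrite mul0r normr0.
Qed.

Lemma trunc_tail K f x : 0 < K -> `|f x - trunc K f x| <= f x ^+ 2 / K.
Proof.
move=> K0; rewrite ler_pdivlMr// /trunc; case: (leP `|f x| K) => h.
  by rewrite mul1r subrr normr0 mul0r sqr_ge0.
by rewrite mul0r subr0 -(real_normK (num_real (f x))) expr2 ler_wpM2l// ltW.
Qed.

Variable P : probability X R.

Lemma L2_trunc K f : L2 P f -> L2 P (trunc K f).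
Proof.
move=> Lf; apply: L2_le (Lf); first exact/measurable_trunc/(L2_measurable Lf).
by move=> x; exact: trunc_le.
Qed.

Lemma nrm_trunc K f : L2 P f -> nrm P (trunc K f) <= nrm P f.
Proof.
move=> Lf; apply: nrm_le (Lf) _ _; first exact/measurable_trunc/(L2_measurable Lf).
by move=> x; exact: trunc_le.
Qed.

(** Where [f] is cut, [|f| <= f^2 / K]. The bound sees the law only through the norm bound [C], so
    it is uniform along a path with bounded L2 norms. *)
Lemma ER_trunc_err (K C M : R) f (b : X -> R) : 0 < K -> L2 P f -> nrm P f <= C ->
  measurable_fun [set: X] b -> (forall x, `|b x| <= M) ->
  `|\int[P]_x (b x * f x) - \int[P]_x (b x * trunc K f x)| <= M * C ^+ 2 / K.
Proof.
move=> K0 Lf nC mb bM; have Lt := L2_trunc K Lf.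
have L1f := L2_L1 (L2_bM mb bM Lf); have L1t := L2_L1 (L2_bM mb bM Lt).
have [x0 _] := probability_inhabited P.
have M0 : 0 <= M := le_trans (normr_ge0 _) (bM x0).
rewrite -ERB//; apply: (le_trans (ER_abs (L1B L1f L1t))).
apply: (@le_trans _ _ (M / K * nrm P f ^+ 2)); last first.
  rewrite mulrAC ler_wpM2r ?invr_ge0 ?(ltW K0)// ler_wpM2l//.
  by rewrite lerXn2r ?nnegrE ?nrm_ge0// (le_trans _ nC)// nrm_ge0.
rewrite sqr_nrm -ERZ; last exact: L2_sq.
apply: ER_le; [exact: L1_norm (L1B L1f L1t)|exact: L1Z (L2_sq Lf)|].
move=> x; rewrite -mulrBr normrM mulrAC -mulrA.
by apply: ler_pM => //; exact: trunc_tail.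
Qed.

Lemma L2_approx_bounded f (eps : R) : L2 P f -> 0 < eps ->
  exists (k : R) (v : X -> R), [/\ 0 <= k, measurable_fun [set: X] v,
    forall x, `|v x| <= k & nrm P (fun x => f x - v x) <= eps].
Proof.
move=> Lf eps0; have mf := L2_measurable Lf.
have mt n : measurable_fun [set: X] (trunc n%:R f) by exact: measurable_trunc.
have dom n x : `|(f x - trunc n%:R f x) ^+ 2| <= f x ^+ 2.
  rewrite ger0_norm ?sqr_ge0// /trunc; case: (_ <= n%:R).
    by rewrite mul1r subrr expr0n/= sqr_ge0.
  by rewrite mul0r subr0.
have cv x : (fun n : nat => ((f x - trunc n%:R f x) ^+ 2)%:E) @ \oo --> 0%:E.
  apply: cvg_near_cst; near=> n; rewrite /trunc.
  suff -> : (`|f x| <= n%:R)%R by rewrite mul1r subrr expr0n.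
  by near: n; exact: nbhs_infty_ger.
have md n : measurable_fun [set: X] (fun x => ((f x - trunc n%:R f x) ^+ 2)%:E).
  by apply/measurable_EFinP/measurable_funX/measurable_funB.
have [_ _] := @dominated_convergence _ _ _ P [set: X] measurableT
  (fun n x => ((f x - trunc n%:R f x) ^+ 2)%:E) (cst 0%E)
  (fun x => (f x ^+ 2)%:E) md (measurable_cst _)
  (aeW _ (fun x _ => cv x)) (L2_sq Lf)
  (aeW _ (fun x n _ => dom n x)).
rewrite integral0 => /fine_cvgP[_ /= cvI].
have : \forall n \near \oo, `|fine (\int[P]_x ((f x - trunc n%:R f x) ^+ 2)%:E)| <= eps ^+ 2.
  by apply: cvgr0_norm_le cvI _ _; rewrite exprn_gt0.
move=> [n _ /(_ n (leqnn n)) /= h].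
exists n%:R, (trunc n%:R f); split => //; first by move=> x; exact: trunc_bounded.
apply: le_nrm => //; [exact: L2B Lf (L2_trunc _ Lf)|exact: ltW|].
exact: le_trans (ler_norm _) h.
Unshelve. all: by end_near. Qed.

End truncation.

(** * Conditional expectations as L2 projections *)

Section conditional_versions.
Context {d dS : measure_display} {O : measurableType d} {S : measurableType dS}
  {R : realType}.
Variables (H : O -> S).
Hypothesis mH : measurable_fun [set: O] H.
Implicit Types (Q : probability O R) (X : O -> R) (r F : S -> R).

(** For square-integrable [X] this is the orthogonal projection on functions of [H]. In this form it
    admits unbounded test functions and is insensitive to changes of [X] and [r] on null sets, which
    makes clipped versions admissible. *)
Definition cond_version Q X r : Prop :=
  [/\ measurable_fun [set: S] r, L2 Q (fun x => r (H x)) &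
      forall F, measurable_fun [set: S] F -> L2 Q (fun x => F (H x)) ->
        \int[Q]_x (F (H x) * r (H x)) = \int[Q]_x (F (H x) * X x)].

Lemma cond_mean_version Q X r : L2 Q X -> is_cond_mean Q H X r -> cond_version Q X r.
Proof.
move=> LX rX; have Lr := cond_mean_L2 mH LX rX; have [mr _ _] := rX.
split => // F mF LF; apply: pull_out => //; [exact: L2_L1|exact: L2_mul..].
Qed.

Lemma cond_version_ae_eq Q X X' r r' : measurable_fun [set: S] r' ->
  L2 Q X -> measurable_fun [set: O] X' ->
  {ae Q, forall x, r (H x) = r' (H x)} -> {ae Q, forall x, X x = X' x} ->
  cond_version Q X r -> cond_version Q X' r'.
Proof.
move=> mr' LX mX' rr XX [mr Lr rX]; have mHr := measurable_comp_H mH.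
split => //; first by apply: L2_ae_eq rr Lr; exact: mHr.
move=> F mF LF; have e := rX F mF LF.
rewrite -(@ae_eq_ER _ _ _ Q (fun x => F (H x) * r (H x))); last 3 first.
- by apply: measurable_funM; exact: mHr.
- by apply: measurable_funM; exact: mHr.
- by apply: filterS rr => x ->.
rewrite e; apply: ae_eq_ER.
- by apply: measurable_funM; [exact: mHr|exact: L2_measurable LX].
- by apply: measurable_funM => //; exact: mHr.
- by apply: filterS XX => x ->.
Qed.

Lemma nrm_cond_version Q X r : L2 Q X -> cond_version Q X r ->
  nrm Q (fun x => r (H x)) <= nrm Q X.
Proof.
move=> LX [mr Lr rX]; set a := nrm Q _; set b := nrm Q X.
have : a ^+ 2 <= a * b.
  rewrite sqr_nrm (@eq_ER _ _ _ _ _ (fun x => r (H x) * r (H x)))//.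
  by rewrite rX//; apply: le_trans (ler_norm _) (cauchy_schwarz Lr LX).
have : 0 <= a by exact: nrm_ge0.
rewrite le_eqVlt => /predU1P[<- _|a0]; first exact: nrm_ge0.
by rewrite expr2 ler_pM2l.
Qed.

(** The bound holds everywhere and not just Q-almost everywhere, so a version chosen under P stays
    bounded under every other law of a path. *)
Lemma bounded_cond_version Q X (M : R) : 0 <= M -> measurable_fun [set: O] X ->
  {ae Q, forall x, `|X x| <= M} ->
  exists r, cond_version Q X r /\ forall s, `|r s| <= M.
Proof.
move=> M0 mX XM.
have LX : L2 Q X.
  split => //; apply: (@ae_L1_le _ _ _ _ _ (fun=> M ^+ 2)).
  - exact: measurable_funX.
  - apply: filterS XM => x h; rewrite normrX lerXn2r ?nnegrE//.
  - exact: L2_L1 (L2_cst Q _).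
have rX := cond_meanP mH (L2_L1 LX); set r := cond_mean Q H X in rX.
have rM := cond_mean_bounded mH (L2_L1 LX) rX XM; have [mr _ _] := rX.
exists (fun s => Num.max (- M) (Num.min M (r s))); split.
  apply: cond_version_ae_eq (cond_mean_version LX rX) => //.
  - by apply: measurable_maxr => //; exact: measurable_minr.
  - apply: filterS rM => x; rewrite ler_norml => /andP[h1 h2].
    by rewrite (min_idPr h2) (max_idPr h1).
  - exact: aeW.
move=> s; rewrite ler_norml le_max lexx/= ge_max ge_min lexx/= andbT.
by rewrite (le_trans _ M0)// oppr_le0.
Qed.

End conditional_versions.

(** * Weak convergence along a path of laws *)

Section weak_convergence.
Context {d : measure_display} {O : measurableType d} {R : realType}.
Variables (P : probability O R) (Q : R -> probability O R) (s : O -> R).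
Hypothesis Qs : qmd_submodel P Q s.
Implicit Types X Y : R -> O -> R.

Definition L2_bounded_along X : Prop := exists C : R, 0 < C /\
  \forall th \near (0 : R)^', L2 (Q th) (X th) /\ nrm (Q th) (X th) <= C.

(** Each [X th] is meaningful only up to [Q th]-null sets, so it is paired with bounded functions
    under its own law; no limit in a fixed L2 space is taken. *)
Definition weakly_cvg X (X0 : O -> R) : Prop :=
  [/\ L2_bounded_along X, L2 P X0 &
      forall (u : O -> R) (M : R), measurable_fun [set: O] u ->
        (forall x, `|u x| <= M) ->
        \int[Q th]_x (u x * X th x) @[th --> (0 : R)^'] --> \int[P]_x (u x * X0 x)].

Lemma dnbhs_dist_le (f : R -> R) (l eps : R) :
  f th @[th --> (0 : R)^'] --> l -> 0 < eps ->
  \forall th \near (0 : R)^', `|l - f th| <= eps.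
Proof. by move=> cvf eps0; exact: (cvgr_dist_le _ _ cvf). Qed.

Lemma dnbhs_norm_le (f : R -> R) (eps : R) :
  f th @[th --> (0 : R)^'] --> (0 : R) -> 0 < eps ->
  \forall th \near (0 : R)^', `|f th| <= eps.
Proof. by move=> cvf eps0; exact: (cvgr0_norm_le _ cvf). Qed.

Lemma score_L2 : L2 P s. Proof. by have [_ /L2_Lfun] := Qs. Qed.

Lemma cvg_norm_dnbhs0 : `|th| @[th --> (0 : R)^'] --> (0 : R).
Proof.
rewrite -[X in _ --> X](normr0 R); apply: cvg_within_filter.
by apply: cvg_norm; exact: cvg_id.
Qed.

Lemma cvg_ER_bounded X (k : R) :
  (\forall th \near (0 : R)^', measurable_fun [set: O] (X th) /\
     forall x, `|X th x| <= k) ->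
  \int[Q th]_x X th x - \int[P]_x X th x @[th --> (0 : R)^'] --> (0 : R).
Proof.
move=> Xk; have [c [e [_ cve nearE]]] := qmd_expansion Qs.
have cvb : `|th| * (k * (nrm P s + (1 + 0) * e th)) @[th --> (0 : R)^'] --> (0 : R).
  rewrite -[X in _ --> X](mul0r (k * (nrm P s + (1 + 0) * 0))).
  apply: cvgM; first exact: cvg_norm_dnbhs0.
  by apply: cvgMl_tmp; apply: cvgD; [exact: cvg_cst|exact: cvgMl_tmp].
apply/cvgr0Pnorm_le => eps eps0; near=> th.
have [mX Xth] : measurable_fun [set: O] (X th) /\ forall x, `|X th x| <= k by near: th.
have [x0 _] := probability_inhabited P.
have k0 : 0 <= k := le_trans (normr_ge0 _) (Xth x0).
have [_ E] : qmd_bounds P Q s c e th by near: th.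
(* The score is approximated by 0: only the O(th) size of the difference is needed here. *)
have := E (fun=> 0) (X th) 0 k (measurable_cst _) (lexx _) _
  (L2_bounded P mX Xth) (L2_bounded (Q th) mX Xth)
  (nrm_bounded P k0 mX Xth) (nrm_bounded (Q th) k0 mX Xth).
rewrite (@eq_ER _ _ _ (Q th) (fun x => 0 * X th x) (fun=> 0)); last by move=> x; rewrite mul0r.
rewrite ER_cst mulr0 subr0 (@eq_nrm _ _ _ P _ s); last by move=> x; rewrite subr0.
move=> h; apply: (le_trans (h _)); first by move=> x; rewrite normr0.
apply: (le_trans (ler_norm _)).
by near: th; apply: cvgr0_norm_le cvb _ eps0.
Unshelve. all: by end_near. Qed.

(** Up to small errors the quotient is E_th[v X_th] with [v] a bounded approximation of the score,
    and this converges to E[v X0], which is close to E[s X0]. The additional bound in L2(P) is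
    required because [qmd_bounds] controls the error through the norms of [X th] under both laws. *)
Lemma weakly_cvg_difference_quotient X (X0 : O -> R) : weakly_cvg X X0 ->
  (exists C : R, \forall th \near (0 : R)^', L2 P (X th) /\ nrm P (X th) <= C) ->
  (\int[Q th]_x X th x - \int[P]_x X th x) / th @[th --> (0 : R)^'] -->
    \int[P]_x (s x * X0 x).
Proof.
move=> [[C1 [C10 nearQ]] LX0 cvX] [C2 nearP].
pose C := Num.max C1 C2.
have C0 : 0 < C by rewrite lt_max C10.
have [c [e [_ cve nearE]]] := qmd_expansion Qs.
apply/cvgrPdist_le => eps eps0.
have D0 : 0 < C + nrm P X0 by rewrite ltr_pwDl// nrm_ge0.
(* The error |s - v| enters twice, multiplied by [C] in the expansion and by the norm of [X0] in the
   limit; this tolerance covers both with a single third of [eps]. *)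
have [k [v [k0 mv vk nv]]] := L2_approx_bounded score_L2
  (divr_gt0 eps0 (mulr_gt0 (ltr0n _ 3) D0) : 0 < eps / (3 * (C + nrm P X0))).
have cv1 := cvX v k mv vk.
have cv2 : C * ((1 + k) * e th) @[th --> (0 : R)^'] --> (0 : R).
  rewrite -[X in _ --> X](mulr0 (C * (1 + k))).
  under eq_fun do rewrite mulrA.
  exact: cvgMl_tmp.
have eps3 : 0 < eps / 3 by rewrite divr_gt0.
have ncv1 := dnbhs_dist_le cv1 eps3; have ncv2 := dnbhs_norm_le cv2 eps3.
near=> th.
have th0 : th != 0 by near: th; exact: nbhs_dnbhs_neq.
have [LQ nQ] : L2 (Q th) (X th) /\ nrm (Q th) (X th) <= C1 by near: th.
have [LP nP] : L2 P (X th) /\ nrm P (X th) <= C2 by near: th.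
have [_ E] : qmd_bounds P Q s c e th by near: th.
have {}E := E v (X th) k C mv k0 vk LP LQ _ _.
have {}E : `|\int[Q th]_x X th x - \int[P]_x X th x - th * \int[Q th]_x (v x * X th x)| <=
    `|th| * (C * (nrm P (fun x => s x - v x) + (1 + k) * e th)).
  by apply: E; rewrite le_max ?nQ ?nP ?orbT.
have e1 : `|\int[P]_x (v x * X0 x) - \int[Q th]_x (v x * X th x)| <= eps / 3.
  by near: th.
have e2 : `|C * ((1 + k) * e th)| <= eps / 3.
  by near: th.
have LsX := L2_mul score_L2 LX0; have LvX := L2_mul (L2_bounded P mv vk) LX0.
have e3 : `|\int[P]_x (s x * X0 x) - \int[P]_x (v x * X0 x)| <=
    nrm P (fun x => s x - v x) * nrm P X0.
  rewrite -ERB//; apply: le_trans (cauchy_schwarz (L2B score_L2 (L2_bounded P mv vk)) LX0).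
  by rewrite le_eqVlt; apply/orP; left; apply/eqP; congr `| _ |; apply: eq_ER => x;
    rewrite mulrBl.
have e4 : `|\int[Q th]_x (v x * X th x) - (\int[Q th]_x X th x - \int[P]_x X th x) / th| <=
    C * (nrm P (fun x => s x - v x) + (1 + k) * e th).
  rewrite -(@ler_pM2l _ `|th|) ?normr_gt0//; apply: le_trans E.
  rewrite -normrM distrC mulrBr.
  by rewrite [th * (_ / th)]mulrC divfK.
set I := \int[P]_x (s x * X0 x) in e3 *; set I1 := \int[P]_x (v x * X0 x) in e1 e3.
set J := \int[Q th]_x (v x * _) in e1 e4.
set W := (_ / th) in e4 *.
have -> : I - W = (I - I1) + (I1 - J) + (J - W) by ring.
apply: (le_trans (ler_normD _ _)).
apply: (le_trans (lerD (ler_normD _ _) (lexx _))).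
set a := nrm P _ in nv e3 e4.
have aD : a * (C + nrm P X0) <= eps / 3.
  apply: (le_trans (ler_wpM2r (ltW D0) nv)); rewrite le_eqVlt; apply/orP; left.
  by apply/eqP; field; rewrite lt0r_neq0.
have e5 := le_trans (ler_norm _) e2.
lra.
Unshelve. all: by end_near. Qed.

Lemma L2_bounded_alongM X (b : O -> R) (M : R) : measurable_fun [set: O] b ->
  (forall x, `|b x| <= M) -> L2_bounded_along X ->
  L2_bounded_along (fun th x => b x * X th x).
Proof.
move=> mb bM [C [C0 nearC]]; have [x0 _] := probability_inhabited (Q 0).
have M0 : 0 <= M := le_trans (normr_ge0 _) (bM x0).
exists (M * C + 1); split; first by rewrite ltr_wpDl// mulr_ge0// ltW.
near=> th; have [LX nX] : L2 (Q th) (X th) /\ nrm (Q th) (X th) <= C by near: th.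
split; first exact: L2_bM bM LX.
apply: (le_trans (nrm_bM mb bM LX)).
by rewrite (@le_trans _ _ (M * C))// ?lerDl// ler_wpM2l.
Unshelve. all: by end_near. Qed.

Lemma weakly_cvgM X (X0 b : O -> R) (M : R) : measurable_fun [set: O] b ->
  (forall x, `|b x| <= M) -> weakly_cvg X X0 ->
  weakly_cvg (fun th x => b x * X th x) (fun x => b x * X0 x).
Proof.
move=> mb bM [Xb LX0 cvX]; split; [exact: L2_bounded_alongM bM Xb|exact: L2_bM bM LX0|].
move=> u N mu uN.
have ubNM x : `|u x * b x| <= N * M by rewrite normrM; exact: ler_pM.
have := cvX (fun x => u x * b x) (N * M) (measurable_funM mu mb) ubNM.
under eq_fun do under eq_Rintegral do rewrite -mulrA.
by under [in X in _ --> X]eq_Rintegral do rewrite -mulrA.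
Qed.

(** The truncated variable is bounded, and its expectations converge by [cvg_ER_bounded]; the tails
    are uniformly small by the second moments. *)
Lemma weakly_cvg_cst (Y : O -> R) : L2 P Y -> L2_bounded_along (fun=> Y) ->
  weakly_cvg (fun=> Y) Y.
Proof.
move=> LY Yb; split => // u M mu uM; have [C [C0 nearC]] := Yb.
apply/cvgrPdist_le => eps eps0.
have [x0 _] := probability_inhabited P.
have M0 : 0 <= M := le_trans (normr_ge0 _) (uM x0).
pose D := Num.max C (nrm P Y).
(* Each of the two truncation errors is then at most [eps / 4]; the summand 1 keeps [K] positive
   when [M] is 0. *)
pose K := 4 * (M * D ^+ 2 + 1) / eps.
have B0 : 0 < M * D ^+ 2 + 1 by rewrite ltr_wpDl// mulr_ge0// sqr_ge0.
have K0 : 0 < K by rewrite divr_gt0// mulr_gt0.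
have KD : M * D ^+ 2 / K <= eps / 4.
  rewrite ler_pdivrMr// /K.
  have -> : eps / 4 * (4 * (M * D ^+ 2 + 1) / eps) = M * D ^+ 2 + 1.
    by field; exact: lt0r_neq0.
  by rewrite lerDl.
have cvK : \int[Q th]_x (u x * trunc K Y x) - \int[P]_x (u x * trunc K Y x)
    @[th --> (0 : R)^'] --> (0 : R).
  apply: (@cvg_ER_bounded (fun th x => u x * trunc K Y x) (M * K)).
  apply: nearW => th; split.
    by apply: measurable_funM => //; exact/measurable_trunc/(L2_measurable LY).
  move=> x; rewrite normrM; apply: ler_pM => //; exact/trunc_bounded/ltW.
have eps2 : 0 < eps / 2 by rewrite divr_gt0.
have ncvK := dnbhs_norm_le cvK eps2.
near=> th.
have [LQ nQ] : L2 (Q th) Y /\ nrm (Q th) Y <= C by near: th.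
have nQD : nrm (Q th) Y <= D by rewrite le_max nQ.
have nPD : nrm P Y <= D by rewrite le_max lexx orbT.
have e1 := ER_trunc_err K0 LQ nQD mu uM; have e2 := ER_trunc_err K0 LY nPD mu uM.
have e3 : `|\int[Q th]_x (u x * trunc K Y x) - \int[P]_x (u x * trunc K Y x)| <= eps / 2.
  by near: th.
move: (le_trans e1 KD) (le_trans e2 KD) e3; rewrite !ler_norml.
move=> /andP[? ?] /andP[? ?] /andP[? ?]; apply/andP; split; lra.
Unshelve. all: by end_near. Qed.

(** Cauchy-Schwarz: a factor tending to 0 in norm times a family that is merely bounded in L2.
    Boundedness of [m] keeps the product in L2. *)
Lemma weakly_cvg_vanishing X (m : R -> O -> R) (M : R) : L2_bounded_along X ->
  (\forall th \near (0 : R)^', measurable_fun [set: O] (m th) /\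
     forall x, `|m th x| <= M) ->
  nrm (Q th) (m th) @[th --> (0 : R)^'] --> (0 : R) ->
  weakly_cvg (fun th x => m th x * X th x) (fun=> 0).
Proof.
move=> [C [C0 nearC]] mM cvm; split.
- exists (`|M| * C + 1); split; first by rewrite ltr_wpDl// mulr_ge0// ltW.
  near=> th; have [LX nX] : L2 (Q th) (X th) /\ nrm (Q th) (X th) <= C by near: th.
  have [mm mthM] : measurable_fun [set: O] (m th) /\ forall x, `|m th x| <= M by near: th.
  have {}mthM x : `|m th x| <= `|M| := le_trans (mthM x) (ler_norm _).
  split; first exact: L2_bM mthM LX.
  apply: (le_trans (nrm_bM mm mthM LX)).
  by rewrite (@le_trans _ _ (`|M| * C))// ?lerDl// ler_wpM2l.
- exact: L2_cst.
move=> u N mu uN; rewrite (@eq_ER _ _ _ P _ (fun=> 0)) ?ER_cst; last by move=> x; rewrite mulr0.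
have [x0 _] := probability_inhabited P.
have N0 : 0 <= N := le_trans (normr_ge0 _) (uN x0).
have cvb : N * (nrm (Q th) (m th) * C) @[th --> (0 : R)^'] --> (0 : R).
  rewrite -[X in _ --> X](mulr0 N); apply: cvgMl_tmp.
  rewrite -[X in _ --> X](mul0r C); exact: cvgMr_tmp.
apply/cvgr0Pnorm_le => eps eps0; have ncvb := dnbhs_norm_le cvb eps0.
near=> th; have [LX nX] : L2 (Q th) (X th) /\ nrm (Q th) (X th) <= C by near: th.
have [mm mthM] : measurable_fun [set: O] (m th) /\ forall x, `|m th x| <= M by near: th.
have Lm := L2_bounded (Q th) mm mthM.
rewrite (@eq_ER _ _ _ _ _ (fun x => (u x * m th x) * X th x)); last by move=> x; rewrite mulrA.
apply: (le_trans (cauchy_schwarz (L2_bM mu uN Lm) LX)).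
apply: (@le_trans _ _ (N * (nrm (Q th) (m th) * C))).
  by rewrite mulrA; apply: ler_pM; rewrite ?nrm_ge0//; exact: nrm_bM.
apply: (le_trans (ler_norm _)).
by near: th.
Unshelve. all: by end_near. Qed.

End weak_convergence.

(** * Conditioning on the history along a path *)

Section conditioning_along_paths.
Context {d dS : measure_display} {O : measurableType d} {S : measurableType dS}
  {R : realType}.
Variables (P : probability O R) (Q : R -> probability O R) (s : O -> R).
Hypothesis Qs : qmd_submodel P Q s.
Variable H : O -> S.
Hypothesis mH : measurable_fun [set: O] H.

(** This is E_P[b | H] = 0. Only bounded test functions are allowed, since functions of [H] chosen
    under [Q th] need not be integrable under P. *)
Definition centered (b : O -> R) : Prop := forall (F : S -> R) (M : R),
  measurable_fun [set: S] F -> (forall h, `|F h| <= M) ->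
  \int[P]_x (b x * F (H x)) = 0.

(** No convergence of [h] is involved. After truncation at a fixed level the integral under P
    vanishes by centering, the integral under [Q th] is close to it, and the truncated part is small
    by the L2 bound. *)
Lemma centered_cvg0 (b : O -> R) (M : R) (h : R -> S -> R) :
  measurable_fun [set: O] b -> (forall x, `|b x| <= M) -> centered b ->
  (\forall th \near (0 : R)^', measurable_fun [set: S] (h th)) ->
  L2_bounded_along Q (fun th x => h th (H x)) ->
  \int[Q th]_x (b x * h th (H x)) @[th --> (0 : R)^'] --> (0 : R).
Proof.
move=> mb bM cb mh [C [C0 nearC]].
apply/cvgr0Pnorm_le => eps eps0.
have [x0 _] := probability_inhabited P.
have M0 : 0 <= M := le_trans (normr_ge0 _) (bM x0).
pose K := 2 * (M * C ^+ 2 + 1) / eps.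
have B0 : 0 < M * C ^+ 2 + 1 by rewrite ltr_wpDl// mulr_ge0// sqr_ge0.
have K0 : 0 < K by rewrite divr_gt0// mulr_gt0.
have KC : M * C ^+ 2 / K <= eps / 2.
  rewrite ler_pdivrMr// /K.
  have -> : eps / 2 * (2 * (M * C ^+ 2 + 1) / eps) = M * C ^+ 2 + 1.
    by field; exact: lt0r_neq0.
  by rewrite lerDl.
have cvK : \int[Q th]_x (b x * trunc K (h th) (H x)) -
    \int[P]_x (b x * trunc K (h th) (H x)) @[th --> (0 : R)^'] --> (0 : R).
  apply: (cvg_ER_bounded Qs (X := fun th x => b x * trunc K (h th) (H x)) (k := M * K)).
  apply: filterS mh => th mhth; split.
    by apply: measurable_funM => //; apply: measurable_comp_H => //; exact: measurable_trunc.
  by move=> x; rewrite normrM; apply: ler_pM => //; exact/trunc_bounded/ltW.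
have eps2 : 0 < eps / 2 by rewrite divr_gt0.
have ncvK := dnbhs_norm_le cvK eps2.
near=> th.
have mhth : measurable_fun [set: S] (h th) by near: th.
have [Lh nh] : L2 (Q th) (fun x => h th (H x)) /\ nrm (Q th) (fun x => h th (H x)) <= C.
  by near: th.
have e1 : `|\int[Q th]_x (b x * h th (H x)) -
    \int[Q th]_x (b x * trunc K (h th) (H x))| <= eps / 2.
  exact: le_trans (ER_trunc_err K0 Lh nh mb bM) KC.
have e2 : `|\int[Q th]_x (b x * trunc K (h th) (H x)) -
    \int[P]_x (b x * trunc K (h th) (H x))| <= eps / 2 by near: th.
rewrite (cb (trunc K (h th)) K) in e2; last 2 first.
- exact: measurable_trunc.
- by move=> y; exact/trunc_bounded/ltW.
rewrite subr0 in e2.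
move: e1 e2; rewrite !ler_norml => /andP[? ?] /andP[? ?]; apply/andP; split; lra.
Unshelve. all: by end_near. Qed.

(* The truncation level K / |th| is high enough for the removed part to be
   O(th / K), and low enough for the truncated functions to be bounded in L2(P):
   P and Q th are at Hellinger distance O(th). *)
Lemma centered_quotient (b : O -> R) (M : R) (h : R -> S -> R) (X0 : O -> R) :
  measurable_fun [set: O] b -> (forall x, `|b x| <= M) -> centered b ->
  (\forall th \near (0 : R)^', measurable_fun [set: S] (h th)) ->
  weakly_cvg P Q (fun th x => h th (H x)) X0 ->
  \int[Q th]_x (b x * h th (H x)) / th @[th --> (0 : R)^'] -->
    \int[P]_x (s x * (b x * X0 x)).
Proof.
move=> mb bM cb mh [[C [C0 nearC]] LX0 cvX].
apply/cvgrPdist_le => eps eps0.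
have [x0 _] := probability_inhabited P.
have M0 : 0 <= M := le_trans (normr_ge0 _) (bM x0).
pose K := 2 * (M * C ^+ 2 + 1) / eps.
have B0 : 0 < M * C ^+ 2 + 1 by rewrite ltr_wpDl// mulr_ge0// sqr_ge0.
have K0 : 0 < K by rewrite divr_gt0// mulr_gt0.
have KC : M * C ^+ 2 / K <= eps / 2.
  rewrite ler_pdivrMr// /K.
  have -> : eps / 2 * (2 * (M * C ^+ 2 + 1) / eps) = M * C ^+ 2 + 1.
    by field; exact: lt0r_neq0.
  by rewrite lerDl.
pose XK th := trunc (K / `|th|) (fun x => h th (H x)).
have mXK : \forall th \near (0 : R)^', measurable_fun [set: O] (XK th).
  by apply: filterS mh => th mhth; apply: measurable_trunc; exact: measurable_comp_H.
have LXK : \forall th \near (0 : R)^', L2 (Q th) (XK th) /\ nrm (Q th) (XK th) <= C.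
  near=> th.
  have [Lh nh] : L2 (Q th) (fun x => h th (H x)) /\ nrm (Q th) (fun x => h th (H x)) <= C.
    by near: th.
  by split; [exact: L2_trunc|exact: le_trans (nrm_trunc _ Lh) nh].
have trunc_small (u : O -> R) (N : R) : measurable_fun [set: O] u ->
    (forall x, `|u x| <= N) -> \forall th \near (0 : R)^',
    `|\int[Q th]_x (u x * h th (H x)) - \int[Q th]_x (u x * XK th x)| <=
      N * C ^+ 2 / K * `|th|.
  move=> mu uN; near=> th.
  have th0 : 0 < `|th| by rewrite normr_gt0; near: th; exact: nbhs_dnbhs_neq.
  have [Lh nh] : L2 (Q th) (fun x => h th (H x)) /\ nrm (Q th) (fun x => h th (H x)) <= C.
    by near: th.
  have := ER_trunc_err (divr_gt0 K0 th0) Lh nh mu uN.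
  by rewrite invf_div mulrA -mulrA (mulrC `|th|) mulrA.
have cvY : weakly_cvg P Q (fun th x => b x * XK th x) (fun x => b x * X0 x).
  apply: weakly_cvgM bM _ => //; split => //; first by exists C.
  move=> u N mu uN; apply/cvgrPdist_le => e e0.
  have cvN : N * C ^+ 2 / K * `|th| @[th --> (0 : R)^'] --> (0 : R).
    rewrite -[X in _ --> X](mulr0 (N * C ^+ 2 / K)); apply: cvgMl_tmp.
    exact: cvg_norm_dnbhs0.
  have e2 : 0 < e / 2 by rewrite divr_gt0.
  have n1 := dnbhs_norm_le cvN e2; have n2 := dnbhs_dist_le (cvX u N mu uN) e2.
  have n3 := trunc_small u N mu uN.
  near=> th.
  have h1 : `|N * C ^+ 2 / K * `|th| | <= e / 2 by near: th.
  have h2 : `|\int[P]_x (u x * X0 x) - \int[Q th]_x (u x * h th (H x))| <= e / 2 by near: th.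
  have h3 : `|\int[Q th]_x (u x * h th (H x)) - \int[Q th]_x (u x * XK th x)| <=
      N * C ^+ 2 / K * `|th| by near: th.
  move: h2 (le_trans h3 (le_trans (ler_norm _) h1)); rewrite !ler_norml.
  by move=> /andP[? ?] /andP[? ?]; apply/andP; split; lra.
have PY : exists C' : R, \forall th \near (0 : R)^',
    L2 P (fun x => b x * XK th x) /\ nrm P (fun x => b x * XK th x) <= C'.
  have [c [e [c0 _ nearE]]] := qmd_expansion Qs.
  exists (M * (C + K * c)); near=> th.
  have th0 : 0 < `|th| by rewrite normr_gt0; near: th; exact: nbhs_dnbhs_neq.
  have mX : measurable_fun [set: O] (XK th) by near: th.
  have [LX nX] : L2 (Q th) (XK th) /\ nrm (Q th) (XK th) <= C by near: th.
  have [E _] : qmd_bounds P Q s c e th by near: th.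
  have XKb x : `|XK th x| <= K / `|th| by apply: trunc_bounded; rewrite divr_ge0// ltW.
  have LPX := L2_bounded P mX XKb.
  split; first exact: L2_bM bM LPX.
  apply: (le_trans (nrm_bM mb bM LPX)); rewrite ler_wpM2l//.
  apply: (le_trans (E _ _ LPX LX XKb)).
  rewrite -mulrA (mulrC c) (mulrA _^-1) mulVf ?lt0r_neq0// mul1r.
  by rewrite lerD2r.
have eps2 : 0 < eps / 2 by rewrite divr_gt0.
have n1 := dnbhs_dist_le (weakly_cvg_difference_quotient Qs cvY PY) eps2.
have n2 := trunc_small b M mb bM.
near=> th.
have th0 : 0 < `|th| by rewrite normr_gt0; near: th; exact: nbhs_dnbhs_neq.
have mhth : measurable_fun [set: S] (h th) by near: th.
have h1 : `|\int[P]_x (s x * (b x * X0 x)) -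
  (\int[Q th]_x (b x * XK th x) - \int[P]_x (b x * XK th x)) / th| <= eps / 2 by near: th.
have h2 : `|\int[Q th]_x (b x * h th (H x)) - \int[Q th]_x (b x * XK th x)| <=
   M * C ^+ 2 / K * `|th| by near: th.
have e3 : \int[P]_x (b x * XK th x) = 0.
  apply: (cb (trunc (K / `|th|) (h th)) (K / `|th|)); first exact: measurable_trunc.
  by move=> y; apply: trunc_bounded; rewrite divr_ge0// ltW.
rewrite e3 subr0 in h1.
have {}h2 : `|\int[Q th]_x (b x * h th (H x)) / th - \int[Q th]_x (b x * XK th x) / th| <= eps / 2.
  rewrite -mulrBl normrM normfV ler_pdivrMr//; apply: (le_trans h2).
  by rewrite ler_wpM2r.
move: h1 h2; rewrite !ler_norml.
by move=> /andP[? ?] /andP[? ?]; apply/andP; split; lra.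
Unshelve. all: by end_near. Qed.

(** Conditioning is moved to the test function. With v = E_P[u | H] one has E_th[u r_th] =
    E_th[(u - v) r_th] + E_th[v X_th]. The first term tends to 0 because u - v is centered under P;
    the second tends to E[v X0] = E[u r0]. *)
Lemma weakly_cvg_cond (X : R -> O -> R) (X0 : O -> R) (r : R -> S -> R) (r0 : S -> R) :
  weakly_cvg P Q X X0 ->
  (\forall th \near (0 : R)^', cond_version H (Q th) (X th) (r th)) ->
  cond_version H P X0 r0 ->
  weakly_cvg P Q (fun th x => r th (H x)) (fun x => r0 (H x)).
Proof.
move=> [[C [C0 nearC]] LX0 cvX] rX [mr0 Lr0 r0X].
have rb : L2_bounded_along Q (fun th x => r th (H x)).
  exists C; split => //; near=> th.
  have [LX nX] : L2 (Q th) (X th) /\ nrm (Q th) (X th) <= C by near: th.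
  have rth : cond_version H (Q th) (X th) (r th) by near: th.
  split; first by case: rth.
  exact: le_trans (nrm_cond_version LX rth) nX.
split => // u M mu uM.
have [x0 _] := probability_inhabited P.
have M0 : 0 <= M := le_trans (normr_ge0 _) (uM x0).
have [v [[mv Lv uv] vM]] := bounded_cond_version mH M0 mu (aeW P uM).
have mvH := measurable_comp_H mH mv.
have vHM x : `|v (H x)| <= M by exact: vM.
pose b x := u x - v (H x).
have mb : measurable_fun [set: O] b by exact: measurable_funB.
have bM x : `|b x| <= M + M by apply: (le_trans (ler_normB _ _)); exact: lerD.
have cb : centered b.
  move=> F N mF FN; have mFH := measurable_comp_H mH mF.
  have LF : L2 P (fun x => F (H x)) by apply: (@L2_bounded _ _ _ _ N).
  have Lu := L2_bounded P mu uM.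
  rewrite (@eq_ER _ _ _ _ _ (fun x => F (H x) * u x - F (H x) * v (H x))); last first.
    by move=> x; rewrite /b; ring.
  by rewrite ERB; [rewrite uv// subrr|exact: L2_mul..].
have mr : \forall th \near (0 : R)^', measurable_fun [set: S] (r th).
  by apply: filterS rX => th [].
have cv0 := centered_cvg0 mb bM cb mr rb.
have cv1 := cvX _ M mvH vHM.
have eP : \int[P]_x (v (H x) * X0 x) = \int[P]_x (u x * r0 (H x)).
  rewrite -r0X// (@eq_ER _ _ _ P _ (fun x => r0 (H x) * v (H x))); last by move=> x; rewrite mulrC.
  by rewrite uv//; apply: eq_ER => x; rewrite mulrC.
have cvD : \int[Q th]_x (b x * r th (H x)) + \int[Q th]_x (v (H x) * X th x)
    @[th --> (0 : R)^'] --> \int[P]_x (u x * r0 (H x)).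
  by rewrite -eP -[X in _ --> X]add0r; exact: cvgD.
move: cvD; apply: cvg_trans; apply: near_eq_cvg; near=> th.
have [mrth Lrth rthX] : cond_version H (Q th) (X th) (r th) by near: th.
have Lv' := L2_bounded (Q th) mvH vHM.
rewrite /= -rthX//.
have Lvr := L2_L1 (L2_bM mvH vHM Lrth); have Lbr := L2_L1 (L2_bM mb bM Lrth).
by rewrite -ERD//; apply: eq_ER => x; rewrite /b; ring.
Unshelve. all: by end_near. Qed.

End conditioning_along_paths.

(** * One time point *)

Section bounded_measurable.
Context {d : measure_display} {X : measurableType d} {R : realType}.
Implicit Types f g : X -> R.

Definition bmfun f : Prop :=
  measurable_fun [set: X] f /\ exists M : R, forall x, `|f x| <= M.

Lemma bmfun_cst c : bmfun (fun=> c).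
Proof. by split => //; exists `|c|. Qed.

Lemma bmfunD f g : bmfun f -> bmfun g -> bmfun (fun x => f x + g x).
Proof.
move=> [mf [M fM]] [mg [N gN]]; split; first exact: measurable_funD.
by exists (M + N) => x; apply: (le_trans (ler_normD _ _)); exact: lerD.
Qed.

Lemma bmfunN f : bmfun f -> bmfun (fun x => - f x).
Proof.
move=> [mf [M fM]]; split; first exact: measurable_funN.
by exists M => x; rewrite normrN.
Qed.

Lemma bmfunB f g : bmfun f -> bmfun g -> bmfun (fun x => f x - g x).
Proof. by move=> bf /bmfunN; exact: bmfunD. Qed.

Lemma bmfunM f g : bmfun f -> bmfun g -> bmfun (fun x => f x * g x).
Proof.
move=> [mf [M fM]] [mg [N gN]]; split; first exact: measurable_funM.
by exists (M * N) => x; rewrite normrM; exact: ler_pM.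
Qed.

Lemma measurable_inv f : measurable_fun [set: X] f ->
  measurable_fun [set: X] (fun x => (f x)^-1).
Proof.
(* The convention that 0 is its own inverse makes the identity hold also at zeros of [f], where the
   first factor is 0. *)
move=> mf; have -> : (fun x => (f x)^-1) = (fun x => f x * powR (f x ^+ 2) (-1)).
  apply/funext => x; rewrite powR_inv1 ?sqr_ge0//.
  have [->|fx0] := eqVneq (f x) 0; first by rewrite invr0 mul0r.
  by field.
apply: measurable_funM => //.
by apply: (measurableT_comp (measurable_powR (-1))); exact: measurable_funX.
Qed.

Lemma bmfunV (eps : R) f : 0 < eps -> (forall x, eps <= `|f x|) ->
  measurable_fun [set: X] f -> bmfun (fun x => (f x)^-1).
Proof.
move=> e0 fe mf; split; first exact: measurable_inv.
exists eps^-1 => x; rewrite normfV lef_pV2 ?posrE// (lt_le_trans e0)//.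
Qed.

Lemma L2_bmM (mu : {measure set X -> \bar R}) f g : bmfun f -> L2 mu g ->
  L2 mu (fun x => f x * g x).
Proof. by move=> [mf [M fM]]; exact: L2_bM fM. Qed.

Lemma bmfun_L2 (P : probability X R) f : bmfun f -> L2 P f.
Proof. by move=> [mf [M fM]]; exact: L2_bounded fM. Qed.

End bounded_measurable.

Lemma bmfun_comp {d dS : measure_display} {O : measurableType d}
  {S : measurableType dS} {R : realType} (H : O -> S) (F : S -> R) :
  measurable_fun [set: O] H -> bmfun F -> bmfun (fun x => F (H x)).
Proof. by move=> mH [mF [M FM]]; split; [exact: measurable_comp_H|exists M => x]. Qed.

Section one_step.
Context {d dS : measure_display} {O : measurableType d} {S : measurableType dS}
  {R : realType}.
Variable H : O -> S.
Hypothesis mH : measurable_fun [set: O] H.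
Variables (Z A : O -> R).
Hypothesis bZ : bmfun Z.
Hypothesis bA : bmfun A.

(* The nuisance functions of one time point under the law Q, with next pseudo-outcome
   G. Conditional expectations are determined only almost everywhere, so versions
   satisfying the bounds everywhere are chosen. *)
Record step (eps M : R) (Q : probability O R) (G : O -> R)
    (rho delta kappa eta gam : S -> R) : Prop := Step {
  step_rho : measurable_fun [set: S] rho /\ forall h, `|rho h| <= M;
  step_delta : measurable_fun [set: S] delta /\ forall h, `|delta h| <= M;
  step_kappa : measurable_fun [set: S] kappa /\ forall h, `|kappa h| <= M;
  step_sep : forall h, eps <= `|kappa h|;
  step_mgam : measurable_fun [set: S] gam;
  step_G : L2 Q G;
  step_gam : L2 Q (fun x => gam (H x));
  step_Z : cond_version H Q Z rho;
  step_A : cond_version H Q A delta;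
  step_AZ : cond_version H Q (fun x => A x * Z x) (fun h => kappa h + delta h * rho h);
  step_AG : cond_version H Q (fun x => A x * G x) eta;
  step_AZG : cond_version H Q (fun x => A x * Z x * G x)
    (fun h => kappa h * gam h + rho h * eta h) }.

Lemma bmfun_of (M : R) (f : S -> R) :
  measurable_fun [set: S] f /\ (forall h, `|f h| <= M) -> bmfun f.
Proof. by move=> [mf fM]; split => //; exists M. Qed.

Lemma version_zero Q (X : O -> R) (r F : S -> R) : cond_version H Q X r ->
  L2 Q X -> measurable_fun [set: S] F -> L2 Q (fun x => F (H x)) ->
  L1 Q (fun x => F (H x) * (X x - r (H x))) /\
  \int[Q]_x (F (H x) * (X x - r (H x))) = 0.
Proof.
move=> [mr Lr rX] LX mF LF; split; first exact: L2_mul LF (L2B LX Lr).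
rewrite (@eq_ER _ _ _ _ _ (fun x => F (H x) * X x - F (H x) * r (H x))); last first.
  by move=> x; rewrite mulrBr.
by rewrite ERB ?rX ?subrr//; exact: L2_mul.
Qed.

Definition ipw (rho kappa : S -> R) (x : O) : R := (Z x - rho (H x)) * A x / kappa (H x).

(** The coefficient of gamma_t in the influence function. It has conditional mean 0 given [H],
    because kappa is the conditional covariance of A and Z. *)
Definition residual (rho delta kappa : S -> R) (x : O) : R :=
  1 - (Z x - rho (H x)) * (A x - delta (H x)) / kappa (H x).

Section step_facts.
Variables (eps M : R) (Q : probability O R) (G : O -> R).
Variables (rho delta kappa eta gam : S -> R).
Hypothesis eps0 : 0 < eps.
Hypothesis st : step eps M Q G rho delta kappa eta gam.

Let brho : bmfun rho := bmfun_of (step_rho st).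
Let bdelta : bmfun delta := bmfun_of (step_delta st).
Let bkappaV : bmfun (fun h => (kappa h)^-1).
Proof. exact: bmfunV eps0 (step_sep st) (step_kappa st).1. Qed.

Let kappa_neq0 h : kappa h != 0.
Proof. by rewrite -normr_gt0 (lt_le_trans eps0)// (step_sep st). Qed.

Let LAG : L2 Q (fun x => A x * G x). Proof. exact: L2_bmM bA (step_G st). Qed.

Let LAZG : L2 Q (fun x => A x * Z x * G x).
Proof. exact: L2_bmM (bmfunM bA bZ) (step_G st). Qed.

Let LAZ : L2 Q (fun x => A x * Z x). Proof. exact: bmfun_L2 (bmfunM bA bZ). Qed.

Lemma bmfun_ipw : bmfun (ipw rho kappa).
Proof.
apply: bmfunM; last exact: (bmfun_comp mH bkappaV).
by apply: bmfunM => //; apply: bmfunB => //; exact: bmfun_comp.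
Qed.

Lemma bmfun_residual : bmfun (residual rho delta kappa).
Proof.
apply: bmfunB; first exact: bmfun_cst.
apply: bmfunM; last exact: (bmfun_comp mH bkappaV).
by apply: bmfunM; apply: bmfunB => //; exact: bmfun_comp.
Qed.

(** Given [H], (Z - rho) A G has mean (kappa gam + rho eta) - rho eta = kappa gam. So gam is the
    regression of the inversely weighted next pseudo-outcome, which is what makes the backward
    recursion reproduce the weighted mean of [Y]. *)
Lemma step_mean (F : S -> R) : measurable_fun [set: S] F -> L2 Q (fun x => F (H x)) ->
  \int[Q]_x (F (H x) * gam (H x)) = \int[Q]_x (F (H x) * (ipw rho kappa x * G x)).
Proof.
move=> mF LF; have LFV := L2_bmM (bmfun_comp mH bkappaV) LF.
have mFV : measurable_fun [set: S] (fun h => (kappa h)^-1 * F h).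
  by apply: measurable_funM => //; case: bkappaV.
have [i1 e1] := version_zero (step_AZG st) LAZG mFV LFV.
have mFVr : measurable_fun [set: S] (fun h => rho h * ((kappa h)^-1 * F h)).
  by apply: measurable_funM => //; case: brho.
have [i2 e2] := version_zero (step_AG st) LAG mFVr (L2_bmM (bmfun_comp mH brho) LFV).
have L1F := L2_mul LF (step_gam st).
have L1w := L2_mul LF (L2_bmM bmfun_ipw (step_G st)).
apply/eqP; rewrite -subr_eq0 -ERB//; apply/eqP.
have e3 := ERB i2 i1; rewrite e1 e2 subrr in e3.
by rewrite -e3; apply: eq_ER => x; rewrite /ipw; field; exact: kappa_neq0.
Qed.

(** By [step_mean], gam is the projection of [ipw] times [G], so testing it against itself gives a
    bound depending only on the size of the weight. This is uniform in the law. *)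
Lemma nrm_step_gam (W : R) : (forall x, `|ipw rho kappa x| <= W) ->
  nrm Q (fun x => gam (H x)) <= W * nrm Q G.
Proof.
move=> wW; have [mw _] := bmfun_ipw; have [x0 _] := probability_inhabited Q.
have W0 : 0 <= W := le_trans (normr_ge0 _) (wW x0).
have Lg := step_gam st; set a := nrm Q _.
have : a ^+ 2 <= a * (W * nrm Q G).
  rewrite sqr_nrm (@eq_ER _ _ _ _ _ (fun x => gam (H x) * gam (H x)))//.
  rewrite (step_mean (step_mgam st) Lg).
  apply: (le_trans (ler_norm _)).
  apply: (le_trans (cauchy_schwarz Lg (L2_bM mw wW (step_G st)))).
  rewrite ler_wpM2l ?nrm_ge0//; exact: nrm_bM (step_G st).
have : 0 <= a by exact: nrm_ge0.
rewrite le_eqVlt => /predU1P[<- _|a0]; first by rewrite mulr_ge0// nrm_ge0.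
by rewrite expr2 ler_pM2l.
Qed.

Lemma centered_Z : centered Q H (fun x => Z x - rho (H x)).
Proof.
move=> F N mF FN; have LF : L2 Q (fun x => F (H x)).
  by apply: bmfun_L2; apply: bmfun_comp => //; split => //; exists N.
have [_ <-] := version_zero (step_Z st) (bmfun_L2 Q bZ) mF LF.
by apply: eq_ER => x; rewrite mulrC.
Qed.

Lemma centered_A : centered Q H (fun x => A x - delta (H x)).
Proof.
move=> F N mF FN; have LF : L2 Q (fun x => F (H x)).
  by apply: bmfun_L2; apply: bmfun_comp => //; split => //; exists N.
have [_ <-] := version_zero (step_A st) (bmfun_L2 Q bA) mF LF.
by apply: eq_ER => x; rewrite mulrC.
Qed.

(** The product (Z - rho)(A - delta) is expanded, and the regressions of AZ, A and Z are subtracted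
    with coefficients 1/kappa, rho/kappa and delta/kappa; what remains is the residual. *)
Lemma residual_zero (F : S -> R) : measurable_fun [set: S] F -> L2 Q (fun x => F (H x)) ->
  \int[Q]_x (residual rho delta kappa x * F (H x)) = 0.
Proof.
move=> mF LF.
have mFV : measurable_fun [set: S] (fun h => (kappa h)^-1 * F h).
  by apply: measurable_funM => //; case: bkappaV.
have LFV := L2_bmM (bmfun_comp mH bkappaV) LF.
have mFr : measurable_fun [set: S] (fun h => rho h * ((kappa h)^-1 * F h)).
  by apply: measurable_funM => //; case: brho.
have mFd : measurable_fun [set: S] (fun h => delta h * ((kappa h)^-1 * F h)).
  by apply: measurable_funM => //; case: bdelta.
have [i1 e1] := version_zero (step_AZ st) LAZ mFV LFV.
have [i2 e2] := version_zero (step_A st) (bmfun_L2 Q bA) mFr (L2_bmM (bmfun_comp mH brho) LFV).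
have [i3 e3] := version_zero (step_Z st) (bmfun_L2 Q bZ) mFd (L2_bmM (bmfun_comp mH bdelta) LFV).
have e4 := ERD (L1B i2 i1) i3; rewrite (ERB i2 i1) e1 e2 e3 subrr addr0 in e4.
rewrite -e4; apply: eq_ER => x; rewrite /residual; field; exact: kappa_neq0.
Qed.

Lemma centered_residual : centered Q H (residual rho delta kappa).
Proof.
move=> F N mF FN; apply: residual_zero => //.
by apply: bmfun_L2; apply: bmfun_comp => //; split => //; exists N.
Qed.

Lemma L2_augmentation (F : S -> R) : bmfun F ->
  L2 Q (fun x => F (H x) * (residual rho delta kappa x * gam (H x) -
    (Z x - rho (H x)) * eta (H x) / kappa (H x))).
Proof.
move=> bF; have [_ Le _] := step_AG st.
apply: L2_bmM; first exact: bmfun_comp.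
apply: L2B; first exact: L2_bmM bmfun_residual (step_gam st).
have bZr : bmfun (fun x => (Z x - rho (H x)) / kappa (H x)).
  apply: bmfunM; last exact: (bmfun_comp mH bkappaV).
  by apply: bmfunB => //; exact: bmfun_comp.
by apply: (eq_L2 _ (L2_bmM bZr Le)) => x; ring.
Qed.

Lemma augmentation_mean0 (F : S -> R) : bmfun F ->
  \int[Q]_x (F (H x) * (residual rho delta kappa x * gam (H x) -
    (Z x - rho (H x)) * eta (H x) / kappa (H x))) = 0.
Proof.
move=> bF; have [me Le _] := step_AG st; have bFH := bmfun_comp mH bF.
have LFg := L2_bmM bFH (step_gam st).
have bFk : bmfun (fun h => F h / kappa h) by exact: bmfunM.
have LFe := L2_bmM (bmfun_comp mH bFk) Le.
have [i e] := version_zero (step_Z st) (bmfun_L2 Q bZ) (measurable_funM bFk.1 me) LFe.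
have h := residual_zero (measurable_funM bF.1 (step_mgam st)) LFg.
have i' := L2_L1 (L2_bmM bmfun_residual LFg).
have := ERB i' i; rewrite h e subrr => <-.
by apply: eq_ER => x /=; ring.
Qed.

(* The nuisances rho0, delta0, kappa0 need not be those of Q: the error of
   weighting by them is first order in quantities that are conditionally centered
   under the law they come from, plus a second-order term. *)
Lemma step_expansion (rho0 delta0 kappa0 : S -> R) (F : S -> R) :
  bmfun rho0 -> bmfun delta0 -> bmfun kappa0 -> (forall h, eps <= `|kappa0 h|) ->
  bmfun F ->
  \int[Q]_x (F (H x) * gam (H x)) - \int[Q]_x (F (H x) * (ipw rho0 kappa0 x * G x)) =
  \int[Q]_x (residual rho0 delta0 kappa0 x * (F (H x) * gam (H x))) -
  \int[Q]_x ((Z x - rho0 (H x)) * (F (H x) / kappa0 (H x) * eta (H x))) +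
  \int[Q]_x ((Z x - rho0 (H x)) *
    ((delta (H x) - delta0 (H x)) * (F (H x) / kappa0 (H x) * gam (H x)))).
Proof.
move=> br0 bd0 bk0 k0e bF.
have k00 x : kappa0 (H x) != 0 by rewrite -normr_gt0 (lt_le_trans eps0).
have bkV : bmfun (fun h => (kappa0 h)^-1) by exact: bmfunV eps0 k0e bk0.1.
have bk : bmfun (fun h => F h / kappa0 h) by exact: bmfunM.
have [[mr0 md0] mk] := (br0.1, bd0.1, bk.1); have [mr md] := (brho.1, bdelta.1).
have mg := step_mgam st; have Lg := step_gam st.
have [me Le _] := step_AG st.
have [[br0H bd0H] bkH] := (bmfun_comp mH br0, bmfun_comp mH bd0, bmfun_comp mH bk).
have [[brH bdH] bFH] := (bmfun_comp mH brho, bmfun_comp mH bdelta, bmfun_comp mH bF).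
have Lkg := L2_bmM bkH Lg; have Lke := L2_bmM bkH Le.
have mkg := measurable_funM mk mg; have mke := measurable_funM mk me.
(* The two sides differ pointwise by a combination of the five innovations of AZG, AG, AZ, A and Z
   under Q, each multiplied by a function of [H], and each of these products has mean 0. The
   multipliers use rho0 and kappa0, which is why rho and kappa of Q leave no trace in the result. *)
have [i1 e1] := version_zero (step_AZG st) LAZG mk (bmfun_L2 Q bkH).
have [i2 e2] := version_zero (step_AG st) LAG (measurable_funM mr0 mk)
  (bmfun_L2 Q (bmfunM br0H bkH)).
have [i3 e3] := version_zero (step_AZ st) LAZ mkg Lkg.
have [i4 e4] := version_zero (step_A st) (bmfun_L2 Q bA) (measurable_funM mr0 mkg)
  (L2_bmM br0H Lkg).
have [i5 e5] := version_zero (step_Z st) (bmfun_L2 Q bZ)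
  (measurable_funB mke (measurable_funM md mkg)) (L2B Lke (L2_bmM bdH Lkg)).
have bZr : bmfun (fun x => Z x - rho0 (H x)) by exact: bmfunB.
have bres : bmfun (residual rho0 delta0 kappa0).
  apply: bmfunB; first exact: bmfun_cst.
  apply: bmfunM; last exact: (bmfun_comp mH bkV).
  by apply: bmfunM => //; exact: bmfunB.
have bw0 : bmfun (ipw rho0 kappa0).
  apply: bmfunM; last exact: (bmfun_comp mH bkV).
  exact: bmfunM.
have j1 := L2_L1 (L2_bmM bFH Lg).
have j2 := L2_L1 (L2_bmM bFH (L2_bmM bw0 (step_G st))).
have j3 := L2_L1 (L2_bmM bres (L2_bmM bFH Lg)).
have j4 := L2_L1 (L2_bmM bZr Lke).
have j5 := L2_L1 (L2_bmM bZr (L2_bmM (bmfunB bdH bd0H) Lkg)).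
apply/eqP; rewrite -subr_eq0 -(ERB j1 j2) -(ERB j3 j4) -(ERD (L1B j3 j4) j5).
rewrite -(ERB (L1B j1 j2) (L1D (L1B j3 j4) j5)); apply/eqP.
have := ERD (L1B (L1D (L1B i2 i1) i3) i4) i5.
rewrite (ERB (L1D (L1B i2 i1) i3) i4) (ERD (L1B i2 i1) i3) (ERB i2 i1).
rewrite e1 e2 e3 e4 e5 !(subrr,addr0,subr0) => <-.
by apply: eq_ER => x; rewrite /residual /ipw /=; field; exact: k00.
Qed.

End step_facts.

Section step_path.
Variables (P : probability O R) (Q : R -> probability O R) (s : O -> R).
Hypothesis Qs : qmd_submodel P Q s.
Variables (eps M : R).
Hypothesis eps0 : 0 < eps.
Variables (G : R -> O -> R) (G0 : O -> R).
Variables (rho delta kappa eta gam : R -> S -> R).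
Variables (rho0 delta0 kappa0 eta0 gam0 : S -> R).
Hypothesis stQ : \forall th \near (0 : R)^',
  step eps M (Q th) (G th) (rho th) (delta th) (kappa th) (eta th) (gam th).
Hypothesis stP : step eps M P G0 rho0 delta0 kappa0 eta0 gam0.
Hypothesis wG : weakly_cvg P Q G G0.

Let br0 : bmfun rho0 := bmfun_of (step_rho stP).
Let bd0 : bmfun delta0 := bmfun_of (step_delta stP).
Let bk0 : bmfun kappa0 := bmfun_of (step_kappa stP).

Let bkV : bmfun (fun h => (kappa0 h)^-1).
Proof. exact: bmfunV eps0 (step_sep stP) bk0.1. Qed.

Let bZr : bmfun (fun x => Z x - rho0 (H x)).
Proof. by apply: bmfunB => //; exact: bmfun_comp. Qed.

Let bres : bmfun (residual rho0 delta0 kappa0). Proof. exact: bmfun_residual stP. Qed.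

(** Under [Q th] the innovation A - delta_th is orthogonal to functions of [H], so the squared norm
    equals E_th[(A - delta0)(delta_th - delta0)]. This tends to 0 since A - delta0 is centered under
    P. *)
Lemma delta_cvg : nrm (Q th) (fun x => delta th (H x) - delta0 (H x))
  @[th --> (0 : R)^'] --> (0 : R).
Proof.
have bb : bmfun (fun x => A x - delta0 (H x)).
  by apply: bmfunB => //; exact: bmfun_comp.
have [mb [N bN]] := bb.
have mh : \forall th \near (0 : R)^', measurable_fun [set: S] (fun h => delta th h - delta0 h).
  by apply: filterS stQ => th [_ [md _] *]; apply: measurable_funB => //; case: bd0.
have [x0 _] := probability_inhabited P.
have M0 : 0 <= M := le_trans (normr_ge0 _) ((step_delta stP).2 (H x0)).
have dM : \forall th \near (0 : R)^', forall x, `|delta th (H x) - delta0 (H x)| <= M + M.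
  apply: filterS stQ => th [_ [_ dM] *]; apply: (le_trans (ler_normB _ _)).
  by apply: lerD => //; exact: (step_delta stP).2.
have bh : L2_bounded_along Q (fun th x => delta th (H x) - delta0 (H x)).
  exists (M + M + 1); split; first by rewrite ltr_wpDl// addr_ge0.
  near=> th.
  have mth : measurable_fun [set: S] (fun h => delta th h - delta0 h) by near: th.
  have mthH := measurable_comp_H mH mth.
  have dth : forall x, `|delta th (H x) - delta0 (H x)| <= M + M by near: th.
  split; first exact: L2_bounded dth.
  by apply: le_trans (nrm_bounded (Q th) (addr_ge0 M0 M0) mthH dth) _; rewrite lerDl.
have cv := centered_cvg0 Qs mH mb bN (centered_A stP) mh bh.
have := cvg_comp _ _ cv (@sqrt_continuous R 0); rewrite sqrtr0.
apply: cvg_trans; apply: near_eq_cvg; near=> th.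
have st : step eps M (Q th) (G th) (rho th) (delta th) (kappa th) (eta th) (gam th) by near: th.
have mth : measurable_fun [set: S] (fun h => delta th h - delta0 h) by near: th.
have mthH := measurable_comp_H mH mth.
have dth : forall x, `|delta th (H x) - delta0 (H x)| <= M + M by near: th.
have LF : L2 (Q th) (fun x => delta th (H x) - delta0 (H x)) by exact: L2_bounded dth.
rewrite /= /nrm; congr Num.sqrt.
have [i e] := version_zero (step_A st) (bmfun_L2 (Q th) bA) mth LF.
rewrite -[LHS]subr0 -[X in _ - X]e -ERB//.
  by apply: eq_ER => x; ring.
by have := L2_L1 (L2_bmM bb LF).
Unshelve. all: by end_near. Qed.

Lemma gam_bounded_along : L2_bounded_along Q (fun th x => gam th (H x)).
Proof.
have [[C [C0 nearC]] _ _] := wG.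
have [mZ [MZ ZM]] := bZ; have [mA [MA AM]] := bA.
have [x0 _] := probability_inhabited P.
have MZ0 : 0 <= MZ := le_trans (normr_ge0 _) (ZM x0).
have MA0 : 0 <= MA := le_trans (normr_ge0 _) (AM x0).
have M0 : 0 <= M := le_trans (normr_ge0 _) ((step_delta stP).2 (H x0)).
(* A bound on [ipw] that serves all laws near P: |Z| + |rho| times |A|, over the separation of
   kappa. *)
pose W := (MZ + M) * MA / eps.
have W0 : 0 <= W by rewrite divr_ge0 ?mulr_ge0 ?addr_ge0// ltW.
exists (W * C + 1); split; first by rewrite ltr_wpDl// mulr_ge0// ltW.
near=> th.
have st : step eps M (Q th) (G th) (rho th) (delta th) (kappa th) (eta th) (gam th) by near: th.
have [LG nG] : L2 (Q th) (G th) /\ nrm (Q th) (G th) <= C by near: th.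
split; first exact: step_gam st.
apply: (@le_trans _ _ (W * C)); last by rewrite lerDl.
apply: (@le_trans _ _ (W * nrm (Q th) (G th))); last by rewrite ler_wpM2l.
have wW x : `|ipw (rho th) (kappa th) x| <= W.
  rewrite /ipw /W !normrM normfV; apply: ler_pM => //; last first.
    by rewrite lef_pV2 ?posrE ?(lt_le_trans eps0)// (step_sep st).
  apply: ler_pM => //; apply: (le_trans (ler_normB _ _)); apply: lerD => //.
  exact: (step_rho st).2.
have := nrm_step_gam eps0 st wW.
exact.
Unshelve. all: by end_near. Qed.

Lemma weakly_cvg_eta : weakly_cvg P Q (fun th x => eta th (H x)) (fun x => eta0 (H x)).
Proof.
have [mA [MA AM]] := bA.
apply: (weakly_cvg_cond Qs mH (weakly_cvgM mA AM wG)); last exact: step_AG stP.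
by apply: filterS stQ => th st; exact: step_AG st.
Qed.

Section weighted.
Variable F : S -> R.
Hypothesis bF : bmfun F.

Let bkH : bmfun (fun x => F (H x) / kappa0 (H x)).
Proof. by apply: bmfunM; [exact: bmfun_comp|exact: (bmfun_comp mH bkV)]. Qed.

Lemma reweighting_error_terms : \forall th \near (0 : R)^',
  \int[Q th]_x (F (H x) * gam th (H x)) -
    \int[Q th]_x (F (H x) * (ipw rho0 kappa0 x * G th x)) =
  \int[Q th]_x (residual rho0 delta0 kappa0 x * (F (H x) * gam th (H x))) -
  \int[Q th]_x ((Z x - rho0 (H x)) * (F (H x) / kappa0 (H x) * eta th (H x))) +
  \int[Q th]_x ((Z x - rho0 (H x)) *
    ((delta th (H x) - delta0 (H x)) * (F (H x) / kappa0 (H x) * gam th (H x)))).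
Proof. by apply: filterS stQ => th st; exact: (step_expansion eps0 st _ _ _ (step_sep stP)). Qed.

Let mgam : \forall th \near (0 : R)^', measurable_fun [set: S] (gam th).
Proof. by apply: filterS stQ => th st; exact: step_mgam st. Qed.

Let meta : \forall th \near (0 : R)^', measurable_fun [set: S] (eta th).
Proof. by apply: filterS stQ => th st; case: (step_AG st). Qed.

Let mdelta : \forall th \near (0 : R)^', measurable_fun [set: S] (delta th).
Proof. by apply: filterS stQ => th st; case: (step_delta st). Qed.

Let mF : measurable_fun [set: S] F := bF.1.

Let mk : measurable_fun [set: S] (fun h => F h / kappa0 h).
Proof. by apply: measurable_funM => //; case: bkV. Qed.

(** The second-order factor: delta_th - delta0 vanishes in norm, while gam is only known to be
    bounded in L2. *)
Lemma weakly_cvg_delta_gam : weakly_cvg P Q (fun th x =>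
  (delta th (H x) - delta0 (H x)) * (F (H x) / kappa0 (H x) * gam th (H x))) (fun=> 0).
Proof.
have [mkH [N kN]] := bkH.
have mM : \forall th \near (0 : R)^',
    measurable_fun [set: O] (fun x => delta th (H x) - delta0 (H x)) /\
    forall x, `|delta th (H x) - delta0 (H x)| <= M + M.
  near=> th.
  have st : step eps M (Q th) (G th) (rho th) (delta th) (kappa th) (eta th) (gam th) by near: th.
  split.
    apply: (measurable_comp_H mH (F := fun h => delta th h - delta0 h)).
    by apply: measurable_funB; [exact: (step_delta st).1|exact: (step_delta stP).1].
  move=> x; apply: (le_trans (ler_normB _ _)).
  by apply: lerD; [exact: (step_delta st).2|exact: (step_delta stP).2].
exact: (weakly_cvg_vanishing P (L2_bounded_alongM mkH kN gam_bounded_along) mM delta_cvg).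
Unshelve. all: by end_near. Qed.

Lemma measurable_delta_gam : \forall th \near (0 : R)^', measurable_fun [set: S]
  (fun h => (delta th h - delta0 h) * (F h / kappa0 h * gam th h)).
Proof.
near=> th; apply: measurable_funM; last by apply: measurable_funM => //; near: th.
by apply: measurable_funB; [near: th|case: bd0].
Unshelve. all: by end_near. Qed.

Let mFgam : \forall th \near (0 : R)^', measurable_fun [set: S] (fun h => F h * gam th h).
Proof. by apply: filterS mgam => th m; exact: measurable_funM. Qed.

Let mketa : \forall th \near (0 : R)^',
  measurable_fun [set: S] (fun h => F h / kappa0 h * eta th h).
Proof. by apply: filterS meta => th m; exact: measurable_funM. Qed.

(** Each of the three error terms has a factor centered under P, so L2 bounds on the remaining
    history functions suffice. The statement is thus available before weak convergence of gam, whose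
    proof rests on it. *)
Lemma reweighting_error_cvg0 :
  \int[Q th]_x (F (H x) * gam th (H x)) -
    \int[Q th]_x (F (H x) * (ipw rho0 kappa0 x * G th x)) @[th --> (0 : R)^'] --> (0 : R).
Proof.
have [mFH [N FN]] := bmfun_comp mH bF.
have [mkH [N' kN]] := bkH.
have [mZr [N1 ZrN]] := bZr; have [mres [N2 resN]] := bres.
have [be _ _] := weakly_cvg_eta; have [bdg _ _] := weakly_cvg_delta_gam.
have h1 := centered_cvg0 Qs mH mres resN (centered_residual eps0 stP) mFgam
  (L2_bounded_alongM mFH FN gam_bounded_along).
have h2 := centered_cvg0 Qs mH mZr ZrN (centered_Z stP) mketa
  (L2_bounded_alongM mkH kN be).
have h3 := centered_cvg0 Qs mH mZr ZrN (centered_Z stP) measurable_delta_gam bdg.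
suff : \int[Q th]_x (F (H x) * gam th (H x)) -
    \int[Q th]_x (F (H x) * (ipw rho0 kappa0 x * G th x)) @[th --> (0 : R)^'] -->
    (0 - 0 + 0 : R) by rewrite subrr addr0.
apply: cvg_trans (cvgD (cvgB h1 h2) h3); apply: near_eq_cvg.
by apply: filterS reweighting_error_terms => th ->.
Qed.

End weighted.

(** As for plain conditioning, u is split into u - v and v = E_P[u | H]. In the part with v, the
    weights of [Q th] are exchanged for those of P at a vanishing cost; v times a fixed bounded
    weight is then an admissible test multiplier for [G]. *)
Lemma weakly_cvg_gam : weakly_cvg P Q (fun th x => gam th (H x)) (fun x => gam0 (H x)).
Proof.
split; [exact: gam_bounded_along|exact: step_gam stP|] => u N mu uN.
have [x0 _] := probability_inhabited P.
have N0 : 0 <= N := le_trans (normr_ge0 _) (uN x0).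
have [v [[mv Lv uv] vN]] := bounded_cond_version mH N0 mu (aeW P uN).
have bv : bmfun v by split => //; exists N.
have mvH := measurable_comp_H mH mv; have vHN x : `|v (H x)| <= N := vN _.
pose b x := u x - v (H x).
have mb : measurable_fun [set: O] b by exact: measurable_funB.
have bN x : `|b x| <= N + N by apply: (le_trans (ler_normB _ _)); exact: lerD.
have cb : centered P H b.
  move=> F N' mF FN.
  have LF : L2 P (fun x => F (H x)).
    by apply: bmfun_L2; apply: bmfun_comp => //; split => //; exists N'.
  rewrite (@eq_ER _ _ _ _ _ (fun x => F (H x) * u x - F (H x) * v (H x))); last first.
    by move=> x; rewrite /b; ring.
  by rewrite ERB; [rewrite uv// subrr|apply: L2_mul => //; exact: L2_bounded uN
    |exact: L2_mul].
have mg : \forall th \near (0 : R)^', measurable_fun [set: S] (gam th).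
  by apply: filterS stQ => th st; exact: step_mgam st.
have h1 := centered_cvg0 Qs mH mb bN cb mg gam_bounded_along.
have h2 := reweighting_error_cvg0 bv.
have [mw [W wW]] := bmfun_ipw eps0 stP.
have [_ _ wcw] := weakly_cvgM mw wW wG.
have h3 := wcw _ N mvH vHN.
have eP : \int[P]_x (v (H x) * (ipw rho0 kappa0 x * G0 x)) = \int[P]_x (u x * gam0 (H x)).
  rewrite -(step_mean eps0 stP mv); last by apply: bmfun_L2; exact: bmfun_comp.
  rewrite (@eq_ER _ _ _ P _ (fun x => gam0 (H x) * v (H x))); last by move=> x; rewrite mulrC.
  rewrite (uv _ (step_mgam stP) (step_gam stP)).
  by apply: eq_ER => x; rewrite mulrC.
suff : \int[Q th]_x (u x * gam th (H x)) @[th --> (0 : R)^'] -->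
    0 + 0 + \int[P]_x (v (H x) * (ipw rho0 kappa0 x * G0 x)).
  by rewrite addr0 add0r eP.
apply: cvg_trans (cvgD (cvgD h1 h2) h3); apply: near_eq_cvg.
near=> th.
have st : step eps M (Q th) (G th) (rho th) (delta th) (kappa th) (eta th) (gam th) by near: th.
rewrite /= addrA addrNK.
have Lg := step_gam st.
rewrite -[LHS]/(\int[Q th]_x (b x * gam th (H x)) +
  \int[Q th]_x (v (H x) * gam th (H x))).
rewrite -ERD; [|exact: L2_L1 (L2_bM mb bN Lg)|exact: L2_L1 (L2_bM mvH vHN Lg)].
by apply: eq_ER => x; rewrite /b; ring.
Unshelve. all: by end_near. Qed.

(** [centered_quotient] applies to each of the three error terms. The history function of the third
    tends weakly to 0, so only the two terms of the influence function survive. *)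
Lemma reweighting_error_quotient (F : S -> R) : bmfun F ->
  (\int[Q th]_x (F (H x) * gam th (H x)) -
    \int[Q th]_x (F (H x) * (ipw rho0 kappa0 x * G th x))) / th @[th --> (0 : R)^'] -->
  \int[P]_x (s x * (F (H x) * (residual rho0 delta0 kappa0 x * gam0 (H x) -
    (Z x - rho0 (H x)) * eta0 (H x) / kappa0 (H x)))).
Proof.
move=> bF; have [mFH [N FN]] := bmfun_comp mH bF.
have bkH := bmfunM (bmfun_comp mH bF) (bmfun_comp mH bkV).
have [mkH [N' kN]] := bkH.
have [mZr [N1 ZrN]] := bZr; have [mres [N2 resN]] := bres.
have mFgam : \forall th \near (0 : R)^', measurable_fun [set: S] (fun h => F h * gam th h).
  by apply: filterS stQ => th st; apply: measurable_funM; [case: bF|exact: step_mgam st].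
have mketa : \forall th \near (0 : R)^',
    measurable_fun [set: S] (fun h => F h / kappa0 h * eta th h).
  apply: filterS stQ => th st; apply: measurable_funM; last by case: (step_AG st).
  by apply: measurable_funM; [case: bF|case: bkV].
have h1 := centered_quotient Qs mH mres resN (centered_residual eps0 stP) mFgam
  (weakly_cvgM mFH FN weakly_cvg_gam).
have h2 := centered_quotient Qs mH mZr ZrN (centered_Z stP) mketa
  (weakly_cvgM mkH kN weakly_cvg_eta).
have h3 := centered_quotient Qs mH mZr ZrN (centered_Z stP) (measurable_delta_gam bF) (weakly_cvg_delta_gam bF).
have Ls := score_L2 Qs.
have Lg0 := step_gam stP; have [_ Le0 _] := step_AG stP.
have i1 := L2_mul Ls (L2_bmM bres (L2_bmM (bmfun_comp mH bF) Lg0)).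
have i2 := L2_mul Ls (L2_bmM bZr (L2_bmM bkH Le0)).
have -> : \int[P]_x (s x * (F (H x) * (residual rho0 delta0 kappa0 x * gam0 (H x) -
    (Z x - rho0 (H x)) * eta0 (H x) / kappa0 (H x)))) =
  \int[P]_x (s x * (residual rho0 delta0 kappa0 x * (F (H x) * gam0 (H x)))) -
  \int[P]_x (s x * ((Z x - rho0 (H x)) * (F (H x) / kappa0 (H x) * eta0 (H x)))) +
  \int[P]_x (s x * ((Z x - rho0 (H x)) * 0)).
  rewrite (@eq_ER _ _ _ _ (fun x => s x * (_ * 0)) (fun=> 0)); last by move=> x; rewrite !mulr0.
  by rewrite ER_cst addr0 -ERB//; apply: eq_ER => x; ring.
apply: cvg_trans (cvgD (cvgB h1 h2) h3); apply: near_eq_cvg.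
by apply: filterS (reweighting_error_terms bF) => th ->; rewrite /= !mulrDl mulNr.
Qed.

End step_path.
End one_step.

(** * Observed data and histories *)

Section longitudinal_measurability.
Context {R : realType} {T : nat} {dL dA : 'I_T.+1 -> measure_display}.
Context {L : forall t, measurableType (dL t)} {A : forall t, measurableType (dA t)}.

Local Notation Obs := (@obs R T dL dA L A).
Local Notation Hist t := (@hist R T dL dA L A t).

Lemma measurable_coord (I : Type) (d : I -> measure_display)
    (X : forall i, measurableType (d i)) (i : I) :
  measurable_fun [set: prod_space X] (fun f : prod_space X => f i).
Proof.
move=> _ B mB; rewrite setTI; apply: sub_gen_smallest.
by exists i, B.
Qed.

Lemma measurable_obsZ (t : 'I_T.+1) : measurable_fun [set: Obs] (@obsZ R T dL dA L A t).
Proof.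
exact: (measurableT_comp (@measurable_coord _ _ (fun _ : 'I_T.+1 => R : measurableType _) t)
  (measurableT_comp measurable_fst (measurableT_comp measurable_fst measurable_fst))).
Qed.

Lemma measurable_obsA (t : 'I_T.+1) : measurable_fun [set: Obs] (@obsA R T dL dA L A t).
Proof.
exact: (measurableT_comp (@measurable_coord _ _ A t)
  (measurableT_comp measurable_snd (measurableT_comp measurable_fst measurable_fst))).
Qed.

Lemma measurable_obsL (t : 'I_T.+1) : measurable_fun [set: Obs] (@obsL R T dL dA L A t).
Proof.
exact: (measurableT_comp (@measurable_coord _ _ L t)
  (measurableT_comp measurable_snd measurable_fst)).
Qed.

Lemma measurable_obsY : measurable_fun [set: Obs] (@obsY R T dL dA L A).
Proof. exact: measurable_snd. Qed.

Lemma measurable_obsH (t : 'I_T.+1) : measurable_fun [set: Obs] (@obsH R T dL dA L A t).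
Proof.
apply: measurable_fun_pair; first apply: measurable_fun_pair.
- by apply: measurable_cylinders => s; exact: measurable_obsZ.
- by apply: measurable_cylinders => s; exact: measurable_obsA.
- by apply: measurable_cylinders => s; exact: measurable_obsL.
Qed.

(** Composition with it turns a function of the observation that depends only on the past of t into
    a function of the history; the coordinates absent from [h] are taken from an arbitrary [o0].
    Matching on [idP] supplies the proof that the index belongs to the subtype. *)
Definition fill (o0 : Obs) (t : 'I_T.+1) (h : Hist t) : Obs :=
  (fun s : 'I_T.+1 => if @idP (s < t)%N is ReflectT st then h.1.1 (exist _ s st) else obsZ s o0,
   fun s : 'I_T.+1 => if @idP (s < t)%N is ReflectT st then h.1.2 (exist _ s st) else obsA s o0,
   fun s : 'I_T.+1 => if @idP (s <= t)%N is ReflectT st then h.2 (exist _ s st) else obsL s o0,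
   obsY o0).

Lemma measurable_fill o0 t : measurable_fun [set: Hist t] (@fill o0 t).
Proof.
apply: measurable_fun_pair; last by [].
apply: measurable_fun_pair; first apply: measurable_fun_pair.
- apply: measurable_cylinders => s /=; case: {-}_ / idP => st //.
  exact: (measurableT_comp (@measurable_coord _ _
    (fun _ : before t => R : measurableType _) (exist _ s st))
    (measurableT_comp measurable_fst measurable_fst)).
- apply: measurable_cylinders => s /=; case: {-}_ / idP => st //.
  exact: (measurableT_comp (@measurable_coord _ _ (fun s : before t => A (val s)) (exist _ s st))
    (measurableT_comp measurable_snd measurable_fst)).
- apply: measurable_cylinders => s /=; case: {-}_ / idP => st //.
  exact: (measurableT_comp (@measurable_coord _ _ (fun s : upto t => L (val s)) (exist _ s st))
    measurable_snd).
Qed.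

Lemma fillZ o0 (t s : 'I_T.+1) o : (s < t)%N -> obsZ s (fill o0 (obsH t o)) = obsZ s o.
Proof. by move=> st; rewrite /obsZ/=; case: {-}_ / idP. Qed.

Lemma fillA o0 (t s : 'I_T.+1) o : (s < t)%N -> obsA s (fill o0 (obsH t o)) = obsA s o.
Proof. by move=> st; rewrite /obsA/=; case: {-}_ / idP. Qed.

Lemma fillL o0 (t s : 'I_T.+1) o : (s <= t)%N -> obsL s (fill o0 (obsH t o)) = obsL s o.
Proof. by move=> st; rewrite /obsL/=; case: {-}_ / idP. Qed.

Lemma fillH o0 (t s : 'I_T.+1) o : (s <= t)%N -> obsH s (fill o0 (obsH t o)) = obsH s o.
Proof.
move=> st; rewrite /obsH; congr (_, _, _).
- by apply/functional_extensionality_dep => -[r rs]; apply: fillZ; exact: leq_trans rs st.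
- by apply/functional_extensionality_dep => -[r rs]; apply: fillA; exact: leq_trans rs st.
- by apply/functional_extensionality_dep => -[r rs]; apply: fillL; exact: leq_trans rs st.
Qed.

Hypothesis A_finite : forall t, finite_set [set: A t].
Hypothesis A_discrete : forall t (B : set (A t)), measurable B.

Lemma measurable_eq_treatment {d} {X : measurableType d} t (f h : X -> A t) :
  measurable_fun [set: X] f -> measurable_fun [set: X] h ->
  measurable_fun [set: X] (fun x => (f x == h x)%:R : R).
Proof.
move=> mf mh.
have mE : measurable [set x | f x = h x].
  rewrite (_ : [set x | _] = \bigcup_(a in [set: A t]) (f @^-1` [set a] `&` h @^-1` [set a])).
    apply: fin_bigcup_measurable => // a _; apply: measurableI.
      by rewrite -[X in measurable X]setTI; exact: mf.
    by rewrite -[X in measurable X]setTI; exact: mh.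
  apply/seteqP; split => x /=; first by move=> e; exists (f x) => //=.
  by move=> [a _ [/= -> ->]].
rewrite (_ : (fun x => _) = \1_[set x | f x = h x]); first exact: measurable_indic.
apply/funext => x; rewrite indicE; congr (_%:R); congr nat_of_bool.
by apply/eqP/idP; rewrite inE.
Qed.

Lemma measurable_followed (g : forall t, Hist t -> A t) t :
  measurable_fun [set: Hist t] (g t) ->
  measurable_fun [set: Obs] (@followed R T dL dA L A g t).
Proof.
move=> mg; apply: measurable_eq_treatment; first exact: measurable_obsA.
exact: (measurableT_comp mg (@measurable_obsH t)).
Qed.

Lemma measurable_ind_eq t (a : A t) : measurable_fun [set: Obs] (@ind_eq R T dL dA L A t a).
Proof. by apply: measurable_eq_treatment; [exact: measurable_obsA|]. Qed.

End longitudinal_measurability.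

(** * Versions of the nuisances that are bounded everywhere *)

Section clipping.
Context {R : realType}.
Implicit Types (M eps x : R).

Definition clip M x : R := Num.max (- M) (Num.min M x).

Lemma clip_bounded M x : 0 <= M -> `|clip M x| <= M.
Proof.
move=> M0; rewrite /clip ler_norml le_max lexx/= ge_max ge_min lexx/= andbT.
by rewrite (le_trans _ M0)// oppr_le0.
Qed.

Lemma clip_id M x : `|x| <= M -> clip M x = x.
Proof.
by rewrite ler_norml /clip => /andP[h1 h2]; rewrite (min_idPr h2) (max_idPr h1).
Qed.

Lemma measurable_clip {d} {X : measurableType d} M (f : X -> R) :
  measurable_fun [set: X] f -> measurable_fun [set: X] (fun y => clip M (f y)).
Proof. by move=> mf; apply: measurable_maxr => //; exact: measurable_minr. Qed.

(** A value too close to 0 or too large is sent to [M], so that one replacement secures both bounds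
    whenever [eps <= M]. *)
Definition clip_away eps M x : R := if (eps <= `|x|) && (`|x| <= M) then x else M.

Lemma clip_away_bounded eps M x : 0 <= M -> `|clip_away eps M x| <= M.
Proof. by move=> M0; rewrite /clip_away; case: ifPn => [/andP[]//|_]; rewrite ger0_norm. Qed.

Lemma clip_away_ge eps M x : 0 <= M -> eps <= M -> eps <= `|clip_away eps M x|.
Proof. by move=> M0 eM; rewrite /clip_away; case: ifPn => [/andP[]//|_]; rewrite ger0_norm. Qed.

Lemma clip_away_id eps M x : eps <= `|x| -> `|x| <= M -> clip_away eps M x = x.
Proof. by rewrite /clip_away => -> ->. Qed.

Lemma measurable_clip_away {d} {X : measurableType d} eps M (f : X -> R) :
  measurable_fun [set: X] f -> measurable_fun [set: X] (fun y => clip_away eps M (f y)).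
Proof.
move=> mf; have mn : measurable_fun [set: X] (fun y => `|f y|) by exact: measurableT_comp.
apply: measurable_fun_ifT => //.
by apply: measurable_and; exact: measurable_fun_ler.
Qed.

End clipping.

Section clipped_versions.
Context {d dS : measure_display} {O : measurableType d} {S : measurableType dS}
  {R : realType}.
Variables (Q : probability O R) (H : O -> S).
Hypothesis mH : measurable_fun [set: O] H.
Variables (Z A G : O -> R) (M eps : R).
Hypothesis mZ : measurable_fun [set: O] Z.
Hypothesis ZM : {ae Q, forall x, `|Z x| <= M}.
Hypothesis mA : measurable_fun [set: O] A.
Hypothesis A1 : forall x, `|A x| <= 1.
Hypothesis LG : L2 Q G.
Hypothesis M0 : 0 <= M.
Hypothesis eps0 : 0 < eps.
Let rho := cond_mean Q H Z.
Let delta := cond_mean Q H A.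
Let kappa := cond_cov Q H A Z.
Let eta := cond_mean Q H (fun x => A x * G x).
Let gam h := cond_cov Q H (fun x => A x * G x) Z h / kappa h.
Hypothesis sep : {ae Q, forall x, eps <= `|kappa (H x)|}.
(** One constant for all nuisances: it exceeds the bound M + M of the covariance, the bound M of
    rho, the bound 1 of delta, and [eps] as [clip_away] demands. *)
Let B := M * 2 + eps + 1.

Let Zc x := clip M (Z x).

Let bA : bmfun A. Proof. by split => //; exists 1. Qed.

Let bZc : bmfun Zc.
Proof. by split; [exact: measurable_clip|exists M => x; exact: clip_bounded]. Qed.

Let ZcE : {ae Q, forall x, Zc x = Z x}.
Proof. by apply: filterS ZM => x; exact: clip_id. Qed.

Let ZE : {ae Q, forall x, Z x = Zc x}.
Proof. by apply: filterS ZcE => x ->. Qed.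

Let LZ : L2 Q Z. Proof. exact: L2_ae_eq ZcE (bmfun_L2 Q bZc). Qed.

Let rZ := cond_meanP mH (L2_L1 LZ).
Let rA := cond_meanP mH (L2_L1 (bmfun_L2 Q bA)).

Let LAZ : L2 Q (fun x => A x * Z x). Proof. exact: L2_bmM bA LZ. Qed.

Let rAZ := cond_meanP mH (L2_L1 LAZ).

Let LAG : L2 Q (fun x => A x * G x). Proof. exact: L2_bmM bA LG. Qed.

Let rAG := cond_meanP mH (L2_L1 LAG).

Let LAGZ : L2 Q (fun x => A x * G x * Z x).
Proof.
apply: (@L2_ae_eq _ _ _ _ (fun x => Zc x * (A x * G x))).
- by apply: measurable_funM => //; case: LAG.
- by apply: filterS ZcE => x ->; rewrite mulrC.
- exact: L2_bmM bZc LAG.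
Qed.

Let rAGZ := cond_meanP mH (L2_L1 LAGZ).

Let mrho : measurable_fun [set: S] rho. Proof. by case: rZ. Qed.
Let mdelta : measurable_fun [set: S] delta. Proof. by case: rA. Qed.
Let mkappa : measurable_fun [set: S] kappa.
Proof. by apply: measurable_funB; [case: rAZ|apply: measurable_funM; [case: rA|case: rZ]]. Qed.
Let meta : measurable_fun [set: S] eta. Proof. by case: rAG. Qed.
Let mgam : measurable_fun [set: S] gam.
Proof.
apply: measurable_funM; last exact: measurable_inv.
by apply: measurable_funB; [case: rAGZ|apply: measurable_funM; [case: rAG|case: rZ]].
Qed.

Let rhoE : {ae Q, forall x, rho (H x) = clip M (rho (H x))}.
Proof. by apply: filterS (cond_mean_bounded mH (L2_L1 LZ) rZ ZM) => x /clip_id ->. Qed.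

Let deltaE : {ae Q, forall x, delta (H x) = clip 1 (delta (H x))}.
Proof.
by apply: filterS (cond_mean_bounded mH (L2_L1 (bmfun_L2 Q bA)) rA (aeW Q A1)) => x /clip_id ->.
Qed.

Let AZM : {ae Q, forall x, `|A x * Z x| <= M}.
Proof. by apply: filterS ZM => x h; rewrite normrM -[leRHS]mul1r; exact: ler_pM. Qed.

Let kappaE : {ae Q, forall x, kappa (H x) = clip_away eps B (kappa (H x))}.
Proof.
have h1 := cond_mean_bounded mH (L2_L1 LAZ) rAZ AZM.
have h2 := cond_mean_bounded mH (L2_L1 LZ) rZ ZM.
have h3 := cond_mean_bounded mH (L2_L1 (bmfun_L2 Q bA)) rA (aeW Q A1).
apply: filterS2 (filterI h1 h2) (filterI h3 sep) => x [h1' h2'] [h3' h4'].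
apply/esym/clip_away_id => //; rewrite /kappa /cond_cov; apply: (le_trans (ler_normB _ _)).
rewrite normrM; apply: (@le_trans _ _ (M + 1 * M)).
  by apply: lerD => //; exact: ler_pM.
by rewrite /B; have := M0; have := eps0; lra.
Qed.

Lemma clipped_nuisances :
  {ae Q, forall x, [/\ Z x = clip M (Z x), rho (H x) = clip M (rho (H x)),
    delta (H x) = clip 1 (delta (H x)) & kappa (H x) = clip_away eps B (kappa (H x))]}.
Proof.
by apply: filterS2 (filterI ZE rhoE) (filterI deltaE kappaE) => x [? ?] [? ?].
Qed.

(** Clipping changes Z, rho, delta and kappa on null sets only, so the projection identities
    persist. The functions eta and gam stay as they are, since only their square-integrability is
    needed; for gam it comes from boundedness of rho and of 1/kappa. *)
Lemma clipped_step : step H (fun x => clip M (Z x)) A eps B Q G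
  (fun h => clip M (rho h)) (fun h => clip 1 (delta h))
  (fun h => clip_away eps B (kappa h)) eta gam.
Proof.
have B0 : 0 <= B by rewrite /B; have := M0; have := eps0; lra.
have eB : eps <= B by rewrite /B; have := M0; lra.
have mrc : measurable_fun [set: S] (fun h => clip M (rho h)) by exact: measurable_clip.
have mdc : measurable_fun [set: S] (fun h => clip 1 (delta h)) by exact: measurable_clip.
have mkc : measurable_fun [set: S] (fun h => clip_away eps B (kappa h)).
  exact: measurable_clip_away.
split => //.
- split => // h; apply: (le_trans (clip_bounded _ M0)).
  by rewrite /B; have := M0; have := eps0; lra.
- split => // h; apply: (le_trans (clip_bounded _ ler01)).
  by rewrite /B; have := M0; have := eps0; lra.
- by split => // h; exact: clip_away_bounded.
- by move=> h; exact: clip_away_ge.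
- have Leta := cond_mean_L2 mH LAG rAG; have Lxi := cond_mean_L2 mH LAGZ rAGZ.
  have brH : bmfun (fun x => clip M (rho (H x))).
    by split; [exact: (measurable_comp_H mH mrc)|exists M => x; exact: clip_bounded].
  have bkH : bmfun (fun x => (clip_away eps B (kappa (H x)))^-1).
    by apply: (bmfunV eps0) => [x|]; [exact: clip_away_ge|exact: (measurable_comp_H mH mkc)].
  apply: (L2_ae_eq _ _ (L2_bmM bkH (L2B Lxi (L2_bmM brH Leta)))).
    exact: (measurable_comp_H mH mgam).
  apply: filterS2 rhoE kappaE => x <- <-.
  by rewrite /gam /cond_cov mulrC (mulrC (rho _)).
- exact: (cond_version_ae_eq mH mrc LZ bZc.1 rhoE ZE (cond_mean_version mH LZ rZ)).
- have LA := bmfun_L2 Q bA.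
  exact: (cond_version_ae_eq mH mdc LA mA deltaE (aeW Q (fun x => erefl (A x)))
    (cond_mean_version mH LA rA)).
- apply: (cond_version_ae_eq mH _ LAZ _ _ _ (cond_mean_version mH LAZ rAZ)).
  + by apply: measurable_funD => //; exact: measurable_funM.
  + by apply: measurable_funM => //; case: bZc.
  + apply: filterS2 rhoE (filterI deltaE kappaE) => x <- [<- <-].
    by rewrite /kappa /cond_cov subrK.
  + by apply: filterS ZE => x e; congr (_ * _); exact: e.
- exact: (cond_mean_version mH LAG rAG).
- apply: (cond_version_ae_eq mH _ LAGZ _ _ _ (cond_mean_version mH LAGZ rAGZ)).
  + by apply: measurable_funD; exact: measurable_funM.
  + by apply: measurable_funM => //; [apply: measurable_funM => //; case: bZc|case: LG].
  + apply: filterS2 rhoE (filterI sep kappaE) => x <- [sx <-].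
    have k0 : kappa (H x) != 0 by rewrite -normr_gt0 (lt_le_trans eps0).
    by rewrite /gam /cond_cov mulrC divfK// (mulrC (rho _)) subrK.
  + by apply: filterS ZE => x e; rewrite mulrAC; congr (_ * _ * _); exact: e.
Qed.

End clipped_versions.

Lemma filter_forall_seq {X : Type} {F : set_system X} {FF : Filter F} (I : eqType)
    (s : seq I) (phi : I -> X -> Prop) :
  (forall i, F (phi i)) -> F (fun x => forall i, i \in s -> phi i x).
Proof.
move=> Fphi; elim: s => [|i s IH]; first exact: filterE.
apply: filterS2 (Fphi i) IH => x h1 h2 j; rewrite inE => /predU1P[->//|]; exact: h2.
Qed.

(** * Backward recursion under a single law *)

Section laws.
Context {R : realType} {T : nat} {dL dA : 'I_T.+1 -> measure_display}.
Context {L : forall t, measurableType (dL t)} {A : forall t, measurableType (dA t)}.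
Hypothesis A_finite : forall t, finite_set [set: A t].
Hypothesis A_discrete : forall t (B : set (A t)), measurable B.

Local Notation Obs := (@obs R T dL dA L A).
Local Notation Hist t := (@hist R T dL dA L A t).
Local Notation obsH := (@obsH R T dL dA L A).
Local Notation obsZ := (@obsZ R T dL dA L A).

Variable g : forall t, Hist t -> A t.
Arguments g : clear implicits.
Hypothesis g_measurable : forall t, measurable_fun [set: Hist t] (g t).

(** The constants are shared by all times and treatments, so that one clipping serves every law near
    the truth. *)
Definition admissible_law (M eps : R) (Q : probability Obs R) : Prop :=
  [/\ forall t, bounded_weight Q t M, forall t (a : A t), separated_weight Q a eps &
      L2 Q (@obsY R T dL dA L A)].

Definition clipped_weight (M eps : R) (Q : probability Obs R) (t : 'I_T.+1) : Obs -> R :=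
  ipw (obsH t) (fun o => clip M (obsZ t o)) (followed g t)
    (fun h => clip M (rho_o Q h))
    (fun h => clip_away eps (M * 2 + eps + 1) (kappa_o g Q h)).

Lemma followed_le1 t o : `|@followed R T dL dA L A g t o| <= 1.
Proof. by rewrite /followed; case: (_ == _); rewrite ?normr1// normr0. Qed.

Lemma bmfun_followed t : bmfun (@followed R T dL dA L A g t).
Proof.
by split; [exact: measurable_followed|exists 1 => o; exact: followed_le1].
Qed.

Lemma bmfun_ind_eq t (a : A t) : bmfun (@ind_eq R T dL dA L A t a).
Proof.
split; first exact: measurable_ind_eq.
by exists 1 => o; rewrite /ind_eq; case: (_ == _); rewrite ?normr1// normr0.
Qed.

Section one_law.
Variables (M eps : R).
Hypothesis M0 : 0 <= M.
Hypothesis eps0 : 0 < eps.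
Variable Q : probability Obs R.
Hypothesis admQ : admissible_law M eps Q.

Lemma L2_obsZ t : L2 Q (obsZ t).
Proof.
have [/(_ t) bM _ _] := admQ; split; first exact: measurable_obsZ.
apply: (@ae_L1_le _ _ _ _ _ (fun=> M ^+ 2)).
- by apply: measurable_funX; exact: measurable_obsZ.
- by apply: filterS bM => o h; rewrite normrX lerXn2r ?nnegrE.
- exact: L2_L1 (L2_cst Q _).
Qed.

(** Separation is assumed for a fixed treatment a, while kappa concerns the treatment prescribed by
    [g]. On histories with prescription a the two indicators coincide, hence so do the conditional
    covariances almost surely; finitely many a cover all histories. *)
Lemma separated_kappa t : {ae Q, forall o, eps <= `|kappa_o g Q (obsH t o)|}.
Proof.
have [_ sep _] := admQ.
have mH := @measurable_obsH R T dL dA L A t.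
have Lf := bmfun_L2 Q (bmfun_followed t).
have LfZ := L2_bmM (bmfun_followed t) (L2_obsZ t).
have key (a : A t) : {ae Q, forall o, g t (obsH t o) = a -> eps <= `|kappa_o g Q (obsH t o)|}.
  pose B0 : set (Hist t) := g t @^-1` [set a].
  have mB0 : measurable B0 by rewrite -[X in measurable X]setTI; exact: g_measurable.
  have Li := bmfun_L2 Q (bmfun_ind_eq a).
  have LiZ := L2_bmM (bmfun_ind_eq a) (L2_obsZ t).
  have E o : B0 (obsH t o) -> @ind_eq R T dL dA L A t a o = followed g t o.
    by rewrite /B0 /ind_eq /followed /= => ->.
  have h1 := cond_mean_eq_on mH mB0 (L2_L1 Li) (L2_L1 Lf)
    (cond_meanP mH (L2_L1 Li)) (cond_meanP mH (L2_L1 Lf)) (aeW Q E).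
  have EZ o : B0 (obsH t o) -> @ind_eq R T dL dA L A t a o * obsZ t o = followed g t o * obsZ t o.
    by move=> /E ->.
  have h2 := cond_mean_eq_on mH mB0 (L2_L1 LiZ) (L2_L1 LfZ)
    (cond_meanP mH (L2_L1 LiZ)) (cond_meanP mH (L2_L1 LfZ)) (aeW Q EZ).
  apply: filterS3 h1 h2 (sep t a) => o e1 e2 + ga.
  by rewrite /kappa_o /cond_cov e1// e2.
have [s sE] := (finite_seqP _).1 (A_finite t).
apply: filterS (filter_forall_seq s key) => o h; apply: (h (g t (obsH t o))) => //.
by have : [set: A t] (g t (obsH t o)) by []; rewrite sE.
Qed.

Lemma law_step t G : L2 Q G ->
  step (obsH t) (fun o => clip M (obsZ t o)) (followed g t) eps (M * 2 + eps + 1) Q G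
    (fun h => clip M (rho_o Q h)) (fun h => clip 1 (delta_o g Q h))
    (fun h => clip_away eps (M * 2 + eps + 1) (kappa_o g Q h))
    (cond_mean Q (obsH t) (fun o => followed g t o * G o)) (gamma_step g Q G).
Proof.
move=> LG; have [/(_ t) bM _ _] := admQ.
have [mf _] := bmfun_followed t.
exact: (clipped_step (@measurable_obsH R T dL dA L A t) (@measurable_obsZ R T dL dA L A t) bM mf
  (followed_le1 t) LG M0 eps0 (separated_kappa t)).
Qed.

Lemma law_nuisances t : {ae Q, forall o, [/\ obsZ t o = clip M (obsZ t o),
    rho_o Q (obsH t o) = clip M (rho_o Q (obsH t o)),
    delta_o g Q (obsH t o) = clip 1 (delta_o g Q (obsH t o)) &
    kappa_o g Q (obsH t o) =
      clip_away eps (M * 2 + eps + 1) (kappa_o g Q (obsH t o))]}.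
Proof.
have [/(_ t) bM _ _] := admQ; have [mf _] := bmfun_followed t.
exact: (clipped_nuisances (@measurable_obsH R T dL dA L A t) (@measurable_obsZ R T dL dA L A t) bM mf
  (followed_le1 t) M0 eps0 (separated_kappa t)).
Qed.

Lemma L2_gamma_after k : L2 Q (gamma_after g Q k).
Proof.
elim: k => [|k IH]; first by case: admQ.
exact: step_gam (law_step _ IH).
Qed.

Lemma bmfun_clippedZ t : bmfun (fun o => clip M (obsZ t o)).
Proof.
split; first by apply: measurable_clip; exact: measurable_obsZ.
by exists M => o; exact: clip_bounded.
Qed.

Lemma bmfun_clipped_weight t : bmfun (clipped_weight M eps Q t).
Proof.
exact: (bmfun_ipw (@measurable_obsH R T dL dA L A t) (bmfun_clippedZ t) (bmfun_followed t) eps0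
  (law_step t (L2_gamma_after 0))).
Qed.

Lemma bmfun_prod {d} {X : measurableType d} (I : Type) (s : seq I) (p : pred I)
    (f : I -> X -> R) : (forall i, bmfun (f i)) ->
  bmfun (fun x => \prod_(i <- s | p i) f i x).
Proof.
move=> bf; elim: s => [|i s IH].
  rewrite (_ : (fun x => _) = fun=> 1); first exact: bmfun_cst.
  by apply/funext => x; rewrite big_nil.
rewrite (_ : (fun x => _) = fun x => (if p i then f i x else 1) * \prod_(j <- s | p j) f j x).
  by apply: bmfunM => //; case: (p i); [exact: bf|exact: bmfun_cst].
by apply/funext => x; rewrite big_cons; case: (p i); rewrite ?mul1r.
Qed.

End one_law.

Lemma gamma_afterE Q (t : 'I_T.+1) : gamma_after g Q (T.+1 - t) = fun o => gamma_o g Q (obsH t o).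
Proof.
have tT : (t <= T)%N by rewrite -ltnS.
apply/funext => o; rewrite subSn//= /gamma_o /gamma_next.
have -> : inord (T - (T - t)) = t by apply: val_inj; rewrite /= inordK subKn.
by [].
Qed.

Lemma prod_ltS (t : 'I_T.+1) (f : 'I_T.+1 -> R) :
  \prod_(s < T.+1 | (s < t.+1)%N) f s = \prod_(s < T.+1 | (s < t)%N) f s * f t.
Proof.
rewrite (bigD1 t)//= mulrC; congr (_ * _); apply: eq_bigl => s.
by rewrite ltnS ltn_neqAle andbC; congr (_ && _); rewrite -val_eqE.
Qed.

Section history_products.
Variables (M eps : R).
Hypothesis M0 : 0 <= M.
Hypothesis eps0 : 0 < eps.
Variable P : probability Obs R.
Hypothesis admP : admissible_law M eps P.

Definition past_weight (t : nat) (o : Obs) : R :=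
  \prod_(s < T.+1 | (s < t)%N) clipped_weight M eps P s o.

(** Every factor with s < t involves Z_s, A_s and H_s only, all of which are recorded in H_t. *)
Lemma past_weight_hist (t : 'I_T.+1) : exists F : Hist t -> R,
  bmfun F /\ forall o, past_weight t o = F (obsH t o).
Proof.
have [x0 _] := probability_inhabited P.
exists (fun h => past_weight t (fill x0 h)); split.
  apply: (bmfun_comp (@measurable_fill R T dL dA L A x0 t)).
  by apply: bmfun_prod => s; exact: bmfun_clipped_weight.
move=> o; apply: eq_bigr => s st; rewrite /clipped_weight /ipw.
by rewrite fillZ// fillH ?(ltnW st)// /followed fillA// fillH// ltnW.
Qed.

Lemma bmfun_past_weight k : bmfun (past_weight k).
Proof. by apply: bmfun_prod => s; exact: bmfun_clipped_weight. Qed.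

Lemma past_weight_max o : past_weight T.+1 o = \prod_(s < T.+1) clipped_weight M eps P s o.
Proof. by apply: eq_bigl => s; rewrite ltn_ord. Qed.

Lemma past_weight0 o : past_weight 0 o = 1.
Proof. by rewrite /past_weight big_pred0. Qed.

Lemma past_weightS (t : 'I_T.+1) o :
  past_weight t.+1 o = past_weight t o * clipped_weight M eps P t o.
Proof. exact: prod_ltS. Qed.

(* It interpolates between psi_functional at Q (k = 0) and a linear functional of Q
   (k = T + 1). *)
Definition mixed_functional (Q : probability Obs R) (k : nat) : R :=
  \int[Q]_o (past_weight k o * gamma_after g Q (T.+1 - k) o).

Lemma mixed_functional_telescope Q :
  mixed_functional Q 0 = \sum_(t < T.+1) (mixed_functional Q t - mixed_functional Q t.+1) +
    mixed_functional Q T.+1.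
Proof.
rewrite -(big_mkord xpredT (fun t => mixed_functional Q t - mixed_functional Q t.+1)).
rewrite (eq_bigr (fun t => - (mixed_functional Q t.+1 - mixed_functional Q t))); last first.
  by move=> t _; rewrite opprB.
by rewrite sumrN telescope_sumr// opprB subrK.
Qed.

Lemma mixed_functional_step Q (t : 'I_T.+1) (F : Hist t -> R) :
  (forall o, past_weight t o = F (obsH t o)) ->
  mixed_functional Q t - mixed_functional Q t.+1 =
  \int[Q]_o (F (obsH t o) * gamma_o g Q (obsH t o)) -
  \int[Q]_o (F (obsH t o) * (clipped_weight M eps P t o * gamma_next g Q t o)).
Proof.
move=> FE; rewrite /mixed_functional gamma_afterE subSS; congr (_ - _).
  by apply: eq_ER => o; rewrite FE.
by apply: eq_ER => o; rewrite past_weightS FE mulrA.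
Qed.

End history_products.

Section psi_as_mixed.
Variables (M eps : R).
Hypothesis M0 : 0 <= M.
Hypothesis eps0 : 0 < eps.
Variable Q : probability Obs R.
Hypothesis admQ : admissible_law M eps Q.

(** When the weights come from Q itself, [step_mean] says that trading gamma_t for w_t gamma_(t+1)
    preserves the mean, whatever bounded function of H_t multiplies it. Hence the weighted mean of
    [Y] equals the mean of gamma_0. *)
Lemma mixed_functional_own k : (k <= T.+1)%N ->
  mixed_functional M eps Q Q k = mixed_functional M eps Q Q 0.
Proof.
elim: k => // k IH kT; rewrite -IH; last exact: ltnW.
pose t : 'I_T.+1 := Ordinal kT.
have [F [bF FE]] := past_weight_hist M0 eps0 admQ t.
apply/esym/eqP; rewrite -subr_eq0; apply/eqP.
rewrite (mixed_functional_step _ FE); apply/eqP; rewrite subr_eq0; apply/eqP.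
have mH := @measurable_obsH R T dL dA L A t.
exact: (step_mean mH (bmfun_clippedZ M0 t) (bmfun_followed t) eps0
  (law_step M0 eps0 admQ t (L2_gamma_after M0 eps0 admQ (T - t))) bF.1
  (bmfun_L2 Q (bmfun_comp mH bF))).
Qed.

Lemma weight_ae : {ae Q, forall o, forall t,
  weight g (alpha_o g Q) t o = clipped_weight M eps Q t o}.
Proof.
apply: filterS (filter_forall_seq (enum 'I_T.+1) (law_nuisances M0 eps0 admQ)) => o h t.
have [zE rE dE kE] := h t (mem_enum _ _).
by rewrite /weight /clipped_weight /ipw /= -zE -rE -kE.
Qed.

Lemma measurable_nuisances t : [/\ measurable_fun [set: Hist t] (@rho_o R T dL dA L A Q t),
  measurable_fun [set: Hist t] (delta_o g Q (t := t)),
  measurable_fun [set: Hist t] (kappa_o g Q (t := t)),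
  measurable_fun [set: Hist t] (eta_o g Q (t := t)) &
  measurable_fun [set: Hist t] (gamma_o g Q (t := t))].
Proof.
have mH := @measurable_obsH R T dL dA L A t.
have LZ := L2_obsZ M0 admQ t; have Lf := bmfun_L2 Q (bmfun_followed t).
have LG := L2_gamma_after M0 eps0 admQ (T - t).
have LfG := L2_bmM (bmfun_followed t) LG; have LfZ := L2_bmM (bmfun_followed t) LZ.
have [m1 _ _] := cond_meanP mH (L2_L1 LZ); have [m2 _ _] := cond_meanP mH (L2_L1 Lf).
have [m3 _ _] := cond_meanP mH (L2_L1 LfG); have [m4 _ _] := cond_meanP mH (L2_L1 LfZ).
split; [exact: m1|exact: m2| |exact: m3|exact: step_mgam (law_step M0 eps0 admQ t LG)].
by apply: measurable_funB; [exact: m4|exact: measurable_funM m2 m1].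
Qed.

Lemma measurable_weight t : measurable_fun [set: Obs] (weight g (alpha_o g Q) t).
Proof.
have mH := @measurable_obsH R T dL dA L A t; have [m1 _ m3 _ _] := measurable_nuisances t.
rewrite /weight /=; apply: measurable_funM; last by apply: measurable_inv; exact: (measurable_comp_H mH m3).
apply: measurable_funM; last by case: (bmfun_followed t).
by apply: measurable_funB; [exact: measurable_obsZ|exact: (measurable_comp_H mH m1)].
Qed.

Lemma psi_functionalE : psi_functional g Q = mixed_functional M eps Q Q 0.
Proof.
rewrite -(mixed_functional_own (leqnn _)) /mixed_functional subnn /psi_functional.
apply: ae_eq_ER.
- apply: measurable_funM; last exact: measurable_obsY.
  by apply: measurable_prod => t _; exact: measurable_weight.
- apply: measurable_funM; last exact: measurable_obsY.
  by case: (bmfun_past_weight M0 eps0 admQ T.+1).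
- apply: filterS weight_ae => o h; rewrite past_weight_max /=; congr (_ * _).
  by apply: eq_bigr => t _.
Qed.

End psi_as_mixed.

End laws.

(** * Derivative along regular paths *)

Section paths.
Context {R : realType} {T : nat} {dL dA : 'I_T.+1 -> measure_display}.
Context {L : forall t, measurableType (dL t)} {A : forall t, measurableType (dA t)}.
Hypothesis A_finite : forall t, finite_set [set: A t].
Hypothesis A_discrete : forall t (B : set (A t)), measurable B.

Local Notation Obs := (@obs R T dL dA L A).
Local Notation Hist t := (@hist R T dL dA L A t).
Local Notation obsH := (@obsH R T dL dA L A).
Local Notation obsZ := (@obsZ R T dL dA L A).
Local Notation obsY := (@obsY R T dL dA L A).

Variable g : forall t, Hist t -> A t.
Arguments g : clear implicits.
Hypothesis g_measurable : forall t, measurable_fun [set: Hist t] (g t).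

Variables (M eps : R).
Hypothesis M0 : 0 <= M.
Hypothesis eps0 : 0 < eps.
Variable P : probability Obs R.
Hypothesis admP : admissible_law M eps P.

(** The t-th bracket of the influence function, written with clipped versions so that the results
    for one time point apply literally; under P it agrees almost surely with the unclipped
    bracket. *)
Definition augmentation (t : 'I_T.+1) (o : Obs) : R :=
  residual (obsH t) (fun o => clip M (obsZ t o)) (followed g t)
    (fun h => clip M (rho_o P h)) (fun h => clip 1 (delta_o g P h))
    (fun h => clip_away eps (M * 2 + eps + 1) (kappa_o g P h)) o *
    gamma_o g P (obsH t o) -
  (clip M (obsZ t o) - clip M (rho_o P (obsH t o))) * eta_o g P (obsH t o) /
    clip_away eps (M * 2 + eps + 1) (kappa_o g P (obsH t o)).

Definition clipped_eif (o : Obs) : R :=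
  past_weight g M eps P T.+1 o * obsY o - psi_functional g P +
  \sum_(t < T.+1) past_weight g M eps P t o * augmentation t o.

Let mH t := @measurable_obsH R T dL dA L A t.
Let bZ t : bmfun (fun o => clip M (obsZ t o)).
Proof. exact: (bmfun_clippedZ M0). Qed.
Let bA t : bmfun (@followed R T dL dA L A g t).
Proof. exact: (bmfun_followed A_finite A_discrete g_measurable). Qed.
Let stP (t : 'I_T.+1) := law_step A_finite A_discrete g_measurable M0 eps0 admP t
  (L2_gamma_after A_finite A_discrete g_measurable M0 eps0 admP (T - t)).

Lemma eif_ae : {ae P, forall o, eif g (psi_functional g P) (alpha_o g P) o = clipped_eif o}.
Proof.
apply: filterS2 (weight_ae A_finite A_discrete g_measurable M0 eps0 admP)
  (filter_forall_seq (enum 'I_T.+1)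
    (law_nuisances A_finite A_discrete g_measurable M0 eps0 admP)) => o hw hn.
rewrite /eif /clipped_eif past_weight_max; congr (_ * _ - _ + _).
  by apply: eq_bigr => t _; exact: hw.
apply: eq_bigr => t _; congr (_ * _).
  by apply: eq_bigr => s _; exact: hw.
have [zE rE dE kE] := hn t (mem_enum _ _).
by rewrite /augmentation /residual /= -zE -rE -dE -kE.
Qed.

Lemma measurable_eif :
  measurable_fun [set: Obs] (eif g (psi_functional g P) (alpha_o g P)).
Proof.
have mw := measurable_weight A_finite A_discrete g_measurable M0 eps0 admP.
apply: measurable_funD.
  apply: measurable_funB => //; apply: measurable_funM; last exact: measurable_obsY.
  by apply: measurable_prod => t _; exact: mw.
apply: measurable_sum => t; apply: measurable_funM.
  rewrite (_ : (fun o => _) = fun o => \prod_(s < T.+1)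
    if (s < t)%N then weight g (alpha_o g P) s o else 1).
    by apply: measurable_prod => s _; case: (_ < _)%N => //; exact: mw.
  by apply/funext => o; rewrite big_mkcond.
have [m1 m2 m3 m4 m5] := measurable_nuisances A_finite A_discrete g_measurable M0 eps0 admP t.
have mZ : measurable_fun [set: Obs] (obsZ t) := @measurable_obsZ R T dL dA L A t.
have [mf _] := bA t.
have n1 := measurable_comp_H (@mH t) m1; have n2 := measurable_comp_H (@mH t) m2.
have n3 := measurable_inv (measurable_comp_H (@mH t) m3).
have n4 := measurable_comp_H (@mH t) m4; have n5 := measurable_comp_H (@mH t) m5.
have nZ := measurable_funB mZ n1; have nf := measurable_funB mf n2.
apply: measurable_funB; last exact: measurable_funM (measurable_funM nZ n4) n3.
apply: measurable_funM => //; apply: measurable_funB => //.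
exact: measurable_funM (measurable_funM nZ nf) n3.
Qed.

Let L2_pwY : L2 P (fun o => past_weight g M eps P T.+1 o * obsY o).
Proof.
apply: L2_bmM; last by case: admP.
exact: (bmfun_past_weight A_finite A_discrete g_measurable M0 eps0 admP).
Qed.

Let L2_aug t : L2 P (fun o => past_weight g M eps P (nat_of_ord t) o * augmentation t o).
Proof.
have [F [bF FE]] := past_weight_hist A_finite A_discrete g_measurable M0 eps0 admP t.
have := L2_augmentation (@mH t) (bZ t) (bA t) eps0 (stP t) bF.
by apply: eq_L2 => o; rewrite FE.
Qed.

Let L2_sum_aug : L2 P (fun o => \sum_(t < T.+1) past_weight g M eps P t o * augmentation t o).
Proof.
elim: (index_enum _) => [|t r IH].
  by apply: eq_L2 (L2_cst P 0) => o; rewrite big_nil.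
by apply: eq_L2 (L2D (L2_aug t) IH) => o; rewrite big_cons.
Qed.

Lemma L2_clipped_eif : L2 P clipped_eif.
Proof. by apply: L2D => //; apply: L2B => //; exact: L2_cst. Qed.

Lemma psi_functional_max : psi_functional g P =
  \int[P]_o (past_weight g M eps P T.+1 o * obsY o).
Proof.
rewrite (psi_functionalE A_finite A_discrete g_measurable M0 eps0 admP).
rewrite -(mixed_functional_own A_finite A_discrete g_measurable M0 eps0 admP (leqnn T.+1)).
by rewrite /mixed_functional subnn.
Qed.

Lemma clipped_eif_mean0 : \int[P]_o clipped_eif o = 0.
Proof.
have Lc := L2_cst P (psi_functional g P).
rewrite ERD; [|exact: L2_L1 (L2B L2_pwY Lc)|exact: L2_L1].
rewrite ERB; [|exact: L2_L1|exact: L2_L1].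
rewrite ER_cst -psi_functional_max subrr add0r.
rewrite (ER_sum _ (fun t => L2_L1 (L2_aug t))).2 big1// => t _.
have [F [bF FE]] := past_weight_hist A_finite A_discrete g_measurable M0 eps0 admP t.
have <- := augmentation_mean0 (@mH t) (bZ t) (bA t) eps0 (stP t) bF.
by apply: eq_ER => o; rewrite FE.
Qed.

Section derivative.
Variables (Q : R -> probability Obs R) (s : Obs -> R).
Hypothesis Qs : qmd_submodel P Q s.
Hypothesis admQ : \forall th \near (0 : R)^', admissible_law M eps (Q th).
Hypothesis Yb : L2_bounded_along Q (fun=> obsY).

(** The difference quotient of the constant 1 is identically 0, and its limit is E[s]. *)
Lemma score_mean0 : \int[P]_o s o = 0.
Proof.
have b1 : L2_bounded_along Q (fun _ _ => 1).
  exists 1; split => //; apply: nearW => th; split; first exact: L2_cst.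
  by rewrite nrm_cst normr1.
have w1 := weakly_cvg_cst Qs (L2_cst P 1) b1.
have nP : exists C : R, \forall th \near (0 : R)^',
    L2 P (fun _ : Obs => 1 : R) /\ nrm P (fun _ : Obs => 1 : R) <= C.
  by exists 1; apply: nearW => _; split; [exact: L2_cst|rewrite nrm_cst normr1].
have := weakly_cvg_difference_quotient Qs w1 nP.
rewrite (@eq_ER _ _ _ P (fun o => s o * 1) s); last by move=> o; rewrite mulr1.
under eq_fun do rewrite !ER_cst subrr mul0r.
by move=> h; apply/esym; apply: (cvg_unique _ (cvg_cst 0) h).
Qed.

Let stQ t k : \forall th \near (0 : R)^',
  step (obsH t) (fun o => clip M (obsZ t o)) (followed g t) eps (M * 2 + eps + 1) (Q th)
    (gamma_after g (Q th) k) (fun h => clip M (rho_o (Q th) h))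
    (fun h => clip 1 (delta_o g (Q th) h))
    (fun h => clip_away eps (M * 2 + eps + 1) (kappa_o g (Q th) h))
    (cond_mean (Q th) (obsH t) (fun o => followed g t o * gamma_after g (Q th) k o))
    (gamma_step g (Q th) (gamma_after g (Q th) k)).
Proof.
apply: filterS admQ => th ath.
exact: (law_step A_finite A_discrete g_measurable M0 eps0 ath t
  (L2_gamma_after A_finite A_discrete g_measurable M0 eps0 ath k)).
Qed.

Lemma weakly_cvg_gamma_after k :
  weakly_cvg P Q (fun th => gamma_after g (Q th) k) (gamma_after g P k).
Proof.
elim: k => [|k IH]; first by apply: (weakly_cvg_cst Qs) => //; case: admP.
pose t : 'I_T.+1 := inord (T - k).
have LP := L2_gamma_after A_finite A_discrete g_measurable M0 eps0 admP k.
exact: (weakly_cvg_gam (@mH t) (bZ t) (bA t) Qs eps0 (stQ t k)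
  (law_step A_finite A_discrete g_measurable M0 eps0 admP t LP) IH).
Qed.

Lemma mixed_functional_quotient (t : 'I_T.+1) :
  (mixed_functional g M eps P (Q th) t - mixed_functional g M eps P (Q th) t.+1) / th
    @[th --> (0 : R)^'] -->
  \int[P]_o (s o * (past_weight g M eps P t o * augmentation t o)).
Proof.
have [F [bF FE]] := past_weight_hist A_finite A_discrete g_measurable M0 eps0 admP t.
under eq_fun do rewrite (mixed_functional_step _ FE).
rewrite (@eq_ER _ _ _ P _ (fun o => s o * (F (obsH t o) * augmentation t o))); last first.
  by move=> o; rewrite FE.
exact: (reweighting_error_quotient (@mH t) (bZ t) (bA t) Qs eps0 (stQ t (T - t)) (stP t)
  (weakly_cvg_gamma_after (T - t)) bF).
Qed.

Lemma psi_functional_quotient :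
  (psi_functional g (Q th) - psi_functional g P) / th @[th --> (0 : R)^'] -->
  \int[P]_o (clipped_eif o * s o).
Proof.
have Ls := score_L2 Qs; have Lc := L2_cst P (psi_functional g P).
have bpw := bmfun_past_weight A_finite A_discrete g_measurable M0 eps0 admP T.+1.
have [mpw [W pwW]] := bpw; have [_ _ LY] := admP.
have cvmax : (\int[Q th]_o (past_weight g M eps P T.+1 o * obsY o) -
    \int[P]_o (past_weight g M eps P T.+1 o * obsY o)) / th @[th --> (0 : R)^'] -->
    \int[P]_o (s o * (past_weight g M eps P T.+1 o * obsY o)).
  apply: (weakly_cvg_difference_quotient Qs
    (weakly_cvgM mpw pwW (weakly_cvg_cst Qs LY Yb))).
  exists (nrm P (fun o => past_weight g M eps P T.+1 o * obsY o)).
  by apply: nearW => th; split => //; exact: L2_pwY.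
have -> : \int[P]_o (clipped_eif o * s o) =
    \sum_(t < T.+1) \int[P]_o (s o * (past_weight g M eps P t o * augmentation t o)) +
    \int[P]_o (s o * (past_weight g M eps P T.+1 o * obsY o)).
  have Lsa t := L2_mul Ls (L2_aug t).
  rewrite -(ER_sum _ Lsa).2.
  have i1 := L2_mul Ls L2_pwY; have i2 := L2_mul Ls Lc; have i3 := (ER_sum (index_enum _) Lsa).1.
  (* The centering constant in the influence function does not affect the pairing, the score having
     mean 0. *)
  have e2 : \int[P]_o (s o * psi_functional g P) = 0.
    rewrite (@eq_ER _ _ _ _ _ (fun o => psi_functional g P * s o)); last by move=> o; rewrite mulrC.
    by rewrite ERZ ?score_mean0 ?mulr0//; exact: L2_L1.
  have E := ERD (L1B i1 i2) i3; have E' := ERB i1 i2.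
  rewrite E' e2 subr0 in E; rewrite addrC; apply: etrans E.
  by apply: eq_ER => o; rewrite /clipped_eif -mulr_sumr; ring.
have cvsum (r : seq 'I_T.+1) :
  \sum_(t <- r) ((mixed_functional g M eps P (Q th) t -
     mixed_functional g M eps P (Q th) t.+1) / th) @[th --> (0 : R)^'] -->
  \sum_(t <- r) \int[P]_o (s o * (past_weight g M eps P t o * augmentation t o)).
  elim: r => [|t r IH]; first by under eq_fun do rewrite big_nil; rewrite big_nil; exact: cvg_cst.
  by under eq_fun do rewrite big_cons; rewrite big_cons; apply: cvgD IH; exact: mixed_functional_quotient.
apply: cvg_trans (cvgD (cvsum _) cvmax); apply: near_eq_cvg.
apply: filterS admQ => th ath; rewrite -[LHS]/(
  \sum_(t < T.+1) ((mixed_functional g M eps P (Q th) t -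
    mixed_functional g M eps P (Q th) t.+1) / th) +
  (\int[Q th]_o (past_weight g M eps P T.+1 o * obsY o) -
    \int[P]_o (past_weight g M eps P T.+1 o * obsY o)) / th).
rewrite -mulr_suml -mulrDl psi_functional_max addrA; congr ((_ - _) / _).
rewrite (psi_functionalE A_finite A_discrete g_measurable M0 eps0 ath).
(* At k = 0 the product of weights is empty, so the law that supplies the weights may be switched
   from [Q th] to P; this connects psi at [Q th] to the telescoping sum. *)
have -> : mixed_functional g M eps (Q th) (Q th) 0 = mixed_functional g M eps P (Q th) 0.
  by apply: eq_ER => o; rewrite !past_weight0.
by rewrite mixed_functional_telescope; congr (_ + _); rewrite /mixed_functional subnn.
Qed.

End derivative.
End paths.

(** * Uniform constants along regular paths *)

Lemma common_positive_bound {R : realType} (I : eqType) (r : seq I) (phi : I -> R -> Prop) :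
  (forall i e e', 0 < e' -> e' <= e -> phi i e -> phi i e') ->
  (forall i, exists2 e, 0 < e & phi i e) ->
  exists2 e, 0 < e & forall i, i \in r -> phi i e.
Proof.
move=> mono ephi; elim: r => [|i r [e e0 IH]]; first by exists 1.
have [e' e'0 h] := ephi i.
have m0 : 0 < Num.min e e' by rewrite lt_min e0.
exists (Num.min e e') => // j; rewrite inE => /predU1P[->|jr].
  by apply: mono h => //; rewrite ge_min lexx orbT.
by apply: mono (IH j jr) => //; rewrite ge_min lexx.
Qed.

Lemma ER_eq_law {d} {X : measurableType d} {R : realType} (P Q : probability X R)
    (f : X -> R) :
  (forall B, measurable B -> Q B = P B) -> \int[Q]_x f x = \int[P]_x f x.
Proof. by move=> PQ; congr fine; apply: eq_measure_integral => B mB _; exact: PQ. Qed.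

Section equal_laws.
Context {R : realType} {T : nat} {dL dA : 'I_T.+1 -> measure_display}.
Context {L : forall t, measurableType (dL t)} {A : forall t, measurableType (dA t)}.
Variable g : forall t, @hist R T dL dA L A t -> A t.
Variables P Q : probability (@obs R T dL dA L A) R.
Hypothesis PQ : forall B, measurable B -> Q B = P B.

(** [Q 0] agrees with P on measurable sets but is another term. Equal laws give the same predicate
    [is_cond_mean], so [get] selects the very same version, and psi takes the same value at both. *)
Lemma cond_mean_eq_law {dS} {S : measurableType dS} (H : @obs R T dL dA L A -> S) X :
  measurable_fun [set: @obs R T dL dA L A] H -> cond_mean Q H X = cond_mean P H X.
Proof.
move=> mH; congr get; apply/funext => r; apply/propext.
have iE D f : measurable D -> (\int[Q]_(x in D) f x = \int[P]_(x in D) f x)%E.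
  by move=> mD; apply: eq_measure_integral => B mB _; exact: PQ.
have mB B : measurable B -> measurable (H @^-1` B).
  by move=> mB; rewrite -[X in measurable X]setTI; exact: mH.
split=> -[mr /integrableP[h1 h2] rX]; split => //.
- by apply/integrableP; split => //; rewrite -iE.
- by move=> B Bm; have := rX B Bm; rewrite !iE//; exact: mB.
- by apply/integrableP; split => //; rewrite iE.
- by move=> B Bm; have := rX B Bm; rewrite !iE//; exact: mB.
Qed.

Lemma psi_functional_eq_law : psi_functional g Q = psi_functional g P.
Proof.
have cmE t X : cond_mean Q (@obsH R T dL dA L A t) X = cond_mean P (@obsH R T dL dA L A t) X.
  by apply: cond_mean_eq_law; exact: measurable_obsH.
have wE t o : weight g (alpha_o g Q) t o = weight g (alpha_o g P) t o.
  by rewrite /weight /= /rho_o /kappa_o /cond_cov !cmE.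
apply: etrans (ER_eq_law _ PQ); apply: eq_ER => o.
by rewrite (eq_bigr _ (fun t _ => wE t o)).
Qed.

End equal_laws.

Section regular_paths.
Context {R : realType} {T : nat} {dL dA : 'I_T.+1 -> measure_display}.
Context {L : forall t, measurableType (dL t)} {A : forall t, measurableType (dA t)}.
Hypothesis A_finite : forall t, finite_set [set: A t].
Hypothesis A_discrete : forall t (B : set (A t)), measurable B.

Local Notation Obs := (@obs R T dL dA L A).
Local Notation obsY := (@obsY R T dL dA L A).

Variable g : forall t, @hist R T dL dA L A t -> A t.
Arguments g : clear implicits.
Hypothesis g_measurable : forall t, measurable_fun [set: @hist R T dL dA L A t] (g t).

Variable P : probability Obs R.
Hypothesis Z_regular : forall t, regular_weight P t.
Hypothesis LY : L2 P obsY.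

Lemma bounded_weight_le (Q : probability Obs R) (t : 'I_T.+1) (M M' : R) : M <= M' ->
  bounded_weight Q t M -> bounded_weight Q t M'.
Proof. by move=> MM'; apply: filterS => o /le_trans; apply. Qed.

Lemma separated_weight_le (Q : probability Obs R) (t : 'I_T.+1) (a : A t) (e e' : R) :
  e' <= e -> separated_weight Q a e -> separated_weight Q a e'.
Proof. by move=> ee'; apply: filterS => o; exact: le_trans. Qed.

Lemma L2_second_moment (Q : probability Obs R) (X : Obs -> R) (K : R) :
  measurable_fun [set: Obs] X -> ('E_Q[fun o => (X o ^+ 2)%R] <= K%:E)%E ->
  L2 Q X /\ nrm Q X <= Num.sqrt K.
Proof.
move=> mX; rewrite unlock => h.
have LX : L2 Q X.
  split => //; apply/integrableP; split; first exact/measurable_EFinP/measurable_funX.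
  apply: le_lt_trans (ltry K); apply: le_trans h.
  by rewrite le_eqVlt; apply/orP; left; apply/eqP; apply: eq_integral => o _ /=;
    rewrite ger0_norm ?sqr_ge0.
split => //; apply: ler_wsqrtr; rewrite -lee_fin ER_EFin//.
by case: LX.
Qed.

Lemma admissible_law_le (Q : probability Obs R) (M M' e e' : R) : M <= M' -> e' <= e ->
  admissible_law M e Q -> admissible_law M' e' Q.
Proof.
move=> MM' ee' [h1 h2 h3]; split => // [t|t a].
  exact: bounded_weight_le (h1 t).
exact: separated_weight_le (h2 t a).
Qed.

Lemma uniform_constants (Q : R -> probability Obs R) :
  (forall t, exists M : R, \forall th \near (0 : R), bounded_weight (Q th) t M) ->
  (forall t (a : A t), exists2 eps : R, 0 < eps &
    \forall th \near (0 : R), separated_weight (Q th) a eps) ->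
  (\forall th \near (0 : R), L2 (Q th) obsY) ->
  exists M eps : R, [/\ 0 <= M, 0 < eps &
    \forall th \near (0 : R), admissible_law M eps (Q th)].
Proof.
move=> Qb Qsep LYQ.
(* An upper bound M is encoded as a positive lower bound on its inverse, so that the minimum over a
   finite list handles both kinds of constants. *)
have [e e0 he] : exists2 e, 0 < e & forall t, t \in enum 'I_T.+1 ->
    \forall th \near (0 : R), bounded_weight (Q th) t e^-1.
  apply: common_positive_bound.
    move=> t e e' e'0 ee'; apply: filterS => th; apply: bounded_weight_le.
    by rewrite lef_pV2// posrE// (lt_le_trans e'0).
  move=> t; have [M h] := Qb t.
  exists (Num.max 1 M)^-1; first by rewrite invr_gt0 lt_max ltr01.
  rewrite invrK; apply: filterS h => th; apply: bounded_weight_le.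
  by rewrite le_max lexx orbT.
have hsep t : exists2 eps : R, 0 < eps &
    \forall th \near (0 : R), forall a : A t, separated_weight (Q th) a eps.
  have [r rE] := (finite_seqP _).1 (A_finite t).
  have ar a : a \in r by have : [set: A t] a by []; rewrite rE.
  have [eps eps0 h] : exists2 eps, 0 < eps & forall a, a \in r ->
      \forall th \near (0 : R), separated_weight (Q th) a eps.
    apply: common_positive_bound; last exact: Qsep.
    by move=> a e1 e2 _ e21; apply: filterS => th; exact: separated_weight_le.
  exists eps => //.
  have {}h a : \forall th \near (0 : R), separated_weight (Q th) a eps := h a (ar a).
  have h' : \forall th \near (0 : R), forall a, a \in r -> separated_weight (Q th) a eps.
    exact: filter_forall_seq.
  by apply: filterS h' => th h' a; exact: h'.
have [eps eps0 heps] : exists2 eps, 0 < eps & forall t, t \in enum 'I_T.+1 ->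
    \forall th \near (0 : R), forall a : A t, separated_weight (Q th) a eps.
  apply: common_positive_bound; last exact: hsep.
  move=> t e1 e2 _ e21; apply: filterS => th h a; exact: separated_weight_le (h a).
exists e^-1, eps; split => //; first by rewrite invr_ge0 ltW.
have h1 : \forall th \near (0 : R), forall t, t \in enum 'I_T.+1 -> bounded_weight (Q th) t e^-1.
  by apply: filter_forall_seq => t; exact: he (mem_enum _ _).
have h2 : \forall th \near (0 : R), forall t, t \in enum 'I_T.+1 ->
    forall a : A t, separated_weight (Q th) a eps.
  by apply: filter_forall_seq => t; exact: heps (mem_enum _ _).
move: LYQ h1 h2; apply: filterS3 => th l h1 h2.
by split => // [t|t a]; [exact: h1 (mem_enum _ _)|exact: h2 (mem_enum _ _) a].
Qed.

Lemma regular_law_admissible :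
  exists M eps : R, [/\ 0 <= M, 0 < eps & admissible_law M eps P].
Proof.
have [||| M [eps [M0 eps0 h]]] := @uniform_constants (fun=> P).
- by move=> t; have [[M h] _] := Z_regular t; exists M; apply: (@filterE R (nbhs (0 : R))) => _; exact: h.
- by move=> t a; have [_ /(_ a)[eps eps0 h]] := Z_regular t; exists eps => //; apply: (@filterE R (nbhs (0 : R))) => _; exact: h.
- by apply: (@filterE R (nbhs (0 : R))) => _; exact: LY.
by exists M, eps; split => //; exact: (nbhs_singleton h).
Qed.

Lemma regular_path_admissible Q s : regular_submodel P Q s ->
  exists M eps : R, [/\ 0 <= M, 0 < eps, admissible_law M eps P,
    \forall th \near (0 : R)^', admissible_law M eps (Q th) &
    L2_bounded_along Q (fun=> obsY)].
Proof.
move=> [Qs Qb Qsep [K EK]].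
have mY := @measurable_obsY R T dL dA L A.
have nK : \forall th \near (0 : R), L2 (Q th) obsY /\ nrm (Q th) obsY <= Num.sqrt K.
  by apply: filterS EK => th; exact: L2_second_moment.
have [M1 [e1 [M10 e10 h1]]] := regular_law_admissible.
have [|M2 [e2 [M20 e20 h2]]] := uniform_constants Qb Qsep.
  by apply: filterS nK => th [].
exists (Num.max M1 M2), (Num.min e1 e2); split.
- by rewrite le_max M10.
- by rewrite lt_min e10.
- by apply: admissible_law_le h1; rewrite ?le_max ?ge_min lexx.
- apply: cvg_within; apply: filterS h2 => th; apply: admissible_law_le.
    by rewrite le_max lexx orbT.
  by rewrite ge_min lexx orbT.
- exists (Num.sqrt K + 1); split; first by rewrite ltr_wpDl// sqrtr_ge0.
  apply: cvg_within; apply: filterS nK => th [h3 h4]; split => //.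
  by rewrite (le_trans h4)// lerDl.
Qed.

Local Notation phi := (eif g (psi_functional g P) (alpha_o g P)).

Lemma L2_eif : L2 P phi.
Proof.
have [M [eps [M0 eps0 admP]]] := regular_law_admissible.
have mphi := measurable_eif A_finite A_discrete g_measurable M0 eps0 admP.
apply: L2_ae_eq mphi _ (L2_clipped_eif A_finite A_discrete g_measurable M0 eps0 admP).
by apply: filterS (eif_ae A_finite A_discrete g_measurable M0 eps0 admP) => o ->.
Qed.

Lemma eif_mean0 : \int[P]_o phi o = 0.
Proof.
have [M [eps [M0 eps0 admP]]] := regular_law_admissible.
rewrite -(clipped_eif_mean0 A_finite A_discrete g_measurable M0 eps0 admP).
apply: ae_eq_ER; [exact: L2_measurable L2_eif| |].
  exact: L2_measurable (L2_clipped_eif A_finite A_discrete g_measurable M0 eps0 admP).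
exact: (eif_ae A_finite A_discrete g_measurable M0 eps0 admP).
Qed.

Lemma is_derive_psi_functional Q s : regular_submodel P Q s ->
  is_derive (0 : R) (1 : R) (fun th => psi_functional g (Q th)) (\int[P]_o (phi o * s o)).
Proof.
move=> regQ; have [M [eps [M0 eps0 admP admQ Yb]]] := regular_path_admissible regQ.
have [Qs _ _ _] := regQ; have [Q0 _ _] := Qs.
have cv := psi_functional_quotient A_finite A_discrete g_measurable M0 eps0 admP Qs admQ Yb.
have e : \int[P]_o (phi o * s o) = \int[P]_o (clipped_eif g M eps P o * s o).
  have ms := L2_measurable (score_L2 Qs).
  apply: ae_eq_ER; [exact: measurable_funM (L2_measurable L2_eif) ms| |].
    apply: measurable_funM ms; apply: L2_measurable.
    exact: (L2_clipped_eif A_finite A_discrete g_measurable M0 eps0 admP).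
  by apply: filterS (eif_ae A_finite A_discrete g_measurable M0 eps0 admP) => o ->.
have {}cv : h^-1 *: (((fun th => psi_functional g (Q th)) \o shift 0) (h *: (1 : R)) -
    psi_functional g (Q 0)) @[h --> (0 : R)^'] --> \int[P]_o (phi o * s o).
  rewrite e; apply: cvg_trans cv; apply: near_eq_cvg; apply: nearW => h.
  rewrite (psi_functional_eq_law g Q0) /= /shift addr0.
  rewrite -[h *: 1]/(h * 1) mulr1 -[RHS]/(h^-1 * _) mulrC.
  by [].
by apply: DeriveDef; [apply/cvg_ex; exists (\int[P]_o (phi o * s o))|exact: cvg_lim cv].
Qed.

End regular_paths.

(** * Tilted paths and uniqueness *)

Lemma probability_of_density {d} {X : measurableType d} {R : realType}
    (P : probability X R) (f : X -> R) :
  (forall x, 0 <= f x) -> L1 P f -> \int[P]_x f x = 1 ->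
  exists Q : probability X R, forall B, Q B = (\int[P]_(x in B) (f x)%:E)%E.
Proof.
move=> f0 Lf f1; pose m (B : set X) := (\int[P]_(x in B) (f x)%:E)%E.
have m0 : m set0 = 0%E by rewrite /m integral_set0.
have m_ge0 B : (0 <= m B)%E by apply: integral_ge0 => x _; rewrite lee_fin.
have m_add : semi_sigma_additive m.
  move=> F mF tF mUF; rewrite /m integral_bigcup//=; last first.
    exact: integrableS Lf.
  by apply: is_cvg_ereal_nneg_natsum_cond => n _ _; exact: m_ge0.
pose mm : {measure set X -> \bar R} := HB.pack m (isMeasure.Build _ _ _ m m0 m_ge0 m_add).
have mT : mm setT = 1%E by rewrite /= /m -ER_EFin// f1.
pose Q : probability X R :=
  HB.pack m (isMeasure.Build _ _ _ m m0 m_ge0 m_add) (Measure_isProbability.Build _ _ R mm mT).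
by exists Q.
Qed.

Section tilting.
Context {d : measure_display} {O : measurableType d} {R : realType}.
Variables (P Q : probability O R) (s : O -> R) (c : R).
Hypothesis ms : measurable_fun [set: O] s.
Hypothesis s1 : forall x, `|s x| <= 1.
Hypothesis c2 : `|c| <= 2^-1.
Hypothesis QE : forall B, Q B = (\int[P]_(x in B) (1 + c * s x)%:E)%E.

Let f x := 1 + c * s x.

Let mf : measurable_fun [set: O] f.
Proof. by apply: measurable_funD => //; exact: measurable_funM. Qed.

(** The density of the tilted law is bounded and bounded away from 0, so P and Q share their null
    sets, and integrability under P carries over to Q. *)
Lemma tilt_bounds x : 2^-1 <= 1 + c * s x <= 2.
Proof.
have : `|c * s x| <= 2^-1 by rewrite normrM -[2^-1]mulr1; exact: ler_pM.
by rewrite ler_norml => /andP[? ?]; apply/andP; split; lra.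
Qed.

Let f0 x : 0 <= f x. Proof. by rewrite /f; have /andP[? _] := tilt_bounds x; lra. Qed.

Lemma tilt_ae (G : set O) : {ae P, forall x, G x} -> {ae Q, forall x, G x}.
Proof.
move=> [N [mN N0 sub]]; exists N; split => //.
rewrite QE null_set_integral//; apply/measurable_EFinP; exact: measurable_funTS mf.
Qed.

Lemma untilt_ae (G : set O) : {ae Q, forall x, G x} -> {ae P, forall x, G x}.
Proof.
move=> [N [mN N0 sub]]; exists N; split => //; apply/eqP.
rewrite eq_le measure_ge0 andbT -(@lee_pmul2l _ (2^-1)%:E)//.
rewrite mule0 -N0 QE -integral_cst//.
apply: ge0_le_integral => //.
- by move=> x _; rewrite lee_fin.
- by apply/measurable_EFinP; exact: measurable_funTS mf.
- by move=> x _; rewrite lee_fin; have /andP[] := tilt_bounds x.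
Qed.

Lemma tilt_L1 h : L1 P h -> L1 Q h.
Proof.
move=> Lh; have mh := L1_measurable Lh; apply/integrableP; split; first exact/measurable_EFinP.
rewrite (ge0_integral_density mf f0 (fun B _ => QE B))//; last first.
  by apply: measurableT_comp => //; exact/measurable_EFinP.
have /integrableP[_] := L1Z 2 (L1_norm Lh); apply: le_lt_trans.
apply: ge0_le_integral => //.
- by move=> x _; rewrite mule_ge0// lee_fin.
- apply: emeasurable_funM; last exact/measurable_EFinP.
  by apply: measurableT_comp => //; exact/measurable_EFinP.
- apply: measurableT_comp => //; apply/measurable_EFinP.
  by apply: measurable_funM => //; exact: measurableT_comp.
- move=> x _; rewrite /= normrM normr_id -EFinM lee_fin mulrC ler_wpM2r//.
  by have /andP[_] := tilt_bounds x; rewrite ger0_norm.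
Qed.

Lemma ER_tilt h : L1 P h -> \int[Q]_x h x = \int[P]_x (h x * (1 + c * s x)).
Proof. by move=> /tilt_L1; exact: ER_density. Qed.

Lemma tilt_second_moment (h : O -> R) : L2 P h ->
  ('E_Q[fun x => (h x ^+ 2)%R] <= (2 * \int[P]_x (h x ^+ 2))%:E)%E.
Proof.
move=> [mh Lh]; rewrite unlock -ER_EFin; last exact: tilt_L1.
have Lhf := L1_density mf f0 (fun B _ => QE B) (tilt_L1 Lh).
rewrite lee_fin ER_tilt// -ERZ//; apply: ER_le => //; first exact: L1Z.
move=> x; rewrite mulrC ler_wpM2r ?sqr_ge0//.
by have /andP[] := tilt_bounds x.
Qed.

(** Subtracting the two defining identities shows that r - r' is the regression under P of
    [W = - c s (X - r')], which is bounded by [2 C |c|]. *)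
Lemma tilt_cond_mean {dS} {S : measurableType dS} (H : O -> S) (X : O -> R) (C : R) :
  measurable_fun [set: O] H -> measurable_fun [set: O] X ->
  {ae P, forall x, `|X x| <= C} ->
  {ae P, forall x, `|cond_mean P H X (H x) - cond_mean Q H X (H x)| <= 2 * C * `|c|}.
Proof.
move=> mH mX XC.
have LX : L1 P X by apply: ae_L1_le mX XC _; exact: L2_L1 (L2_cst P C).
have rX := cond_meanP mH LX; have rX' := cond_meanP mH (tilt_L1 LX).
have r'C := untilt_ae (cond_mean_bounded mH (tilt_L1 LX) rX' (tilt_ae XC)).
set r := cond_mean P H X in rX *; set r' := cond_mean Q H X in rX' r'C *.
have [mr Lr _] := rX; have [mr' _ _] := rX'.
have mHr := measurable_comp_H mH mr; have mHr' := measurable_comp_H mH mr'.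
have Lr' : L1 P (fun x => r' (H x)).
  by apply: ae_L1_le mHr' r'C _; exact: L2_L1 (L2_cst P C).
pose W x := - c * s x * (X x - r' (H x)).
have LXr := L1B LX Lr'.
have LW : L1 P W.
  apply: (L1_le _ _ (L1Z `|c| (L1_norm LXr))).
    by apply: measurable_funM; [exact: measurable_funM|exact: measurable_funB].
  by move=> x; rewrite /W !normrM normrN ler_wpM2r// -[leRHS]mulr1 ler_wpM2l.
have WC : {ae P, forall x, `|W x| <= 2 * C * `|c|}.
  apply: filterS2 XC r'C => x h1 h2; rewrite /W !normrM normrN mulrC.
  apply: ler_pM => //; first by apply: (le_trans (ler_normB _ _)); lra.
  by rewrite -[leRHS]mulr1 ler_wpM2l.
have Lrr := L1B Lr Lr'.
have cmW : is_cond_mean P H W (fun h => r h - r' h).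
  split => //; first exact: measurable_funB.
  move=> B mB; rewrite -!ER_indic//; congr EFin.
  have e1 := is_cond_mean_indic mH LX rX mB.
  have e2 := is_cond_mean_indic mH (tilt_L1 LX) rX' mB.
  have i2 := L1_indic_mul mH mB LXr.
  rewrite ER_tilt// in e2.
  have i2' := L1_density mf f0 (fun B _ => QE B) (tilt_L1 i2).
  have i1 := L1_indic_mul mH mB (L1B LX Lr).
  have iW := L1_indic_mul mH mB LW.
  have := ERD (L1B i2' i1) iW.
  rewrite (ERB i2' i1) e1 e2 subrr add0r => <-.
  by apply: eq_ER => x; rewrite /W /f; ring.
exact: (cond_mean_bounded mH LW cmW WC).
Qed.

End tilting.

(** With r the root of 1 + x, one has x = (r - 1)(r + 1), so the remainder is - (r - 1)^2 / 2, and
    (r + 1)^4 >= 1. *)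
Lemma sqrt1D_remainder {R : realType} (x : R) : -1 <= x ->
  (Num.sqrt (1 + x) - 1 - x / 2) ^+ 2 <= x ^+ 4.
Proof.
move=> x1; have x0 : 0 <= 1 + x by lra.
have r0 : 0 <= Num.sqrt (1 + x) by exact: sqrtr_ge0.
have r2 : Num.sqrt (1 + x) ^+ 2 = 1 + x by exact: sqr_sqrtr.
set r := Num.sqrt _ in r0 r2 *.
have -> : x = (r - 1) * (r + 1) by rewrite -subr_sqr r2; ring.
have -> : (r - 1 - (r - 1) * (r + 1) / 2) ^+ 2 = (r - 1) ^+ 4 / 4 by field.
rewrite exprMn; have h : 1 <= (r + 1) ^+ 4 by apply: exprn_ege1; lra.
have h4 : 0 <= (r - 1) ^+ 4 by rewrite exprn_even_ge0.
by nra.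
Qed.

Section tilted_path.
Context {d : measure_display} {O : measurableType d} {R : realType}.
Variables (P : probability O R) (s : O -> R) (Q : R -> probability O R).
Hypothesis ms : measurable_fun [set: O] s.
Hypothesis s1 : forall x, `|s x| <= 1.
Hypothesis QE : forall th B, Q th B = (\int[P]_(x in B) (1 + clip 2^-1 th * s x)%:E)%E.

(** Clipping th at 1/2 makes 1 + th s nonnegative for every real th, as a path indexed by the whole
    line requires; near 0 the path is the plain tilt. *)
Lemma near0_clip (e : R) : 0 < e -> \forall th \near (0 : R), `|th| <= e /\ clip 2^-1 th = th.
Proof.
move=> e0; have e'0 : 0 < Num.min e 2^-1 by rewrite lt_min e0 invr_gt0/=.
have : \forall th \near (0 : R), `|th| <= Num.min e 2^-1.
  by apply: nbhs0_le.
by apply: (@filterS R (nbhs (0 : R))) => th; rewrite le_min => /andP[h1 h2]; split => //; exact: clip_id.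
Qed.

Lemma qmd_tilted_path : qmd_submodel P Q s.
Proof.
have c2 th : `|clip 2^-1 th : R| <= 2^-1 by apply: clip_bounded; rewrite invr_ge0.
have clip0 : clip 2^-1 (0 : R) = 0 by apply: clip_id; rewrite normr0 invr_ge0.
split.
- move=> B mB; rewrite QE clip0.
  under eq_integral do rewrite mul0r addr0.
  by rewrite integral_cst// mul1e.
- by apply/L2_Lfun; exact: (L2_bounded P ms s1).
(* P dominates the path; the squared remainder integrates to at most th^4 near 0, which leaves th^2
   after division. *)
exists P, (fun th x => 1 + clip 2^-1 th * s x); split.
  apply: (@filterE R (nbhs (0 : R))) => th; split => //.
    by apply: measurable_funD => //; exact: measurable_funM.
  by move=> x; have /andP[h _] := tilt_bounds s1 (c2 th) x; rewrite (le_trans _ h)// invr_ge0.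
pose I th := \int[P]_x ((Num.sqrt (1 + clip 2^-1 th * s x) - Num.sqrt (1 + clip 2^-1 0 * s x)
  - th / 2 * s x * Num.sqrt (1 + clip 2^-1 0 * s x)) ^+ 2).
have mI th : measurable_fun [set: O] (fun x => (Num.sqrt (1 + th * s x) - 1 - th / 2 * s x) ^+ 2).
  apply: measurable_funX; apply: measurable_funB; last exact: measurable_funM.
  apply: measurable_funB => //; apply: measurableT_comp; first by apply: continuous_measurable_fun; exact: sqrt_continuous.
  by apply: measurable_funD => //; exact: measurable_funM.
have bI th x : `|th| <= 2^-1 -> (Num.sqrt (1 + th * s x) - 1 - th / 2 * s x) ^+ 2 <= th ^+ 4.
  move=> th2; have := tilt_bounds s1 th2 x => /andP[h _].
  have -> : th / 2 * s x = th * s x / 2 by ring.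
  apply: (le_trans (sqrt1D_remainder _)); first by lra.
  rewrite exprMn -[leRHS]mulr1 ler_wpM2l ?exprn_even_ge0//.
  by rewrite -[s x ^+ 4]ger0_norm ?exprn_even_ge0// normrX exprn_ile1.
have EI th : `|th| <= 2^-1 -> (\int[P]_x ((Num.sqrt (1 + clip 2^-1 th * s x) -
    Num.sqrt (1 + clip 2^-1 0 * s x)
  - th / 2 * s x * Num.sqrt (1 + clip 2^-1 0 * s x)) ^+ 2)%:E)%E = (I th)%:E /\ 0 <= I th <= th ^+ 4.
  move=> th2; have E x : (Num.sqrt (1 + clip 2^-1 th * s x) - Num.sqrt (1 + clip 2^-1 0 * s x)
  - th / 2 * s x * Num.sqrt (1 + clip 2^-1 0 * s x)) ^+ 2 =
    (Num.sqrt (1 + th * s x) - 1 - th / 2 * s x) ^+ 2.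
    by rewrite (clip_id th2) clip0 mul0r addr0 sqrtr1 mulr1.
  have LI : L1 P (fun x => (Num.sqrt (1 + th * s x) - 1 - th / 2 * s x) ^+ 2).
    by apply: (L1_bounded P (mI th)) => x; rewrite ger0_norm ?sqr_ge0//; exact: bI.
  split; first by rewrite /I ER_EFin//; apply: eq_L1 LI => x; rewrite E.
  rewrite /I (@eq_ER _ _ _ _ _ _ E) ER_ge0/=; last by move=> x; exact: sqr_ge0.
  by rewrite -[leRHS](ER_cst P) ER_le// => [|x]; [exact: L2_L1 (L2_cst P _)|exact: bI].
have cv1 : th ^- 2 * I th @[th --> (0 : R)^'] --> (0 : R).
  have cv2 : `|th| * `|th| @[th --> (0 : R)^'] --> (0 : R).
    rewrite -[X in _ --> X](mul0r (0 : R)); apply: cvgM; exact: cvg_norm_dnbhs0.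
  apply: (squeeze_cvgr _ (cvg_cst (0 : R)) cv2); near=> th.
  have [th2 _] : `|th| <= 2^-1 /\ clip 2^-1 th = th.
    by near: th; apply: cvg_within; apply: near0_clip; rewrite invr_gt0.
  have th0 : th != 0 by near: th; exact: nbhs_dnbhs_neq.
  have [_ /andP[i0 i4]] := EI th th2.
  rewrite mulr_ge0 ?invr_ge0 ?sqr_ge0//= mulrC ler_pdivrMr ?exprn_even_gt0//.
  by apply: (le_trans i4); rewrite -expr2 real_normK ?num_real// -exprD.
have cv : (th ^- 2 * I th)%:E @[th --> (0 : R)^'] --> (0 : R)%:E.
  by apply: cvg_EFin; [exact: nearW|exact: cv1].
apply: cvg_trans cv; apply: near_eq_cvg.
near=> th; have [th2 _] : `|th| <= 2^-1 /\ clip 2^-1 th = th.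
  by near: th; apply: cvg_within; apply: near0_clip; rewrite invr_gt0.
by have [-> _] := EI th th2.
Unshelve. all: by end_near. Qed.

End tilted_path.

(** Three errors of size 2 M c: that of the mean of the product, and one from each factor of the
    product of the means. *)
Lemma cov_perturbation {R : realType} (x x' y y' z z' c M : R) :
  `|x - x'| <= 2 * M * c -> `|y - y'| <= 2 * 1 * c -> `|z - z'| <= 2 * M * c ->
  `|z| <= M -> `|y'| <= 1 -> `|x - y * z - (x' - y' * z')| <= 6 * M * c.
Proof.
move=> hx hy hz zM y1.
have -> : x - y * z - (x' - y' * z') = (x - x') - ((y - y') * z + y' * (z - z')) by ring.
apply: (le_trans (ler_normB _ _)); apply: (le_trans (lerD hx (ler_normD _ _))).
rewrite !normrM.
have h1 : `|y - y'| * `|z| <= 2 * 1 * c * M by exact: ler_pM.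
have h2 : `|y'| * `|z - z'| <= 1 * (2 * M * c) by exact: ler_pM.
lra.
Qed.

(** The condition forces 6 M c <= e / 2, so half of the separation survives; the extra 12 gives a
    positive divisor of [e] even when [M] is 0. *)
Lemma separation_perturbation {R : realType} (x y c M e : R) : 0 <= c ->
  e <= `|x| -> `|x - y| <= 6 * M * c -> (12 * M + 12) * c <= e -> e / 2 <= `|y|.
Proof. by move=> c0 ex xy ce; have := ler_normD (x - y) y; rewrite subrK; lra. Qed.

Section tilted_regular_path.
Context {R : realType} {T : nat} {dL dA : 'I_T.+1 -> measure_display}.
Context {L : forall t, measurableType (dL t)} {A : forall t, measurableType (dA t)}.
Hypothesis A_finite : forall t, finite_set [set: A t].
Hypothesis A_discrete : forall t (B : set (A t)), measurable B.

Local Notation Obs := (@obs R T dL dA L A).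
Local Notation obsH := (@obsH R T dL dA L A).
Local Notation obsZ := (@obsZ R T dL dA L A).
Local Notation obsY := (@obsY R T dL dA L A).

Variables (P : probability Obs R) (s : Obs -> R).
Hypothesis Z_regular : forall t, regular_weight P t.
Hypothesis LY : L2 P obsY.
Hypothesis ms : measurable_fun [set: Obs] s.
Hypothesis s1 : forall o, `|s o| <= 1.

Lemma tilt_cond_cov (Q : probability Obs R) (c M : R) (t : 'I_T.+1) (a : A t) :
  0 <= M -> `|c| <= 2^-1 ->
  (forall B, Q B = (\int[P]_(x in B) (1 + c * s x)%:E)%E) -> bounded_weight P t M ->
  {ae P, forall o, `|cond_cov P (obsH t) (ind_eq a) (obsZ t) (obsH t o) -
    cond_cov Q (obsH t) (ind_eq a) (obsZ t) (obsH t o)| <= 6 * M * `|c|}.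
Proof.
move=> M0 c2 QE bM; have mH := @measurable_obsH R T dL dA L A t.
have mZ : measurable_fun [set: Obs] (obsZ t) := @measurable_obsZ R T dL dA L A t.
have mi : measurable_fun [set: Obs] (@ind_eq R T dL dA L A t a) :=
  (bmfun_ind_eq A_finite A_discrete a).1.
have i1 o : `|@ind_eq R T dL dA L A t a o| <= 1.
  by rewrite /ind_eq; case: (_ == _); rewrite ?normr1// normr0.
have iZ : {ae P, forall o, `|ind_eq a o * obsZ t o| <= M}.
  by apply: filterS bM => o h; rewrite normrM -[leRHS]mul1r; exact: ler_pM.
have LZ : L1 P (obsZ t) by apply: ae_L1_le mZ bM _; exact: L2_L1 (L2_cst P M).
have Li : L1 P (ind_eq a) := L1_bounded P mi i1.
have h1 := tilt_cond_mean ms s1 c2 QE mH (measurable_funM mi mZ) iZ.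
have h2 := tilt_cond_mean ms s1 c2 QE mH mi (aeW P i1).
have h3 := tilt_cond_mean ms s1 c2 QE mH mZ bM.
have h4 := cond_mean_bounded mH LZ (cond_meanP mH LZ) bM.
have LiQ := tilt_L1 ms s1 c2 QE Li.
have h5 := untilt_ae ms s1 c2 QE
  (cond_mean_bounded mH LiQ (cond_meanP mH LiQ) (aeW Q i1)).
have h45 : {ae P, forall o, `|cond_mean P (obsH t) (obsZ t) (obsH t o)| <= M /\
    `|cond_mean Q (obsH t) (ind_eq a) (obsH t o)| <= 1}.
  by apply: filterS2 h4 h5.
have h23 : {ae P, forall o,
    `|cond_mean P (obsH t) (ind_eq a) (obsH t o) -
      cond_mean Q (obsH t) (ind_eq a) (obsH t o)| <= 2 * 1 * `|c| /\
    `|cond_mean P (obsH t) (obsZ t) (obsH t o) -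
      cond_mean Q (obsH t) (obsZ t) (obsH t o)| <= 2 * M * `|c|}.
  by apply: filterS2 h2 h3.
apply: filterS3 h1 h23 h45 => o b1 [b2 b3] [b4 b5].
exact: cov_perturbation b1 b2 b3 b4 b5.
Qed.

Lemma tilted_path_regular : \int[P]_o s o = 0 -> exists Q, regular_submodel P Q s.
Proof.
move=> s0; have c2 th : `|clip 2^-1 th : R| <= 2^-1 by apply: clip_bounded; rewrite invr_ge0.
have /choice[Q QE] : forall th : R, exists Q : probability Obs R,
    forall B, Q B = (\int[P]_(x in B) (1 + clip 2^-1 th * s x)%:E)%E.
  move=> th; apply: probability_of_density.
  - by move=> x; have /andP[h _] := tilt_bounds s1 (c2 th) x; rewrite (le_trans _ h)// invr_ge0.
  - by apply: L1D; [exact: L2_L1 (L2_cst P 1)|apply: L1Z; exact: (L1_bounded P ms s1)].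
  - have Ls := L1_bounded P ms s1.
    rewrite ERD; [|exact: L2_L1 (L2_cst P 1)|exact: L1Z].
    by rewrite ERZ// s0 mulr0 addr0 ER_cst.
exists Q; split.
- exact: qmd_tilted_path.
- move=> t; have [[M bM] _] := Z_regular t; exists M.
  apply: (@filterE R (nbhs (0 : R))) => th; rewrite /bounded_weight.
  by apply: (tilt_ae ms (QE th)); exact: bM.
- move=> t a; have [[M bM] /(_ a)[eps eps0 sep]] := Z_regular t.
  exists (eps / 2); first by rewrite divr_gt0.
  pose M' := Num.max 0 M; have M'0 : 0 <= M' by rewrite le_max lexx.
  have bM' : bounded_weight P t M'.
    by apply: filterS bM => o h; rewrite (le_trans h)// le_max lexx orbT.
  have e0 : 0 < eps / (12 * M' + 12) by rewrite divr_gt0// ltr_wpDl// mulr_ge0.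
  apply: (@filterS R (nbhs (0 : R)) _ _ _ _ (near0_clip e0)) => th [the thE].
  have h := tilt_cond_cov a M'0 (c2 th) (QE th) bM'.
  rewrite /separated_weight; apply: (tilt_ae ms (QE th)); apply: filterS2 sep h => o.
  rewrite thE; set x := cond_cov _ _ _ _ _; set y := cond_cov _ _ _ _ _ => h1 h2.
  have : (12 * M' + 12) * `|th| <= eps by rewrite mulrC -ler_pdivlMr// ltr_wpDl// mulr_ge0.
  exact: (separation_perturbation (normr_ge0 th) h1 h2).
- exists (2 * \int[P]_o (obsY o ^+ 2)); apply: (@filterE R (nbhs (0 : R))) => th.
  exact: (tilt_second_moment ms s1 (c2 th) (QE th) LY).
Qed.

End tilted_regular_path.

(** * Uniqueness of the influence function *)

Section uniqueness.
Context {d : measure_display} {O : measurableType d} {R : realType}.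
Variable P : probability O R.

Lemma ae_eq0_of_bounded_scores (D : O -> R) : L2 P D -> \int[P]_x D x = 0 ->
  (forall s : O -> R, measurable_fun [set: O] s -> (forall x, `|s x| <= 1) -> \int[P]_x s x = 0 ->
     \int[P]_x (D x * s x) = 0) ->
  {ae P, forall x, D x = 0}.
Proof.
move=> LD D0 Ds; have mD := L2_measurable LD.
pose B : set O := [set x | 0 < D x].
have mB : measurable B.
  rewrite -[X in measurable X]setTI (_ : B = (fun x => 0 < D x) @^-1` [set true]).
    have m0 : measurable_fun [set: O] (fun=> 0 : R) by exact: measurable_cst.
    exact: (measurable_fun_ltr m0 mD measurableT).
  by rewrite /B; apply/seteqP; split => x /=.
have mi : measurable_fun [set: O] (\1_B : O -> R) by exact: measurable_indic.
have i01 x : 0 <= (\1_B x : R) <= 1.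
  by rewrite indicE; case: (_ \in _); rewrite ?lexx ?ler01.
have bi x : `|\1_B x : R| <= 1 by have /andP[h1 h2] := i01 x; rewrite ger0_norm.
pose p := \int[P]_x (\1_B x : R).
have Li := L1_bounded P mi bi.
have p0 : 0 <= p by apply: ER_ge0 => x; have /andP[] := i01 x.
have p1 : p <= 1.
  rewrite -[leRHS](ER_cst P); apply: ER_le => //; exact: L2_L1 (L2_cst P 1).
have Lc := L2_L1 (L2_cst P p).
have E : \int[P]_x (D x * (\1_B x - p)) = 0.
  apply: Ds.
  - exact: measurable_funB.
  - by move=> x; have /andP[h1 h2] := i01 x; rewrite ler_norml; apply/andP; split; lra.
  - by rewrite ERB// ER_cst subrr.
have LDi := L2_mul LD (L2_bounded P mi bi).
have E1 : \int[P]_x (D x * \1_B x) = 0.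
  have i2 := L1Z p (L2_L1 LD).
  have bw x : `|\1_B x - p| <= 1.
    by have /andP[h1 h2] := i01 x; rewrite ler_norml; apply/andP; split; lra.
  have Lw : L2 P (fun x => \1_B x - p).
    by apply: (L2_bounded P _ bw); exact: measurable_funB.
  have := ERD (L2_mul LD Lw) i2; rewrite E (ERZ _ (L2_L1 LD)) D0 mulr0 addr0 => <-.
  by apply: eq_ER => x; ring.
(* D times the indicator is the positive part, so its vanishing mean makes the positive part null;
   as D itself has mean 0, the negative part is null too. *)
have pos x : D x * \1_B x = Num.max (D x) 0.
  rewrite indicE; case: (boolP (x \in B)); rewrite ?inE ?notin_setE /B /=.
    by move=> /ltW/max_idPl ->; rewrite mulr1.
  by move=> /negP; rewrite -leNgt => /max_idPr ->; rewrite mulr0.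
have a1 : {ae P, forall x, D x * \1_B x = 0}.
  by apply: ER_ge0_eq0 => // [x|]; rewrite ?E1// pos le_max lexx orbT.
have a2 : {ae P, forall x, D x * \1_B x - D x = 0}.
  apply: ER_ge0_eq0; first exact: L1B LDi (L2_L1 LD).
    by move=> x; rewrite pos subr_ge0 le_max lexx.
  by rewrite ERB// ?E1 ?D0 ?subrr//; exact: L2_L1.
by apply: filterS2 a1 a2 => x -> /eqP; rewrite sub0r oppr_eq0 => /eqP.
Qed.

End uniqueness.

Theorem theoremA2 (R : realType) (T : nat)
    (dL dA dU : 'I_T.+1 -> measure_display)
    (L : forall t, measurableType (dL t))
    (A : forall t, measurableType (dA t))
    (U : forall t, measurableType (dU t))
    (A_finite : forall t, finite_set [set: A t])
    (A_discrete : forall t (B : set (A t)), measurable B)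
    (dW : measure_display) (Omega : measurableType dW) (Pr : probability Omega R)
    (Lv : forall t, {RV Pr >-> L t})
    (Uv : forall t, {RV Pr >-> U t})
    (Z : 'I_T.+1 -> {RV Pr >-> R})
    (Av : forall t, {RV Pr >-> A t})
    (Y : {RV Pr >-> R})
    (Ypot : (forall t, A t) -> {RV Pr >-> R})
    (g : forall t, hist L A t -> A t)
    (O := observed Z Av Lv Y)
    (P := distribution Pr O : probability (obs L A) R)
    (consistency : {ae Pr, forall w, Y w = Ypot (fun t => Av t w) w})
    (latent_ignorability : forall (t : 'I_T.+1) (a : forall s, A s),
       cond_indep Pr (fun w => (obsH t (O w), latent_past Uv t w))
         (fun w => (Z t w, Av t w)) (Y_from Ypot Av a t))
    (IV_independence : forall t : 'I_T.+1,
       cond_indep Pr (fun w => obsH t (O w)) (Z t) (latent_past Uv t))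
    (Z_regular : forall t, regular_weight P t)
    (Y_L2 : (Y : Omega -> R) \in Lfun Pr 2%:E)
    (g_measurable : forall t, measurable_fun [set: hist L A t] (g t)) :
  is_EIF regular_submodel (psi_functional g) P
    (eif g (psi_functional g P) (alpha_o g P)).
Proof.
have LY : L2 P (@obsY R T dL dA L A).
  have mY := @measurable_obsY R T dL dA L A.
  have [_ /integrableP[_ Yoo]] := (L2_Lfun Pr Y).2 Y_L2.
  split => //; apply/integrableP; split; first exact/measurable_EFinP/measurable_funX.
  rewrite ge0_integral_distribution//.
  by apply: measurableT_comp => //; exact/measurable_EFinP/measurable_funX.
have Leif := L2_eif A_finite A_discrete g_measurable Z_regular LY.
have eif0 := eif_mean0 A_finite A_discrete g_measurable Z_regular LY.
have deif := is_derive_psi_functional A_finite A_discrete g_measurable Z_regular LY.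
set phi := eif _ _ _ in Leif eif0 deif *.
split; first by split; [exact/L2_Lfun|rewrite unlock -ER_EFin ?eif0//; exact: L2_L1|exact: deif].
move=> phi' [/L2_Lfun Lphi' phi'0 dphi'].
have {}phi'0 : \int[P]_o phi' o = 0.
  by move: phi'0; rewrite unlock -ER_EFin => [[]|]; last exact: L2_L1.
have : {ae P, forall o, phi' o - phi o = 0}.
  apply: ae_eq0_of_bounded_scores; first exact: L2B.
    by rewrite ERB; [rewrite phi'0 eif0 subrr|exact: L2_L1|exact: L2_L1].
  move=> s ms s1 s0.
  have [Q Qs] := tilted_path_regular A_finite A_discrete Z_regular LY ms s1 s0.
  have Ls := L2_bounded P ms s1.
  rewrite (@eq_ER _ _ _ _ _ (fun o => phi' o * s o - phi o * s o)); last first.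
    by move=> o; rewrite mulrBl.
  rewrite ERB; [|exact: L2_mul|exact: L2_mul].
  apply/eqP; rewrite subr_eq0; apply/eqP.
  (* Both pairings with s are the derivative of psi along one and the same tilted path, hence
     equal. *)
  have d1 := deif Q s Qs; have d2 := dphi' Q s Qs.
  by rewrite -(@derive_val _ _ _ _ _ _ _ d1) -(@derive_val _ _ _ _ _ _ _ d2).
by apply: filterS => o /eqP; rewrite subr_eq0 => /eqP.
Qed.
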